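(* For every constant $\alpha<\frac{4}{7}$ there is a constant $d_0$ such that the following holds. Let $p=\frac{d}{n}$ where $d_0\le d\le n^{1/4}$ ($d$ may depend on $n$). Then with high probability $$\chi_g(G_{n,p})\ \ge\ \frac{\alpha d}{\ln d}.$$ For every constant $\alpha>12$ there is a constant $d_0$ such that, for $p=\frac dn$ with $d_0\le d\le n^{1/4}$, with high probability $$\chi_g(G_{n,p})\ \le\ \frac{\alpha d}{\ln d}.$$
   Context: Coloring game: given a graph $G$ and a positive integer $k$, two players A and B alternately (A moves first) choose an uncolored vertex and assign it a color from $\{1,\dots,k\}$ so that the partial coloring stays proper (adjacent vertices get different colors). A wins if eventually all vertices are colored; B wins if at some point some uncolored vertex has all $k$ colors appearing among its neighbors. The game chromatic number $\chi_g(G)$ is the least $k$ for which A has a winning strategy. $G_{n,p}$ is the binomial random graph on vertex set $[n]=\{1,\dots,n\}$ with each edge present independently with probability $p$. ''With high probability'' (w.h.p.) means with probability tending to $1$ as $n\to\infty$. *)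

(* Defs.v *)
From Stdlib Require Import Reals.
From mathcomp Require Import all_boot.

Set Implicit Arguments.
Unset Strict Implicit.
Unset Printing Implicit Defensive.

Section Game.
Variables (n k : nat) (adj : rel 'I_n).

Definition coloring := {ffun 'I_n -> option 'I_k}.

Definition empty_coloring : coloring := [ffun _ => None].

Definition upd (c : coloring) (v : 'I_n) (a : 'I_k) : coloring :=
  [ffun u => if u == v then Some a else c u].

Definition legal (c : coloring) (v : 'I_n) (a : 'I_k) : bool :=
  (c v == None) && [forall u, adj u v ==> (c u != Some a)].

Definition blocked (c : coloring) (v : 'I_n) : bool :=
  (c v == None) && [forall a : 'I_k, [exists u, adj u v && (c u == Some a)]].

Definition all_colored (c : coloring) : bool := [forall v, c v != None].

(* Awins m turnA c : player A has a winning strategy from position c, with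
   A to move iff turnA, using at most m further moves (m = fuel; each move
   colours one vertex so fuel n suffices from the empty colouring). *)
Fixpoint Awins (m : nat) (turnA : bool) (c : coloring) : bool :=
  if [exists v, blocked c v] then false
  else if all_colored c then true
  else match m with
       | 0 => false
       | m'.+1 =>
         if turnA then
           [exists v, [exists a, legal c v a && Awins m' false (upd c v a)]]
         else
           [forall v, [forall a, legal c v a ==> Awins m' true (upd c v a)]]
       end.

Definition A_wins_game : bool := Awins n true empty_coloring.
End Game.

(* game chromatic number: least k such that A wins with k colours.
   We search k in 0..n (A always wins with k = n colours, since a vertex has
   at most n-1 neighbours), returning n+1 if none were found (never happens). *)
Definition game_chromatic_number (n : nat) (adj : rel 'I_n) : nat :=
  find (fun k => @A_wins_game n k adj) (iota 0 n.+1).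

Definition valid_edge_set (n : nat) (S : {set 'I_n * 'I_n}) : bool :=
  [forall e in S, (e.1 < e.2)%N].

Definition graph_of (n : nat) (S : {set 'I_n * 'I_n}) : rel 'I_n :=
  fun u v => ((u, v) \in S) || ((v, u) \in S).

Definition npairs (n : nat) : nat := 'C(n, 2).

Definition Gnp_prob (n : nat) (p : R) (P : rel 'I_n -> bool) : R :=
  foldr Rplus R0
    (map (fun S : {set 'I_n * 'I_n} =>
            if valid_edge_set S && P (graph_of S)
            then Rmult (pow p #|S|) (pow (Rminus R1 p) (npairs n - #|S|))
            else R0)
         (enum {set 'I_n * 'I_n})).

Definition Rleb (x y : R) : bool := if Rle_dec x y then true else false.

(* Main.v *)
(** Lower bound. Let B always colour a vertex which still has many available
    colours. As A must win after every choice of colour, a win of A forces the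
    number of proper k-colourings of the graph to be at least the product of the
    numbers of colours available to B during his first T moves. With high
    probability every partial colouring of 2T vertices leaves some vertex about
    (k/4) (1-p)^(2T/k) colours, and for k < (4/7) d / ln d the expected number of
    proper colourings is much smaller than the resulting product.

    Upper bound. With k = floor (12 d / ln d) colours, A colours a vertex with the
    fewest available colours until critical vertices, with boundedly many
    available colours, appear. These, together with a exists_closed_superset of bounded relative
    size, receive private lists of available colours, disjoint for any two
    vertices which one move of B could harm at the same time. Each move of B then
    damages at most one list, and A answers by colouring its owner from it. Few
    vertices become critical: in a descending ladder of ten thresholds, a vertex
    passing from one threshold to the next has many neighbours among the vertices
    coloured since the position in which all vertices were above the former, and
    sparsity of small vertex sets shrinks the number of such vertices by a power
    of d at each level. *)

From Stdlib Require Import Reals.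
From mathcomp Require Import all_boot all_order all_algebra.
From mathcomp Require Import Rstruct.
From mathcomp Require Import zify ring lra.
Require Import Defs.

Set Implicit Arguments.
Unset Strict Implicit.
Unset Printing Implicit Defensive.

(** Two scales have to be reconciled in the upper bound. The union bound over all partial colourings
    leaves about [n / d^(3/4)] vertices short of colours, while the lists need sets spanning at most
    3/2 edges per vertex, which the first moment provides only for sizes well below [n / d^3]. The
    ladder closes this gap, each of its ten levels gaining about [d^(3/10)]. The small constants
    hang together as follows. The set of owners of lists is closed under adding uncoloured vertices
    whose [connset] has 18 or more elements; [cset_count] (18 against 6) then leaves at most a third
    of it non-critical, so the critical vertices control its size. A vertex outside has at most 17
    such elements, and an order in which each new owner has at most 6 with respect to earlier new
    owners raises this to 23. A list has 23 + 2 colours, so that one is left after one has been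
    spoiled, and it avoids the lists of at most 23 + 23 * 23 = 552 others. *)

(** * Positions of the game and available colours *)

Section GameBasics.
Variables (n k : nat) (adj : rel 'I_n).
Notation col := (coloring n k).
Implicit Types (c : col) (v u z : 'I_n) (a i : 'I_k).

Definition uncolored c : {set 'I_n} := [set v | c v == None].
Definition avail c v : {set 'I_k} :=
  [set a | [forall u, adj u v ==> (c u != Some a)]].
Definition subcol c c' := forall v, c v != None -> c' v = c v.

Lemma in_uncolored c v : (v \in uncolored c) = (c v == None).
Proof. by rewrite inE. Qed.

Lemma legalE c v a : legal adj c v a = (v \in uncolored c) && (a \in avail c v).
Proof. by rewrite /legal !inE. Qed.

Lemma blockedE c v : blocked adj c v = (v \in uncolored c) && (avail c v == set0).
Proof.
rewrite /blocked inE; case: (c v == None) => //=.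
apply/forallP/eqP => [h|h a].
  apply/setP => a; rewrite !inE; apply/negbTE/forallP => h'.
  have /existsP[u /andP[au cu]] := h a.
  by have := h' u; rewrite au cu.
have := in_set0 a; rewrite -h inE => /negbT/forallPn[u].
rewrite negb_imply negbK => hu; by apply/existsP; exists u.
Qed.

Lemma uncolored_upd c v a : uncolored (upd c v a) = uncolored c :\ v.
Proof.
by apply/setP => u; rewrite !inE ffunE; case: (u == v).
Qed.

Lemma availP c v a : reflect (forall u, adj u v -> c u <> Some a) (a \in avail c v).
Proof.
rewrite inE; apply: (iffP forallP) => h u.
  by move=> auv; have := h u; rewrite auv => /eqP.
by apply/implyP => auv; apply/eqP/h.
Qed.

Lemma avail_upd c z i v : z \in uncolored c ->
  avail (upd c z i) v = if adj z v then avail c v :\ i else avail c v.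
Proof.
rewrite inE => /eqP cz; apply/setP => a; apply/availP/idP => [h|].
- have ha : a \in avail c v.
    apply/availP => u auv cu; have := h u auv; rewrite ffunE; case: eqP => [e|//].
    by move: cu; rewrite e cz.
  case: ifP => // az; rewrite in_setD1 ha andbT; apply/eqP => e.
  by have := h z az; rewrite ffunE eqxx e.
- case: ifP => az.
    rewrite in_setD1 => /andP[/eqP nai /availP h] u auv; rewrite ffunE; case: eqP => [e|_].
      by case=> e'; apply: nai.
    exact: h.
  move=> /availP h u auv; rewrite ffunE; case: eqP => [e|_]; last exact: h.
  by rewrite -e auv in az.
Qed.

Lemma subcol_trans c1 c2 c3 : subcol c1 c2 -> subcol c2 c3 -> subcol c1 c3.
Proof. by move=> h1 h2 v hv; rewrite h2 ?h1. Qed.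
Lemma subcol_upd c v a : v \in uncolored c -> subcol c (upd c v a).
Proof. by rewrite inE => /eqP hv u; rewrite ffunE; case: (u =P v) => [->|]; rewrite ?hv. Qed.
Lemma subcol_unc c c' : subcol c c' -> uncolored c' \subset uncolored c.
Proof.
by move=> h; apply/subsetP => v; rewrite !inE; apply: contraLR => hv; rewrite h.
Qed.

Lemma avail_sub c c' v : subcol c c' -> avail c' v \subset avail c v.
Proof.
move=> h; apply/subsetP => a /availP ha; apply/availP => u auv cu.
by apply: (ha u auv); rewrite h cu.
Qed.

Lemma card_avail_sub c c' v : subcol c c' ->
  #|avail c v| <= #|avail c' v| + #|[set u in uncolored c :\: uncolored c' | adj u v]|.
Proof.
move=> h; set N := [set u in _ | _].
have sub : avail c v \subset avail c' v :|: [set a | [exists u in N, c' u == Some a]].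
  apply/subsetP => a /availP ha; rewrite in_setU.
  have [//|/=] := boolP (a \in avail c' v).
  rewrite inE => /forallPn[u]; rewrite negb_imply negbK => /andP[auv /eqP cu].
  rewrite inE; apply/existsP; exists u; rewrite cu eqxx andbT !inE cu auv /= !andbT.
  by apply/negPn/negP => cn; move: cu; rewrite (h _ cn) => /(ha u auv).
apply: leq_trans (subset_leq_card sub) _.
apply: leq_trans (leq_card_setU _ _) _; rewrite leq_add2l.
(* A colour already lost serves as the default value for [odflt]; for [k = 0] there would be
   none. *)
have [->|[a0 _]] := set_0Vmem [set a : 'I_k | [exists u in N, c' u == Some a]].
  by rewrite cards0.
have sub2 : [set a | [exists u in N, c' u == Some a]] \subset
   [set odflt a0 (c' u) | u in N].
  apply/subsetP => a; rewrite inE => /existsP[u /andP[uN /eqP cu]].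
  by apply/imsetP; exists u => //; rewrite cu.
exact: leq_trans (subset_leq_card sub2) (leq_imset_card _ _).
Qed.

(** The two invariants are a strategy for A in the form of safe positions, with A and with B to
    move. Every move colours one vertex, so the number of uncoloured vertices is enough fuel. *)
Lemma Awins_strategy (PA PB : col -> Prop) :
  (forall c, PA c -> (forall v, v \in uncolored c -> avail c v != set0)
     /\ (uncolored c = set0 \/ exists v a, [/\ v \in uncolored c, a \in avail c v & PB (upd c v a)])) ->
  (forall c, PB c -> (forall v, v \in uncolored c -> avail c v != set0)
     /\ forall v a, v \in uncolored c -> a \in avail c v -> PA (upd c v a)) ->
  forall m c, #|uncolored c| <= m ->
   (PA c -> Awins adj m true c) /\ (PB c -> Awins adj m false c).
Proof.
move=> hA hB.
have nb c : (forall v, v \in uncolored c -> avail c v != set0) -> [exists v, blocked adj c v] = false.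
  move=> h; apply/negbTE/existsPn => v; rewrite blockedE negb_and.
  by case: (boolP (v \in uncolored c)) => //= hv; apply: h.
have ac c : all_colored c = (uncolored c == set0).
  apply/forallP/eqP => [h|h v].
    by apply/setP => v; rewrite !inE; apply/negbTE.
  by have := in_set0 v; rewrite -h inE => ->.
elim=> [|m IH] c hm; split=> hP.
- case: (hA _ hP) => h1 h2; rewrite /= nb //= ac.
  by rewrite -cards_eq0 -leqn0 hm.
- case: (hB _ hP) => h1 h2; rewrite /= nb //= ac.
  by rewrite -cards_eq0 -leqn0 hm.
- case: (hA _ hP) => h1 h2; rewrite /= nb //= ac.
  case: eqP => // /eqP hne; case: h2 => [h0|[v [a [hv ha hPB]]]]; first by rewrite h0 eqxx in hne.
  apply/existsP; exists v; apply/existsP; exists a; rewrite legalE hv ha /=.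
  apply: (proj2 (IH _ _)) => //.
  by rewrite uncolored_upd; move: hm; rewrite (cardsD1 v) hv add1n ltnS.
- case: (hB _ hP) => h1 h2; rewrite /= nb //= ac; case: ifP => // _.
  apply/forallP => v; apply/forallP => a; apply/implyP; rewrite legalE => /andP[hv ha].
  apply: (proj1 (IH _ _)) => //; last exact: h2.
  by rewrite uncolored_upd; move: hm; rewrite (cardsD1 v) hv add1n ltnS.
Qed.

End GameBasics.

(** * Double counting *)

Lemma card_pairs1 (S T : finType) (A : {set S}) (Q : S -> T -> bool) :
  #|[set e : S * T | (e.1 \in A) && Q e.1 e.2]| = \sum_(a in A) #|[set b | Q a b]|.
Proof.
rewrite -sum1_card.
under [RHS]eq_bigr => a _ do rewrite -sum1_card.
rewrite pair_big_dep /=; apply: eq_bigl => -[a b]; by rewrite !inE.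
Qed.

Lemma card_pairs2 (S T : finType) (B : {set T}) (Q : S -> T -> bool) :
  #|[set e : S * T | (e.2 \in B) && Q e.1 e.2]| = \sum_(b in B) #|[set a | Q a b]|.
Proof.
rewrite -(card_pairs1 B (fun b a => Q a b)).
have sw : injective (fun e : T * S => (e.2, e.1)) by move=> [? ?] [? ?] [-> ->].
rewrite -(card_imset _ sw); apply: eq_card => -[a b]; rewrite inE /=.
apply/idP/imsetP => [h|[[b' a'] h [-> ->]]]; last by move: h; rewrite inE.
by exists (b, a) => //; rewrite inE.
Qed.

Lemma subset_card (T : finType) (A : {set T}) m : m <= #|A| ->
  exists B : {set T}, B \subset A /\ #|B| = m.
Proof.
move=> hm; exists [set x in take m (enum A)]; split.
  by apply/subsetP => x; rewrite inE => /mem_take; rewrite mem_enum.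
rewrite cardsE; have /card_uniqP -> : uniq (take m (enum A)) by rewrite take_uniq ?enum_uniq.
by rewrite size_takel // -cardE.
Qed.

(** * Degeneracy in locally sparse graphs *)

Section Core.
Variables (n k : nat) (adj : rel 'I_n).
Hypothesis adj_sym : symmetric adj.
Hypothesis adj_irr : irreflexive adj.
Implicit Types (K P V X : {set 'I_n}) (q u v y : 'I_n) (c : coloring n k).

(** Ordered pairs are counted, so [3 * #|X|] arcs amount to 3/2 edges per vertex. *)
Definition arcs X := #|[set e : 'I_n * 'I_n | (e.1 \in X) && ((e.2 \in X) && adj e.1 e.2)]|.

(* Members of [K] adjacent to [q], together with the neighbours of [q] through
   which [q] is at distance two from [K]. *)
Definition cset K q : {set 'I_n} :=
  [set u | adj q u && ((u \in K) || [exists y in K, (y != q) && adj u y])].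

Lemma csetS K K' q : K \subset K' -> cset K q \subset cset K' q.
Proof.
move=> /subsetP h; apply/subsetP => u; rewrite !inE => /andP[-> /=].
case/orP => [/h -> //|/existsP[y /and3P[yK yq uy]]].
by apply/orP; right; apply/existsP; exists y; rewrite (h _ yK) yq.
Qed.

(* Adding to [P] the vertices of the sets [cset P q] lying outside [P] gives a
   set spanning too many edges, since each of them has two neighbours in [P]. *)
Lemma cset_count P V t s1 :
  (forall X, #|X| <= s1 -> arcs X <= 3 * #|X|) ->
  V \subset P -> (forall q, q \in V -> t <= #|cset P q|) ->
  t.+1 * #|P| <= s1 -> t * #|V| <= 6 * #|P|.
Proof.
move=> H3 /subsetP VP ht hs.
have /fin_all_exists[C hC] : forall q, exists B : {set 'I_n},
    B \subset cset P q /\ (q \in V -> #|B| = t).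
  move=> q; have [qV|_] := boolP (q \in V); last by exists set0; rewrite sub0set.
  by have [B [h1 h2]] := subset_card (ht q qV); exists B.
pose R := [set e : 'I_n * 'I_n | (e.1 \in V) && (e.2 \in C e.1)].
have cR : #|R| = t * #|V|.
  rewrite (card_pairs1 V (fun q u => u \in C q)) (eq_bigr (fun _ => t)) ?sum_nat_const 1?mulnC // => q qV.
  by rewrite -(proj2 (hC q) qV); apply: eq_card => u; rewrite inE.
have RC e : e \in R -> [/\ e.1 \in V, adj e.1 e.2 & e.2 \in cset P e.1].
  rewrite inE => /andP[h1 h2]; have h3 := subsetP (proj1 (hC e.1)) _ h2.
  by split=> //; move: h3; rewrite inE => /andP[].
pose In := [set e in R | e.2 \in P]; pose Out := [set e in R | e.2 \notin P].
have cIO : #|In| + #|Out| = #|R|.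
  rewrite -(cardsID [set e | e.2 \in P] R); congr (_ + _); apply: eq_card => e;
    by rewrite !inE // andbC.
pose U := [set e.2 | e in Out].
have cU : #|U| <= #|Out| by exact: leq_imset_card.
have UP u : u \in U -> u \notin P.
  by case/imsetP => e; rewrite inE => /andP[_ h] ->.
pose A2 := [set e : 'I_n * 'I_n | (e.2 \in U) && ((e.1 \in P) && adj e.1 e.2)].
have cOA : #|Out| <= #|A2|.
  apply/subset_leq_card/subsetP => e eO; have [eR eP] := setIdP eO.
  have [h1 h2 h3] := RC _ eR; rewrite inE VP // h2 !andbT.
  by apply/imsetP; exists e.
have cUA : 2 * #|U| <= #|A2|.
  rewrite (card_pairs2 U (fun a u => (a \in P) && adj a u)) mulnC -sum_nat_const; apply: leq_sum => u uU.
  have /imsetP[e eO eu] := uU; have [eR eP] := setIdP eO.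
  have [h1 h2] := RC _ eR; rewrite !inE h2 (negbTE eP) /=.
  case/existsP => y /and3P[yP yq uy].
  have: [set e.1; y] \subset [set a | (a \in P) && adj a u].
    apply/subsetP => a; rewrite !inE => /orP[] /eqP ->.
      by rewrite VP //= eu.
    by rewrite yP /= adj_sym eu.
  by move/subset_leq_card; rewrite cards2 eq_sym yq.
pose A2' := [set e : 'I_n * 'I_n | (e.1 \in U) && ((e.2 \in P) && adj e.1 e.2)].
have cA : #|A2'| = #|A2|.
  rewrite (card_pairs1 U (fun u a => (a \in P) && adj u a)).
  rewrite (card_pairs2 U (fun a u => (a \in P) && adj a u)); apply: eq_bigr => u _; apply: eq_card => a.
  by rewrite !inE adj_sym.
have sub : In :|: (A2 :|: A2') \subset
   [set e : 'I_n * 'I_n | (e.1 \in P :|: U) && ((e.2 \in P :|: U) && adj e.1 e.2)].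
  apply/subsetP => e; rewrite 2!in_setU => he; rewrite inE 2!in_setU; move: he.
  case/or3P.
  - by case/setIdP => /RC[h1 h2 _] ->; rewrite VP ?h2.
  - by rewrite inE => /and3P[-> -> ->]; rewrite orbT.
  - by rewrite inE => /and3P[-> -> ->]; rewrite orbT.
have d1 : [disjoint A2 & A2'].
  rewrite -setI_eq0; apply/eqP/setP => e; rewrite !inE.
  by apply/negP => /andP[/and3P[/UP/negbTE h _ _] /and3P[_ h2 _]]; rewrite h in h2.
have d2 : [disjoint In & A2 :|: A2'].
  rewrite -setI_eq0; apply/eqP/setP => e; rewrite in_setI in_setU [RHS]inE.
  apply/negP => /andP[/setIdP[/RC[h1 _ _] h2]]; rewrite !inE.
  by case/orP => /and3P[/UP h _ _]; move: h; rewrite ?h2 ?VP.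
have := subset_leq_card sub.
rewrite cardsU (disjoint_setI0 d2) cards0 subn0 cardsU (disjoint_setI0 d1) cards0 subn0 => h.
have tVP : t * #|V| <= t * #|P| by rewrite leq_mul2l (subset_leq_card (introT subsetP VP)) orbT.
have cPU : #|P :|: U| <= #|P| + #|U| by apply: leq_card_setU.
have := H3 (P :|: U); rewrite /arcs => /(_ _)h3.
have {}h3 := h3 ltac:(lia).
(* The sparsity bound reads [In + 2 A2 <= 3 (P + U)] in cardinalities. With [2 U <= A2] it gives
   [2 In + A2 <= 6 P], and [Out <= A2] turns this into [In + Out <= 6 P]. *)
lia.
Qed.

(** Only uncoloured vertices matter, both as owners of lists and as places where B may still
    move. *)
Definition connset c K v := cset (K :&: uncolored c) v :&: uncolored c.

Lemma connsetS c c' K K' v : subcol c c' -> K \subset K' ->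
  connset c' K v \subset connset c K' v.
Proof.
move=> /subcol_unc hc hK; apply: setISS => //; apply: csetS; exact: setISS.
Qed.

Lemma connset_cset c K v : connset c K v \subset cset K v.
Proof. by apply: subset_trans (subsetIl _ _) _; apply: csetS; apply: subsetIl. Qed.

Lemma in_connset c K v u : (u \in connset c K v) =
  [&& adj v u, u \in uncolored c & (u \in K) || [exists y in K, [&& y \in uncolored c, y != v & adj u y]]].
Proof.
rewrite in_setI [u \in cset _ _]inE in_setI.
case: (adj v u) => //=; case: (u \in uncolored c); rewrite ?andbF ?andbT //=.
congr (_ || _); apply: eq_existsb => y; rewrite in_setI -!andbA //.
Qed.

Lemma connset0 c v : connset c set0 v = set0.
Proof.
apply/setP => u; rewrite in_connset !in_set0 /=.
by apply/negP => /and3P[_ _ /exists_inP[y]]; rewrite in_set0.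
Qed.

(** A degeneracy order. By [cset_count] with [V = P], not every member of [P] can have [t > 6]
    elements in its [cset]; one with fewer is split off and placed last. *)
Lemma peel s1 t P :
  (forall X, #|X| <= s1 -> arcs X <= 3 * #|X|) -> 6 < t -> t.+1 * #|P| <= s1 ->
  exists s : seq 'I_n, [/\ uniq s, s =i P &
    forall sa q sb, s = sa ++ q :: sb -> #|cset [set x in sa] q| < t].
Proof.
move=> H3 t6; elim: {P}#|P| {-2}P (erefl #|P|) => [|m IH] P cP hs.
  exists [::]; split=> //; last by case.
  by move=> x; move/eqP: cP; rewrite cards_eq0 => /eqP ->; rewrite inE.
have [q qP hq] : exists2 q, q \in P & #|cset P q| < t.
  apply/exists_inP; apply: contraT; rewrite negb_exists_in => /forall_inP h.
  have := cset_count H3 (subxx P) (t := t) _ hs.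
  have h' : forall q, q \in P -> t <= #|cset P q| by move=> q /h; rewrite -leqNgt.
  by move=> /(_ h'); rewrite cP; nia.
have cP' : #|P :\ q| = m by move: cP; rewrite (cardsD1 q) qP => -[].
have [|s [us es hpeel]] := IH (P :\ q) cP'.
  by apply: leq_trans hs; rewrite leq_mul2l cP' cP leqnSn orbT.
exists (rcons s q); split.
- by rewrite rcons_uniq us es !inE eqxx.
- move=> x; rewrite mem_rcons inE es !inE; case: eqP => [->|//]; by rewrite qP.
- move=> sa y sb; case/lastP: sb => [|sb z]; last first.
    by rewrite -rcons_cons -rcons_cat => /eqP; rewrite eqseq_rcons => /andP[/eqP e _]; apply: (hpeel _ _ _ e).
  rewrite cats1 => /eqP; rewrite eqseq_rcons => /andP[/eqP <- /eqP <-].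
  apply: leq_ltn_trans hq; apply/subset_leq_card/csetS.
  by apply/subsetP => x; rewrite inE es !inE => /andP[].
Qed.
End Core.

(** * The private-list strategy *)

Lemma card_bigcup_le (I T : finType) (A : {set I}) (F : I -> {set T}) m :
  (forall i, i \in A -> #|F i| <= m) -> #|\bigcup_(i in A) F i| <= #|A| * m.
Proof.
move=> h; rewrite -sum_nat_const.
apply: (@leq_trans (\sum_(i in A) #|F i|)); last exact: leq_sum.
elim/big_rec2: _ => [|i a B _ hB]; first by rewrite cards0.
by apply: leq_trans (leq_card_setU _ _) _; rewrite leq_add2l.
Qed.

Section Lists.
Variables (n k : nat) (adj : rel 'I_n).
Hypothesis adj_sym : symmetric adj.
Hypothesis adj_irr : irreflexive adj.
Notation col := (coloring n k).
Notation unc := (@uncolored n k).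
Notation av := (avail adj).
Implicit Types (c : col) (x y z q u : 'I_n) (E : seq 'I_n) (L : 'I_n -> {set 'I_k}).

Definition older c E x : {set 'I_n} :=
  [set z in unc c | [&& z \in E, adj x z & index z E < index x E]].

(* A move of B at a vertex [z] spoils a list only when it removes a colour from
   the list of a neighbour of [z] without lowering its [older] count, that is,
   when the neighbour precedes [z] in [E]. Lists of vertices which share such a
   [z], or which are adjacent (so that A's own moves are harmless), are disjoint. *)
Definition near c E x y :=
  adj x y \/ exists z, [/\ z \in unc c, adj z x, adj z y,
                        index x E < index z E & index y E < index z E].

Definition good_lists c E L :=
  (forall x, x \in E -> x \in unc c ->
     [/\ L x \subset av c x, 2 + #|older c E x| <= #|L x| & #|L x| <= 25]) /\
  (forall x y, x \in E -> y \in E -> x \in unc c -> y \in unc c -> x != y ->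
     near c E x y -> [disjoint L x & L y]).

Lemma near_sym c E x y : near c E x y -> near c E y x.
Proof.
case=> [h|[z [h1 h2 h3 h4 h5]]]; first by left; rewrite adj_sym.
by right; exists z.
Qed.

Lemma index_rcons_in E q x : x \in E -> index x (rcons E q) = index x E.
Proof. by move=> xE; rewrite -cats1 index_cat xE. Qed.

(* [q] has at most 23 + 23 * 23 = 552 predecessors whose lists, of at most 25
   colours each, have to be avoided. *)
Lemma extend_list1 c E L q : good_lists c E L -> q \notin E -> q \in unc c ->
  (forall u, u \in unc c -> u \notin E -> #|connset adj c [set x in E] u| <= 23) ->
  25 * 552 + 25 <= #|av c q| ->
  exists L', good_lists c (rcons E q) L'.
Proof.
move=> [G3 G4] qE qU hcon hav.
pose N := connset adj c [set x in E] q.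
pose Bad : {set 'I_n} := [set y in unc c | (y \in E) && (adj q y ||
   [exists z in unc c, [&& z \notin E, adj z q & adj z y]])].
have cBad : #|Bad| <= 552.
  have sub : Bad \subset N :|: \bigcup_(z in N :\: [set x in E]) connset adj c [set x in E] z.
    apply/subsetP => y; rewrite [y \in Bad]inE => /and3P[yU yE]; rewrite in_setU.
    case/orP => [qy|/exists_inP[z zU /and3P[zE zq zy]]].
      by rewrite in_connset qy yU inE yE.
    apply/orP; right; apply/bigcupP; exists z.
      rewrite in_setD inE zE in_connset adj_sym zq zU /=; apply/orP; right.
      apply/exists_inP; exists y; first by rewrite inE.
      by rewrite yU zy andbT; apply: contraNneq qE => <-.
    by rewrite in_connset zy yU inE yE.
  apply: leq_trans (subset_leq_card sub) _; apply: leq_trans (leq_card_setU _ _) _.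
  have cN : #|N| <= 23 by apply: hcon.
  have : #|\bigcup_(z in N :\: [set x in E]) connset adj c [set x in E] z| <= #|N :\: [set x in E]| * 23.
    apply: card_bigcup_le => z; rewrite in_setD inE in_connset => /and4P[h1 _ h2 _].
    exact: hcon.
  have : #|N :\: [set x in E]| <= #|N| by apply/subset_leq_card/subsetDl.
  lia.
pose F := \bigcup_(y in Bad) L y.
have cF : #|F| <= 552 * 25.
  apply: (@leq_trans (#|Bad| * 25)); last by rewrite leq_mul2r cBad orbT.
  by apply: card_bigcup_le => y; rewrite inE => /and3P[yU yE _]; case: (G3 y yE yU).
(* 25 = 2 + 23: by [hcon] at most 23 uncoloured neighbours of [q] lie in [E], and all of them
   precede [q]. *)
have [Lq [LqS cLq]] : exists B : {set 'I_k}, B \subset av c q :\: F /\ #|B| = 25.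
  apply: subset_card; rewrite cardsD.
  have := subset_leq_card (subsetIr (av c q) F); lia.
exists (fun x => if x == q then Lq else L x).
have idq : index q (rcons E q) = size E by rewrite -cats1 index_cat (negbTE qE) /= eqxx addn0.
have idlt x z : x \in E -> z != q -> (index x (rcons E q) < index z (rcons E q)) = (index x E < index z E).
  move=> xE zq; rewrite (index_rcons_in _ xE); have [zE|zE] := boolP (z \in E).
    by rewrite index_rcons_in.
  rewrite -cats1 index_cat (negbTE zE) (memNindex zE) /= eq_sym (negbTE zq).
  have : index x E < size E by rewrite index_mem.
  by move=> h; rewrite h ltn_addr.
have idE x : x \in E -> index x E < size E by rewrite index_mem.
have nearE x y : x \in E -> y \in E -> near c (rcons E q) x y -> near c E x y.
  move=> xE yE [h|[z [h1 h2 h3 h4 h5]]]; first by left.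
  right; exists z; have [e|zq] := eqVneq z q; last by rewrite -!idlt.
  (* [index] returns [size E] outside [E], so [near] already treats a vertex outside [E] as later
     than all of [E]. Appending [q] creates no new conflict between old owners. *)
  by subst z; rewrite (memNindex qE) !idE.
have nearq y : y \in E -> y \in unc c -> near c (rcons E q) q y -> y \in Bad.
  move=> yE yU nr; rewrite inE yU yE /=; case: nr => [->//|[z [h1 h2 h3]]].
  rewrite idq => h4 h5; apply/orP; right; apply/exists_inP; exists z => //.
  rewrite h2 h3 !andbT; apply/negP => zE; move: h4.
  by rewrite index_rcons_in // ltnNge ltnW // idE.
have dLq y : y \in Bad -> [disjoint Lq & L y].
  move=> yB; rewrite disjoint_sym; apply: (@disjointWl _ _ (mem F)).
    by apply/subsetP => a ay; apply/bigcupP; exists y.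
  apply: (@disjointWr _ _ (mem (av c q :\: F))); first exact: subset_trans LqS _.
  by rewrite -setI_eq0; apply/eqP/setP => a; rewrite !inE; case: (a \in F).
split=> [x|x y].
- rewrite mem_rcons inE; have [-> _ _|xq /= xE xU] := eqVneq x q.
  + split; [exact: subset_trans LqS (subsetDl _ _)| |by rewrite cLq].
    rewrite cLq (_ : 25 = 2 + 23) // leq_add2l; apply: leq_trans (hcon q qU qE).
    apply/subset_leq_card/subsetP => z; rewrite inE mem_rcons inE => /and4P[zU zE qz].
    have zq : z != q by apply: contraTneq qz => ->; rewrite adj_irr.
    by rewrite (negbTE zq) /= in zE; rewrite in_connset qz zU inE zE.
  + have [h1 h2 h3] := G3 x xE xU; split=> //; apply: leq_trans h2.
    rewrite leq_add2l; apply/subset_leq_card/subsetP => z.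
    rewrite !inE mem_rcons inE => /and4P[-> zE -> h] /=.
    have zq : z != q.
      by apply: contraTneq h => ->; rewrite idq index_rcons_in // -leqNgt ltnW // idE.
    by rewrite (negbTE zq) /= in zE; rewrite zE -idlt.
- rewrite !mem_rcons !in_cons; have [->|xq] := eqVneq x q => /=.
  + rewrite eq_sym; have [//|yq /= _ yE _ yU _ nr] := eqVneq y q.
    by apply/dLq/nearq.
  + have [->|yq] /= := eqVneq y q.
      move=> xE _ xU _ _ nr; rewrite disjoint_sym; apply/dLq/nearq => //.
      exact: near_sym.
    move=> xE yE xU yU xy nr; apply: G4 => //; exact: nearE.
Qed.

Lemma extend_lists c s E L : good_lists c E L -> uniq (E ++ s) ->
  (forall q, q \in s -> q \in unc c /\ 25 * 552 + 25 <= #|av c q|) ->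
  (forall sa sb u, s = sa ++ sb -> u \in unc c -> u \notin E ++ sa ->
     #|connset adj c [set x in E ++ sa] u| <= 23) ->
  exists L', good_lists c (E ++ s) L'.
Proof.
elim: s E L => [|q s IH] E L GL us hs hcon; first by exists L; rewrite cats0.
rewrite -cat_rcons in us *.
have qE : q \notin E by move: us; rewrite cat_uniq rcons_uniq => /andP[/andP[]].
have [qU qav] := hs q (mem_head _ _).
have [|L' GL'] := extend_list1 GL qE qU _ qav.
  by move=> u uU uE; have := hcon [::] (q :: s) u; rewrite cats0; apply.
apply: (IH _ L') => // [y ys|sa sb u e uU]; first by apply: hs; rewrite inE ys orbT.
by rewrite cat_rcons => uE; apply: (hcon (q :: sa) sb) => //; rewrite e.
Qed.

Lemma olderS c c' E x : subcol c c' -> older c' E x \subset older c E x.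
Proof.
move=> /subcol_unc/subsetP h; apply/subsetP => z; rewrite !in_set.
by case/andP; rewrite -in_set => zU ->; have := h z; rewrite !inE in zU * => ->.
Qed.

Lemma nearS c c' E x y : subcol c c' -> near c' E x y -> near c E x y.
Proof.
move=> /subcol_unc/subsetP h [|[z [h1 h2 h3 h4 h5]]]; first by left.
by right; exists z; split=> //; apply: h.
Qed.

(** The state after a move of B: the surplus of lists over older neighbours may have dropped from 2
    to 1, but for one owner at most. *)
Definition weak_lists c E L :=
  [/\ forall x, x \in E -> x \in unc c ->
        [/\ L x \subset av c x, 1 + #|older c E x| <= #|L x| & #|L x| <= 25],
      forall x y, x \in E -> y \in E -> x \in unc c -> y \in unc c -> x != y ->
        near c E x y -> [disjoint L x & L y] &
      forall x y, x \in E -> y \in E -> x \in unc c -> y \in unc c -> x != y ->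
        #|L x| < 2 + #|older c E x| -> 2 + #|older c E y| <= #|L y|].

Lemma good_weak c E L : good_lists c E L -> weak_lists c E L.
Proof.
case=> G3 G4; split=> // [x xE xU|x y _ yE _ yU _ _]; last by case: (G3 y yE yU).
by case: (G3 x xE xU) => h1 h2 h3; split=> //; apply: leq_trans h2.
Qed.

(** A neighbour of [z] later than [z] in [E] loses at most one colour together with the older
    neighbour [z], so its surplus is kept. Two earlier neighbours with [i] in their lists would be
    [near] through [z], against disjointness. *)
Lemma weak_of_good c E L z i : good_lists c E L -> z \in unc c ->
  weak_lists (upd c z i) E (fun y => if adj z y then L y :\ i else L y).
Proof.
move=> [G3 G4] zU; set L1 := fun y => _; set c1 := upd c z i.
have sc : subcol c c1 by apply: subcol_upd.
have Uc x : x \in unc c1 -> x \in unc c by apply: (subsetP (subcol_unc sc)).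
have Uz x : x \in unc c1 -> z != x by rewrite uncolored_upd in_setD1 eq_sym => /andP[].
have L1S x : L1 x \subset L x by rewrite /L1; case: ifP => // _; apply: subsetDl.
have cL1 x : #|L x| <= (adj z x && (i \in L x)) + #|L1 x|.
  by rewrite /L1; case: ifP => //= _; rewrite -cardsD1.
have old x : x \in E -> x \in unc c1 -> adj z x -> index z E < index x E ->
    #|older c1 E x| < #|older c E x|.
  move=> xE xU zx zi; apply: proper_card; rewrite properE olderS //=.
  apply/subsetPn; exists z; last by rewrite in_set uncolored_upd in_setD1 eqxx.
  by rewrite in_set zU adj_sym zx zi -index_mem (ltn_trans zi) ?index_mem.
have oldle x := subset_leq_card (olderS E x sc).
split=> [x xE xU|x y xE yE xU yU xy nr|x y xE yE xU yU xy hx].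
- have [h1 h2 h3] := G3 x xE (Uc x xU); split.
  + rewrite /c1 avail_upd // /L1; case: ifP => _ //; exact: setSD.
  + by have := cL1 x; have := oldle x; clear -h2; case: (adj z x && _); rewrite ?add0n; lia.
  + exact: leq_trans (subset_leq_card (L1S x)) h3.
- have d := G4 x y xE yE (Uc _ xU) (Uc _ yU) xy (nearS sc nr).
  exact: disjointWl (L1S x) (disjointWr (L1S y) d).
- rewrite leqNgt; apply/negP => hy.
  have key w : w \in E -> w \in unc c1 -> #|L1 w| < 2 + #|older c1 E w| ->
      [/\ adj z w, i \in L w & index w E < index z E].
    move=> wE wU hw; have [_ h2 _] := G3 w wE (Uc w wU).
    have h3 := cL1 w; have h4 := oldle w.
    have /andP[zw iw] : adj z w && (i \in L w).
      by apply: contraT => /negbTE e; rewrite e in h3; lia.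
    split=> //; rewrite ltnNge leq_eqVlt; apply/negP => /orP[/eqP e|lt].
      have zE : z \in E by rewrite -index_mem e index_mem.
      by have := Uz w wU; rewrite -(nth_index z zE) e nth_index ?eqxx.
    have lt' := old w wE wU zw lt; rewrite zw iw in h3.
    have ar a b o o' : 2 + o <= b -> b <= true + a -> a < 2 + o' -> o' < o -> False by move=> /=; lia.
    exact: (ar _ _ _ _ h2 h3 hw lt').
  have [zx ix lx] := key x xE xU hx; have [zy iy ly] := key y yE yU hy.
  have /(G4 x y xE yE (Uc x xU) (Uc y yU) xy) : near c E x y by right; exists z.
  by rewrite -setI_eq0 => /eqP/setP/(_ i); rewrite !inE ix iy.
Qed.

Lemma weak_avail c E L x : weak_lists c E L -> x \in E -> x \in unc c -> av c x != set0.
Proof.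
case=> W1 _ _ xE xU; have [h1 h2 _] := W1 x xE xU.
by rewrite -card_gt0 (leq_trans _ (subset_leq_card h1)) // (leq_trans _ h2).
Qed.

(** A colours the deficient owner, if there is one, from its own list. Adjacent owners have lists
    disjoint from it and therefore lose nothing. *)
Lemma weak_list_move c E L : weak_lists c E L -> (exists2 x, x \in E & x \in unc c) ->
  exists x a, [/\ x \in E, x \in unc c, a \in av c x & good_lists (upd c x a) E L].
Proof.
move=> WL [x0 x0E x0U]; have [W1 W2 W3] := WL.
have [x [xE xU hx]] : exists x, [/\ x \in E, x \in unc c &
    forall y, y \in E -> y \in unc c -> x != y -> 2 + #|older c E y| <= #|L y|].
  have [/exists_inP[x xU /andP[xE hx]]|] :=
    boolP [exists x in unc c, (x \in E) && (#|L x| < 2 + #|older c E x|)].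
    by exists x; split=> // y yE yU xy; apply: (W3 x).
  rewrite negb_exists_in => /forall_inP h; exists x0; split=> // y yE yU _.
  by have := h y yU; rewrite yE /= -leqNgt.
have [hL1 hL2 hL3] := W1 x xE xU.
have [a aL] : exists a, a \in L x by apply/card_gt0P; apply: leq_trans hL2.
exists x, a; split=> //; first exact: (subsetP hL1).
have sc : subcol c (upd c x a) by apply: subcol_upd.
have Uc y : y \in unc (upd c x a) -> x != y /\ y \in unc c.
  by rewrite uncolored_upd in_setD1 eq_sym => /andP[].
split=> [y yE /Uc[xy yU]|y z yE zE /Uc[_ yU] /Uc[_ zU] yz nr]; last first.
  by apply: W2 => //; apply: nearS nr.
have [h1 h2 h3] := W1 y yE yU; split=> //; last first.
  apply: leq_trans (hx y yE yU xy); rewrite leq_add2l.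
  exact/subset_leq_card/olderS.
rewrite avail_upd //; case: ifP => // xay; apply/subsetD1P; split=> //.
have /(W2 x y xE yE xU yU xy) : near c E x y by left.
by rewrite -setI_eq0 => /eqP/setP/(_ a); rewrite !inE aL /= => ->.
Qed.

End Lists.

Lemma in_set_id (T : finType) (A : {set T}) (P : pred T) x :
  (x \in [set y in A | P y]) = (x \in A) && P x.
Proof. by rewrite inE. Qed.

(** * The ladder of thresholds and the strategy of A *)

Section Upper.
Variables (n k : nat) (adj : rel 'I_n).
Hypothesis adj_sym : symmetric adj.
Hypothesis adj_irr : irreflexive adj.
Notation col := (coloring n k).
Notation unc := (@uncolored n k).
Notation av := (avail adj).
Implicit Types (c : col) (x y z q u v : 'I_n) (E : seq 'I_n) (F : {set 'I_n}).
Implicit Types (L : 'I_n -> {set 'I_k}) (cs : nat -> col).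

Variables J B0 dl r g1 s1 : nat.
Definition threshold j := B0 + (J - j) * dl.
(** Bounds how many vertices, uncoloured at the anchor of level [j], are now below [threshold j].
    Then at most [3 * level_size j + 1] vertices have been coloured since that anchor, and
    [dense_few] divides this by [r]. *)
Fixpoint level_size j := if j is j'.+1 then (3 * level_size j' + 1) %/ r else g1.

Hypothesis B0_big : 25 * 552 + 27 <= B0.
Hypothesis r4 : 4 <= r.
Hypothesis low_few : forall c, #|[set v | #|av c v| < threshold 0]| <= g1.
Hypothesis dense_few : forall T : {set 'I_n}, #|T| <= 3 * g1 + 1 ->
  r * #|[set v | dl <= #|[set u in T | adj u v]|]| <= #|T|.
Hypothesis locally_sparse : forall X : {set 'I_n}, #|X| <= s1 -> arcs adj X <= 3 * #|X|.
Hypothesis threshold0 : threshold 0 <= k.+1.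
Hypothesis s1_big : 30 * level_size J + 20 <= s1.

(* [cs j] is the position at the last time when every uncoloured vertex had at
   least [threshold j - 1] available colours, [F] is the set of vertices holding lists,
   and [s] is 1 when B is to move and 2 when A is. The fourth field says that since
   the anchor [cs j] A has coloured only vertices in [F] or with fewer than [threshold j]
   available colours; the last one that a vertex outside [F] meets few lists. *)
Record anchored c cs F s : Prop := Anchored {
  _ : forall i j, i <= j <= J -> subcol (cs i) (cs j);
  _ : forall j, j <= J -> subcol (cs j) c;
  _ : forall j v, j <= J -> v \in unc (cs j) -> threshold j <= #|av (cs j) v| + 1;
  _ : forall j, j <= J -> #|unc (cs j) :\: unc c| <=
       3 * #|[set v in unc (cs j) :\: unc c | (v \notin F) && (#|av c v| < threshold j)]|
       + 2 * #|F :\: unc c| + s;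
  _ : F \subset unc (cs J);
  _ : 2 * #|F| <= 3 * #|[set x in F | #|av c x| < B0]|;
  _ : forall x, x \in F -> #|av c x| < B0 \/ 18 <= #|cset adj F x|;
  _ : forall v, v \in unc c -> v \notin F -> #|connset adj c F v| <= 17 }.

Lemma thresholdJ : threshold J = B0. Proof. by rewrite /threshold subnn mul0n addn0. Qed.
Lemma threshold_ge j : B0 <= threshold j. Proof. exact: leq_addr. Qed.

Lemma avail_le c c' v : subcol c c' -> #|av c' v| <= #|av c v|.
Proof. by move=> h; apply/subset_leq_card/avail_sub. Qed.

Lemma avail_upd_ge c z i v : z \in unc c -> #|av c v| <= #|av (upd c z i) v| + 1.
Proof.
move=> zU; rewrite avail_upd //; case: ifP => _; last by rewrite leq_addr.
by rewrite (cardsD1 i (av c v)) addnC leq_add2l leq_b1.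
Qed.

(** A move of B raises [s] from 1 to 2. A move of A inside [F] increases the term
    [2 * #|F :\: unc c|] by 2, which pays for the move and brings [s] back to 1. *)
Lemma anchored_upd c cs F s s' z i : anchored c cs F s -> z \in unc c ->
  s.+1 <= s' + 2 * (z \in F) -> anchored (upd c z i) cs F s'.
Proof.
move=> [A1 A1' A2 A3 EU E1 K2 K6] zU hs; set c1 := upd c z i.
have sc : subcol c c1 by apply: subcol_upd.
have Uc1 : unc c1 = unc c :\ z by exact: uncolored_upd.
split=> //.
- by move=> j hj; apply: subcol_trans (A1' j hj) sc.
- move=> j hj; have := A3 j hj.
  have zcs : z \in unc (cs j) by apply: (subsetP (subcol_unc (A1' j hj))).
  have e1 : #|unc (cs j) :\: unc c1| = #|unc (cs j) :\: unc c| + 1.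
    rewrite (cardsD1 z (_ :\: unc c1)) Uc1 !in_setD zcs in_set1 eqxx /= addnC; congr (_ + _).
    congr #|pred_of_set _|; apply/setP => v; rewrite in_setD1 in_setD in_setD1 [RHS]in_setD.
    by have [->|] := eqVneq v z; rewrite //= zU.
  have e2 : #|F :\: unc c1| = #|F :\: unc c| + (z \in F).
    rewrite (cardsD1 z (_ :\: unc c1)) Uc1 !in_setD in_set1 eqxx /= addnC; congr (_ + _).
    congr #|pred_of_set _|; apply/setP => v; rewrite in_setD1 in_setD in_setD1 [RHS]in_setD.
    by have [->|] := eqVneq v z; rewrite //= zU.
  have e3 : #|[set v in unc (cs j) :\: unc c | (v \notin F) && (#|av c v| < threshold j)]| <=
     #|[set v in unc (cs j) :\: unc c1 | (v \notin F) && (#|av c1 v| < threshold j)]|.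
    apply/subset_leq_card/subsetP => v; rewrite !in_set_id => /and3P[h1 -> h3] /=.
    rewrite (leq_ltn_trans (avail_le v sc) h3) andbT; apply: (subsetP _ _ h1).
    by apply: setDS; apply: subcol_unc.
  rewrite e1 e2; have ar (X a b f p p' t : nat) : p.+1 <= p' + 2 * t -> a <= b ->
    X <= 3 * a + 2 * f + p -> X + 1 <= 3 * b + 2 * (f + t) + p' by lia.
  exact: ar.
- apply: leq_trans E1 _; rewrite leq_mul2l; apply/subset_leq_card/subsetP => x.
  by rewrite !in_set_id => /andP[-> h]; apply: leq_ltn_trans (avail_le x sc) h.
- by move=> x xF; case: (K2 x xF) => h; [left|right] => //; apply: leq_ltn_trans (avail_le x sc) h.
- move=> v; rewrite Uc1 in_setD1 => /andP[_ vU] vF; apply: leq_trans (K6 v vU vF).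
  by apply/subset_leq_card/connsetS.
Qed.

Lemma level_size_le j : level_size j <= g1.
Proof.
elim: j => //= j IH; case: (posnP (level_size j)) => [->|h].
  by rewrite divn_small // (leq_trans _ r4).
apply: leq_trans IH; apply: (@leq_trans ((3 * level_size j + 1) %/ 4)).
  by apply: leq_div2l.
by rewrite -ltnS ltn_divLR //; lia.
Qed.

(* A vertex descending from level [j] to level [j + 1] has [dl] neighbours among
   the vertices coloured since the anchor [cs j], and these are few by induction. *)
Lemma low_bound c cs F j : anchored c cs F 1 -> j <= J ->
  #|[set v in unc (cs j) | #|av c v| < threshold j]| <= level_size j.
Proof.
move=> [A1 A1' A2 A3 EU E1 K2 K6]; elim: j => [|j IH] hj.
  apply: leq_trans (low_few c); apply/subset_leq_card/subsetP => v.
  by rewrite in_set_id => /andP[_ h]; rewrite in_set.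
have hj' : j <= J := ltnW hj; have {}IH := IH hj'.
set X := [set v in unc (cs j) | _] in IH.
(* Everything is charged to [X]: the vertices counted outside [F] lie in [X :\: F], and [2 * #|F|]
   is at most three times the critical part of [F], which lies in [X :&: F]. *)
have cT : #|unc (cs j) :\: unc c| <= 3 * level_size j + 1.
  apply: leq_trans (A3 j hj') _; rewrite leq_add2r.
  apply: leq_trans (_ : 3 * #|X :\: F| + 3 * #|X :&: F| <= _); last first.
    by rewrite -mulnDr addnC cardsID leq_mul2l.
  apply: leq_add.
    rewrite leq_mul2l; apply/subset_leq_card/subsetP => v; rewrite in_set_id.
    by case/and3P => /setDP[vU _] vF vt; rewrite in_setD vF in_set_id vU.
  apply: leq_trans (_ : 2 * #|F| <= _); first by rewrite leq_mul2l subset_leq_card ?orbT ?subsetDl.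
  apply: leq_trans E1 _; rewrite leq_mul2l; apply/subset_leq_card/subsetP => x.
  rewrite in_setI !in_set_id => /andP[xF h]; rewrite xF andbT (leq_trans h (threshold_ge j)) andbT.
  have /(subsetP (subcol_unc (A1 j J _))) : x \in unc (cs J) by apply: (subsetP EU).
  by rewrite inE; apply; rewrite hj' leqnn.
have hT : #|unc (cs j) :\: unc c| <= 3 * g1 + 1.
  by apply: leq_trans cT _; rewrite leq_add2r leq_mul2l level_size_le.
rewrite [level_size _]/= leq_divRL; last by apply: leq_trans r4.
apply: leq_trans cT; apply: leq_trans (dense_few hT); rewrite mulnC leq_mul2l; apply/orP; right.
apply/subset_leq_card/subsetP => v; rewrite in_set_id => /andP[vU hv].
have vUj : v \in unc (cs j) by apply: (subsetP (subcol_unc (A1 j j.+1 _))) vU; rewrite leqnSn.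
(* The 1 conceded in [threshold j <= #|av (cs j) v| + 1] is regained from the strict inequality
   [#|av c v| < threshold j.+1], so that the loss is at least [dl]. *)
have := card_avail_sub adj v (A1' j hj'); have := A2 j v hj' vUj.
have e : threshold j = threshold j.+1 + dl.
  by rewrite /threshold -addnA; congr (_ + _); rewrite addnC -mulSn -subSn // subSS.
by rewrite e in_set; lia.
Qed.

(** All critical vertices are added to [F], then uncoloured vertices with at least 18 elements in
    their [connset] as long as there are any. At each addition [cset_count] bounds the non-critical
    members by a third, which in turn keeps the set within the range of [locally_sparse]. *)
Lemma exists_closed_superset c cs F : anchored c cs F 1 -> exists F', [/\ F \subset F', F' :\: F \subset unc c,
   2 * #|F'| <= 3 * #|[set x in F' | #|av c x| < B0]| /\
     3 * #|[set x in F' | #|av c x| < B0]| <= 3 * level_size J,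
   forall x, x \in F' -> #|av c x| < B0 \/ 18 <= #|cset adj F' x| &
   forall v, v \in unc c -> v \notin F' -> B0 <= #|av c v| /\ #|connset adj c F' v| <= 17 ].
Proof.
move=> bs; have hX := low_bound bs (leqnn J); rewrite thresholdJ in hX.
have [A1 A1' A2 A3 EU E1 K2 K6] := bs.
have UJ : unc c \subset unc (cs J) by apply: subcol_unc; apply: A1'.
pose Sd := [set v in unc c | (v \notin F) && (#|av c v| < B0)].
pose P F' := [/\ F \subset F', F' :\: F \subset unc c,
   2 * #|F'| <= 3 * #|[set x in F' | #|av c x| < B0]|,
   forall x, x \in F' -> #|av c x| < B0 \/ 18 <= #|cset adj F' x| &
   Sd \subset F'].
have Pc F' : P F' -> 3 * #|[set x in F' | #|av c x| < B0]| <= 3 * level_size J.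
  move=> [h1 h2 h3 h4 h5]; rewrite leq_mul2l; apply: leq_trans hX.
  apply/subset_leq_card/subsetP => x; rewrite !in_set_id => /andP[xF' ->]; rewrite andbT.
  suff : x \in unc (cs J) by [].
  have [xF|xF] := boolP (x \in F); first exact: (subsetP EU).
  by apply/(subsetP UJ)/(subsetP h2); rewrite in_setD xF.
suff key m F' : P F' -> #|~: F'| <= m -> exists F'', P F'' /\
    (forall v, v \in unc c -> v \notin F'' -> #|connset adj c F'' v| <= 17).
  have [|F' [PF' cl]] := key _ (F :|: Sd) _ (leqnn _).
    have dFS : F :&: Sd = set0.
      by apply/setP => x; rewrite in_setI in_set_id in_set0; case: (x \in F); rewrite /= ?andbF.
    split; [exact: subsetUl| | | |exact: subsetUr].
    + apply/subsetP => x; rewrite in_setD in_setU; case: (x \in F) => //=.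
      by rewrite in_set_id => /andP[].
    + have -> : [set x in F :|: Sd | #|av c x| < B0] = [set x in F | #|av c x| < B0] :|: Sd.
        apply/setP => x; rewrite [LHS]in_set_id !in_setU in_set_id andb_orl; congr (_ || _).
        by rewrite in_set_id; case: (_ < B0); rewrite ?andbF ?andbT.
      rewrite !cardsU dFS cards0 subn0.
      rewrite (_ : _ :&: Sd = set0) ?cards0 ?subn0; first by rewrite !mulnDr; lia.
      by apply/setP => x; rewrite in_setI !in_set_id in_set0; case: (x \in F); rewrite /= ?andbF.
    + move=> x; rewrite in_setU => /orP[/K2[h|h]|]; [by left|right|].
        by apply: leq_trans h _; apply/subset_leq_card/csetS/subsetUl.
      by rewrite in_set_id => /and3P[_ _ h]; left.
  exists F'; have h6 := Pc F' PF'; case: PF' => h1 h2 h3 h4 h5; split=> // v vU vF'; split; last exact: cl.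
  rewrite leqNgt; apply/negP => hv.
  have vF : v \notin F by apply: contra vF' => /(subsetP h1).
  by case/negP: vF'; apply: (subsetP h5); rewrite in_set_id vU vF.
elim: m F' => [|m IH] F' PF' hm.
  exists F'; split=> // v _ vF'; have : v \in ~: F' by rewrite inE.
  by move: hm; rewrite leqn0 cards_eq0 => /eqP ->; rewrite inE.
have [/exists_inP[v vU /andP[vF' hv]]|] :=
  boolP [exists v in unc c, (v \notin F') && (17 < #|connset adj c F' v|)]; last first.
  rewrite negb_exists_in => /forall_inP h; exists F'; split=> // v vU vF'.
  by have := h v vU; rewrite vF' /= -leqNgt.
apply: (IH (v |: F')); last first.
  by rewrite setCU setIC -setDE; move: hm; rewrite (cardsD1 v (~: F')) in_setC vF' add1n ltnS.
have [h1 h2 h3 h4 h5] := PF'; have h6 := Pc F' PF'.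
have k2 : forall x, x \in v |: F' -> #|av c x| < B0 \/ 18 <= #|cset adj (v |: F') x|.
  move=> x; rewrite in_setU1 => /orP[/eqP ->|/h4[]]; [right|by left|move=> H; right].
    apply: leq_trans hv _; apply/subset_leq_card; apply: subset_trans (connset_cset _ _ _ _) _.
    exact/csetS/subsetUr.
  by apply: leq_trans H _; apply/subset_leq_card/csetS/subsetUr.
split=> //.
- exact: subset_trans h1 (subsetUr _ _).
- apply/subsetP => x; rewrite in_setD in_setU1 => /andP[xF /orP[/eqP -> //|xF']].
  by apply: (subsetP h2); rewrite in_setD xF.
- have cF : #|v |: F'| = 1 + #|F'| by rewrite cardsU1 vF'.
  pose V := [set x in v |: F' | B0 <= #|av c x|].
  have := @cset_count _ adj adj_sym (v |: F') V 18 s1 locally_sparse.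
  have VS : V \subset v |: F' by apply/subsetP => x; rewrite in_set_id => /andP[].
  have Vt q : q \in V -> 18 <= #|cset adj (v |: F') q|.
    by rewrite in_set_id => /andP[/k2[] // h1' h2']; rewrite ltnNge h2' in h1'.
  (* The side condition is [19 * (1 + #|F'|) <= s1]. It holds because [#|F'|] is at most
     [3/2 * level_size J], and it is the origin of [30 * level_size J + 20] in [s1_big]. *)
  move=> /(_ VS Vt); rewrite cF => h; have {}h := h ltac:(lia).
  have : #|[set x in v |: F' | #|av c x| < B0]| + #|V| = 1 + #|F'|.
    rewrite -cF -(cardsID [set x | #|av c x| < B0] (v |: F')); congr (_ + _); apply: eq_card => x.
      by rewrite !inE.
    by rewrite !inE -leqNgt andbC.
  lia.
- exact: subset_trans h5 (subsetUr _ _).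
Qed.

(** A round passes from [invB] to [invA] (B has moved), to [preB] (A has moved) and back to [invB]
    (lists are added without a move). A move takes at most one colour from a vertex, whence [B0 - 1]
    and [B0 - 2]; the latter still allows the [25 * 552 + 25] colours that a new list requires. *)
Definition invB c := exists cs E L, [/\ uniq E, anchored c cs [set x in E] 1, good_lists adj c E L &
  forall v, v \in unc c -> v \notin E -> B0 <= #|av c v|].
Definition preB c := exists cs E L, [/\ uniq E, anchored c cs [set x in E] 1, good_lists adj c E L &
  forall v, v \in unc c -> v \notin E -> B0 - 2 <= #|av c v|].
Definition invA c := exists cs E L, [/\ uniq E, anchored c cs [set x in E] 2, weak_lists adj c E L &
  forall v, v \in unc c -> v \notin E -> B0 - 1 <= #|av c v|].

(** The new members of the closed set are appended in the order of [peel]. Until it is appended,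
    such a member has at most 17 elements in its [connset] through the old owners and 6 through the
    new ones before it. New members are uncoloured, so the counts in [anchored] are unaffected. *)
Lemma invB_of_pre c : preB c -> invB c.
Proof.
case=> cs [E [L [uE bs GL hav]]].
have [F' [h1 h2 [h3 h4] h5 h6]] := exists_closed_superset bs; have [A1 A1' A2 A3 EU E1 K2 K6] := bs.
have cF' : 20 * #|F'| <= s1 by lia.
have [s [us es ps]] := @peel _ adj adj_sym s1 7 (F' :\: [set x in E]) locally_sparse isT
  ltac:(have := subset_leq_card (subsetDl F' [set x in E]); lia).
have sF q : q \in s -> q \in unc c /\ q \notin E.
  rewrite es => h; split; first exact: (subsetP h2).
  by move: h; rewrite in_setD inE => /andP[].
have eF : [set x in E ++ s] = F'.
  apply/setP => x; rewrite inE mem_cat es in_setD inE.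
  have [xE|] := boolP (x \in E) => //=; apply/esym.
  by apply: (subsetP h1); rewrite inE.
have uEs : uniq (E ++ s).
  by rewrite cat_uniq uE us andbT; apply/hasPn => q /sF[].
have [||L' GL'] := extend_lists adj_sym adj_irr GL uEs.
- move=> q /sF[qU qE]; split=> //; apply: leq_trans (hav q qU qE).
  by rewrite leq_subRL; lia.
- move=> sa sb u e uU uEa; have [us'|us'] := boolP (u \in s); last first.
    have : u \notin F' by rewrite -eF inE mem_cat negb_or us' andbT; move: uEa; rewrite mem_cat negb_or => /andP[].
    move=> /(h6 u uU)[_ h]; apply: leq_trans (_ : 17 <= 23) => //; apply: leq_trans h.
    apply/subset_leq_card/connsetS => //; rewrite -eF e; apply/subsetP => x.
    by rewrite !inE !mem_cat => /orP[] ->; rewrite ?orbT.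
  have usb : u \in sb by move: us' uEa; rewrite e !mem_cat negb_or => /orP[->|//]; rewrite andbF.
  have [sb1 [sb2 esb]] : exists sb1 sb2, sb = sb1 ++ u :: sb2.
    by case/path.splitPr: usb => p1 p2; exists p1, p2.
  have hp := ps (sa ++ sb1) u sb2 ltac:(by rewrite e esb -catA).
  have [_ uE2] := sF u us'.
  have c1 : #|connset adj c [set x in E] u| <= 17 by apply: K6 => //; rewrite inE.
  have c2 : #|cset adj [set x in sa] u| <= 6.
    rewrite -ltnS; apply: leq_ltn_trans hp; apply/subset_leq_card/csetS/subsetP => x.
    by rewrite !inE mem_cat => ->.
  apply: leq_trans (_ : 17 + 6 <= 23) => //; apply: leq_trans (leq_add c1 c2).
  apply: leq_trans (leq_card_setU _ _); apply/subset_leq_card/subsetP => y.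
  rewrite in_connset in_setU in_connset [y \in cset _ _ _]inE => /and3P[uy yU]; rewrite uy yU /=.
  rewrite ![y \in [set _ in _]]inE mem_cat; case/orP => [/orP[->|->]|/exists_inP[w]]; rewrite ?orbT //.
  rewrite inE mem_cat => /orP[] hw /and3P[wU wu yw]; apply/orP; [left|right]; apply/orP; right;
    apply/exists_inP; (exists w; first by rewrite inE); by rewrite ?wU wu.
exists cs, (E ++ s), L'; split=> //; last first.
  by move=> v vU vE; have [] := h6 v vU; rewrite // -eF inE.
have unF : forall v, v \notin unc c -> (v \in F') = (v \in [set x in E]).
  move=> v vU; rewrite -eF !inE mem_cat; case: (boolP (v \in s)) => [/sF[]|]; last by rewrite orbF.
  by rewrite (negbTE vU).
rewrite eF; split=> //.
- move=> j hj; apply: leq_trans (A3 j hj) _; rewrite leq_add2r.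
  apply: leq_add; rewrite leq_mul2l; apply/subset_leq_card/subsetP => v.
    by rewrite ![v \in finset _]in_set_id => /and3P[h /=]; have /setDP[_ vU] := h; rewrite h unF // => -> ->.
  by rewrite !in_setD => /andP[vU]; rewrite vU unF.
- apply/subsetP => x xF'; have [xE|xE] := boolP (x \in [set x in E]); first exact: (subsetP EU).
  by apply/(subsetP (subcol_unc (A1' J (leqnn _))))/(subsetP h2); rewrite in_setD xE.
- by move=> v vU /(h6 v vU)[].
Qed.

Lemma invA_of_B c z i : invB c -> z \in unc c -> invA (upd c z i).
Proof.
case=> cs [E [L [uE bs GL hav]]] zU.
exists cs, E, (fun y => if adj z y then L y :\ i else L y); split=> //.
- by apply: anchored_upd bs zU _; rewrite leq_addr.
- exact: weak_of_good.
- move=> v vU vE; have {}vU : v \in unc c by move: vU; rewrite uncolored_upd in_setD1 => /andP[].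
  by have := avail_upd_ge i v zU; have := hav v vU vE; lia.
Qed.

(** Once all owners are coloured, the lists are dropped and A colours a vertex [v0] with the fewest
    available colours. A level that [v0], hence every uncoloured vertex, misses by at most one
    colour takes the present position as its new anchor; for every other level [v0] itself counts as
    low. *)
Lemma preB_of_A c : invA c -> unc c = set0 \/ exists v a,
  [/\ v \in unc c, a \in av c v & preB (upd c v a)].
Proof.
case=> cs [E [L [uE bs WL hav]]].
have [/exists_inP[x0 x0U x0E]|] := boolP [exists x in unc c, x \in E].
  right; have [|x [a [xE xU xa GL]]] := weak_list_move WL; first by exists x0.
  exists x, a; split=> //; exists cs, E, L; split=> //.
    by apply: anchored_upd bs xU _; rewrite inE xE.
  move=> v vU vE; have {}vU : v \in unc c by move: vU; rewrite uncolored_upd in_setD1 => /andP[].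
  by have := avail_upd_ge a v xU; have := hav v vU vE; lia.
rewrite negb_exists_in => /forall_inP EU'.
have [->|[u0 u0U]] := set_0Vmem (unc c); [by left|right].
have [A1 A1' A2 A3 EU E1 K2 K6] := bs.
case: (arg_minnP (fun v => #|av c v|) u0U) => v0 v0U' v0min.
have v0U : v0 \in unc c := v0U'.
have v0c := EU' v0 v0U; have v0B := hav v0 v0U v0c.
have [a0 a0v] : exists a, a \in av c v0 by apply/card_gt0P; lia.
exists v0, a0; split=> //; set c2 := upd c v0 a0.
have sc : subcol c c2 by apply: subcol_upd.
pose cs' j := if threshold j <= #|av c v0| + 1 then c else cs j.
have threshold_anti i j : i <= j -> threshold j <= threshold i by move=> h; rewrite leq_add2l leq_mul2r leq_sub2l ?orbT.
exists cs', [::], (fun _ => set0); split=> //; last first.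
  move=> v vU _; have {}vU : v \in unc c by move: vU; rewrite uncolored_upd in_setD1 => /andP[].
  by have := avail_upd_ge a0 v v0U; rewrite -/c2; have := hav v vU (EU' v vU); lia.
have e0 : [set x in [::]] = set0 :> {set 'I_n} by apply/setP => x; rewrite !inE.
rewrite e0; split=> //.
- move=> i j /andP[ij jJ]; rewrite /cs'; case: ifP => [h|_].
    by rewrite (leq_trans (threshold_anti _ _ ij) h).
  by case: ifP => _; [apply: A1'; apply: leq_trans ij jJ|apply: A1; rewrite ij].
- move=> j jJ; rewrite /cs'; case: ifP => _ //; exact: subcol_trans (A1' j jJ) sc.
- move=> j v jJ; rewrite /cs'; case: ifP => [h vU|_]; last exact: A2.
  by apply: leq_trans h _; rewrite leq_add2r; apply: v0min.
- have U2 : unc c2 = unc c :\ v0 by exact: uncolored_upd.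
  move=> j jJ; rewrite /cs' set0D cards0 muln0 addn0; case: ifP => [_|hthr].
    apply: leq_trans (leq_addl _ _); rewrite U2 -(cards1 v0); apply/subset_leq_card/subsetP => v.
    by rewrite !inE; case: eqP => //= _ /andP[/negbTE ->].
  set D := unc (cs j) :\: unc c2.
  set D0 := unc (cs j) :\: unc c.
  have v0cs : v0 \in unc (cs j) by apply: (subsetP (subcol_unc (A1' j jJ))).
  have eD : D = v0 |: D0.
    rewrite /D U2; apply/setP => v; rewrite in_setD in_setD1 in_setU1 in_setD.
    by have [->|] := eqVneq v v0 => //=; rewrite v0cs.
  have cD : #|D| = 1 + #|D0| by rewrite eD cardsU1 (_ : v0 \notin D0) // in_setD v0U.
  have := A3 j jJ; rewrite -/D0.
  have -> : [set x in E] :\: unc c = [set x in E].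
    apply/setP => x; rewrite in_setD inE; case: (boolP (x \in unc c)) => //= xU.
    by rewrite (negbTE (EU' x xU)).
  set R := [set v in D0 | _ & _]; set G := [set x in [set x in E] | _] in E1.
  have RG : #|v0 |: (R :|: G)| <= #|[set v in D | (v \notin set0) && (#|av c2 v| < threshold j)]|.
    apply/subset_leq_card/subsetP => v vv.
    have hle : #|av c2 v| <= #|av c v| by apply: avail_le.
    suff [vD vt] : v \in D /\ #|av c v| < threshold j by rewrite in_set_id vD inE (leq_ltn_trans hle vt).
    move: vv; rewrite eD !in_setU1; have [->|_ /=] := eqVneq v v0.
      by split=> //; lia.
    rewrite in_setU => /orP[|]; rewrite in_set_id.
      by case/and3P => -> _ ->.
    case/andP => vE vB; split; last exact: leq_trans vB (threshold_ge j).
    rewrite in_setD; apply/andP; split.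
      by apply/negP => /EU'; rewrite inE in vE; rewrite vE.
    by apply: (subsetP (subcol_unc (A1 j J _))); [rewrite jJ leqnn|apply: (subsetP EU)].
  have cRG : #|v0 |: (R :|: G)| = 1 + (#|R| + #|G|).
    rewrite cardsU1 cardsU (_ : R :&: G = set0) ?cards0 ?subn0.
      rewrite (_ : v0 \notin _) // in_setU negb_or in_set_id in_setD v0U /= in_set_id inE.
      by rewrite (negbTE v0c).
    by apply/setP => x; rewrite in_setI [x \in R]in_set_id [x \in G]in_set_id [RHS]inE; case: (x \in [set _ in E]); rewrite ?andbF.
  rewrite cRG in RG; rewrite cD.
  (* Here the weight 3 originates: dropping [F] exchanges [2 * #|F|] for three times its critical
     part, and [v0] contributes 3, enough for its own move and for lowering [s] from 2 to 1. *)
  have ar (f g x y z : nat) : 2 * f <= 3 * g -> 1 + (x + g) <= y -> z <= 3 * x + 2 * f + 2 ->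
    1 + z <= 3 * y + 1 by lia.
  exact: ar E1 RG.
- exact: sub0set.
- by rewrite cards0 muln0.
- by move=> x; rewrite inE.
- by move=> v vU _; rewrite connset0 cards0.
Qed.

Lemma invA_init : invA (empty_coloring n k).
Proof.
have U0 : unc (empty_coloring n k) = setT by apply/setP => v; rewrite in_uncolored inE ffunE.
have av0 v : #|av (empty_coloring n k) v| = k.
  rewrite -[RHS]card_ord -cardsT; apply: eq_card => a; rewrite [RHS]inE.
  by apply/availP => u _; rewrite ffunE.
have e0 : [set x in [::]] = set0 :> {set 'I_n} by apply/setP => x; rewrite !inE.
have thk j : threshold j <= k.+1.
  by apply: leq_trans threshold0; rewrite leq_add2l leq_mul2r leq_sub2l ?orbT.
exists (fun _ => empty_coloring n k), [::], (fun _ => set0); split=> //; last first.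
  by move=> v _ _; rewrite av0; have := thk J; rewrite thresholdJ; lia.
rewrite e0; split=> //.
- by move=> j v _ _; rewrite av0 addn1.
- by move=> j _; rewrite setDv cards0.
- exact: sub0set.
- by rewrite cards0 muln0.
- by move=> x; rewrite inE.
- by move=> v vU _; rewrite connset0 cards0.
Qed.

Theorem A_wins_of_sparse : @A_wins_game n k adj.
Proof.
apply: (proj1 (@Awins_strategy n k adj invA invB _ _ n _ _)) invA_init.
- move=> c hc; split; last first.
    case: (preB_of_A hc) => [->|[v [a [h1 h2 h3]]]]; [by left|right].
    by exists v, a; split=> //; apply: invB_of_pre.
  case: hc => cs [E [L [uE bs WL hav]]] v vU.
  have [vE|vE] := boolP (v \in E); first exact: weak_avail WL vE vU.
  by rewrite -card_gt0; have := hav v vU vE; lia.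
- move=> c hc; split; last by move=> v a vU _; apply: invA_of_B.
  case: hc => cs [E [L [uE bs GL hav]]] v vU.
  have [vE|vE] := boolP (v \in E); first exact: weak_avail (good_weak GL) vE vU.
  by rewrite -card_gt0; have := hav v vU vE; lia.
- by rewrite -[X in _ <= X]card_ord max_card.
Qed.
End Upper.

(** * The hypotheses of the strategy from pseudorandomness *)

Section Pseudorandom.
Variables (n k : nat) (adj : rel 'I_n).
Hypothesis adj_sym : symmetric adj.
Hypothesis adj_irr : irreflexive adj.
Variables J B0 l r g s1 : nat.
Notation threshold0 := (threshold J B0 (4 * l * r) 0).
Hypothesis g_gt0 : 0 < g.
Hypothesis l_gt0 : 0 < l.
Hypothesis r4 : 4 <= r.
Hypothesis avail_many : forall (c : coloring n k) (Y : {set 'I_n}), Y \subset uncolored c ->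
  #|Y| = g -> g * (threshold0 + 4 * l) < \sum_(y in Y) #|avail adj c y|.
Hypothesis sparse : forall X : {set 'I_n}, 0 < #|X| -> #|X| <= 14 * g -> arcs adj X < 2 * l * #|X|.

(** By sparsity, fewer than [g] of [2 * g] low vertices have [4 * l] neighbours among them.
    Uncolouring all [2 * g] gives back at most [4 * l] colours to each of the others, and [g] of
    these, now uncoloured, contradict [avail_many]. *)
Lemma few_low (c : coloring n k) : #|[set v | #|avail adj c v| < threshold0]| <= 2 * g.
Proof.
rewrite leqNgt; apply/negP => /ltnW/subset_card[X [/subsetP XS cX]].
have hX : arcs adj X < 2 * l * (2 * g) by rewrite -cX; apply: sparse; rewrite cX; lia.
pose high := [set v in X | 4 * l <= #|[set u in X | adj u v]|].
have chigh : #|high| < g.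
  rewrite -(ltn_pmul2r (_ : 0 < 4 * l)); last lia.
  apply: leq_ltn_trans (_ : arcs adj X < _); last by move: hX; lia.
  rewrite /arcs; apply: leq_trans (_ : \sum_(v in X) #|[set u in X | adj u v]| <= _).
    rewrite -sum_nat_const [leqRHS](bigID (fun v => v \in high)) /=; apply: leq_trans (leq_addr _ _).
    rewrite [X in _ <= X](eq_bigl (mem high)); last first.
      by move=> v; rewrite !inE; case: (v \in X).
    by apply: leq_sum => v; rewrite inE => /andP[].
  rewrite -(card_pairs2 X (fun u v => (u \in X) && adj u v)).
  by apply/eq_leq/eq_card => e; rewrite !inE; case: (e.1 \in X); rewrite ?andbF.
have [Y [/subsetP YS cY]] : exists Y : {set 'I_n}, Y \subset X :\: high /\ #|Y| = g.
  apply: subset_card; rewrite cardsD cX.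
  have ar (a b m : nat) : a <= b -> b < m -> m <= 2 * m - a by lia.
  exact: ar (subset_leq_card (subsetIr X high)) chigh.
pose c' : coloring n k := [ffun v => if v \in X then None else c v].
have sc : subcol c' c by move=> v; rewrite ffunE; case: ifP.
have := @avail_many c' Y _ cY; rewrite -cY -sum_nat_const.
have -> : Y \subset uncolored c'.
  by apply/subsetP => y /YS /setDP[yX _]; rewrite in_uncolored ffunE yX.
move=> /(_ isT); rewrite ltnNge => /negP; apply; apply: leq_sum => y /YS/setDP[yX yh].
apply: leq_trans (card_avail_sub adj y sc) _; apply: leq_add.
  by have := XS y yX; rewrite inE => /ltnW.
have hy : #|[set u in X | adj u y]| <= 4 * l.
  by move: yh; rewrite inE yX /= -ltnNge => /ltnW.
apply: leq_trans hy; apply/subset_leq_card/subsetP => u; rewrite !inE ffunE.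
by case: (u \in X) => /=; [case/andP|case: (c u == None)].
Qed.

(** The edges between [T] and a set [W] of such vertices with [#|W| <= #|T|] are limited by the
    sparsity of [T :|: W]; a larger [V] is first cut down to [#|T|] elements. The union has at most
    [12 * g + 2 <= 14 * g] vertices, whence the 14 in [sparse]. *)
Lemma few_neighbors (T : {set 'I_n}) : #|T| <= 3 * (2 * g) + 1 ->
  r * #|[set v | 4 * l * r <= #|[set u in T | adj u v]|]| <= #|T|.
Proof.
move=> cT; set V := [set v | _].
have [T0|Tn0] := posnP #|T|.
  rewrite (_ : V = set0) ?cards0 ?muln0 //; apply/setP => v; rewrite !inE.
  rewrite (_ : [set u in T | adj u v] = set0) ?cards0; first by apply/negbTE; rewrite -ltnNge; lia.
  by apply/setP => u; rewrite !inE; move/eqP: T0; rewrite cards_eq0 => /eqP ->; rewrite inE.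
have key (W : {set 'I_n}) : W \subset V -> #|W| <= #|T| -> r * #|W| <= #|T|.
  move=> /subsetP WV cW.
  have cTW : #|T :|: W| <= #|T| + #|W| by apply: leq_card_setU.
  have h : arcs adj (T :|: W) < 2 * l * (2 * #|T|).
    apply: leq_trans (sparse _ _) _.
    - by apply: leq_trans Tn0 _; apply/subset_leq_card/subsetUl.
    - by lia.
    - by rewrite leq_mul2l; apply/orP; right; lia.
  have h2 : #|W| * (4 * l * r) <= arcs adj (T :|: W).
    apply: leq_trans (_ : \sum_(v in W) #|[set u in T | adj u v]| <= _).
      by rewrite -sum_nat_const; apply: leq_sum => v /WV; rewrite inE.
    rewrite -(card_pairs2 W (fun u v => (u \in T) && adj u v)).
    apply/subset_leq_card/subsetP => e; rewrite !inE => /and3P[-> -> ->].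
    by rewrite orbT.
  have h3 : #|W| * r * (4 * l) < #|T| * (4 * l) by move: h h2; lia.
  by move: h3; rewrite ltn_pmul2r; [lia|lia].
have [hV|hV] := leqP #|V| #|T|; first exact: key.
have [W [WV cW]] := subset_card (ltnW hV).
have := key W WV; rewrite cW leqnn => /(_ isT) h; exfalso; move: h.
by rewrite leqNgt => /negP; apply; rewrite ltn_Pmull //; apply: leq_trans r4.
Qed.

Theorem A_wins_of_pseudorandom : 25 * 552 + 27 <= B0 ->
  (forall X : {set 'I_n}, #|X| <= s1 -> arcs adj X <= 3 * #|X|) ->
  threshold0 <= k.+1 -> 30 * level_size r (2 * g) J + 20 <= s1 -> @A_wins_game n k adj.
Proof.
move=> hB h3 hk hs.
exact: (A_wins_of_sparse adj_sym adj_irr hB r4 few_low few_neighbors h3 hk hs).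
Qed.
End Pseudorandom.

Import Order.TTheory GRing.Theory Num.Theory.

(** * Counting proper colourings *)

Section Lower.
Variables (n k : nat) (adj : rel 'I_n).
Hypothesis adj_sym : symmetric adj.
Hypothesis adj_irr : irreflexive adj.
Notation col := (coloring n k).
Notation unc := (@uncolored n k).
Notation av := (avail adj).
Implicit Types (c : col) (u v : 'I_n) (a : 'I_k).

Definition proper_coloring (f : {ffun 'I_n -> 'I_k}) := [forall u, forall v, adj u v ==> (f u != f v)].
Definition extensions c : {set {ffun 'I_n -> 'I_k}} :=
  [set f | proper_coloring f && [forall v, (c v != None) ==> (c v == Some (f v))]].

Lemma in_extensions c f : reflect (proper_coloring f /\ forall v a, c v = Some a -> f v = a)
  (f \in extensions c).
Proof.
rewrite inE; apply: (iffP andP) => -[pf h]; split=> //.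
  by move=> v a cv; have := forallP h v; rewrite cv => /= /eqP [].
apply/forallP => v; apply/implyP; case e: (c v) => [a|//] _.
by rewrite (h v a e).
Qed.

Definition proper_partial c := forall u v a, adj u v -> c u = Some a -> c v <> Some a.

Lemma proper_partial_upd c v a : proper_partial c -> a \in av c v ->
  proper_partial (upd c v a).
Proof.
move=> pc /availP ha x y b xy; rewrite !ffunE.
case: (x =P v) => [ex|_]; case: (y =P v) => [ey|_].
- by move: xy; rewrite ex ey adj_irr.
- by case=> <- cy; apply: (ha y _ cy); rewrite adj_sym -ex.
- by move=> cx [e]; apply: (ha x _ _); rewrite -?ey // e.
- exact: pc.
Qed.

Lemma extensions_total c : proper_partial c -> unc c = set0 -> 0 < #|extensions c|.
Proof.
move=> pc U0; have ct v : c v != None.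
  by have := in_set0 v; rewrite -U0 in_uncolored => ->.
(* Without colours, a position with everything coloured has no vertices, and the empty function
   extends it. *)
have [a0|] := pickP 'I_k; last first.
  move=> h0; have n0 v : False by have := ct v; case: (c v) => // a; have := h0 a.
  apply/card_gt0P; exists [ffun v => False_rect _ (n0 v)]; apply/in_extensions.
  by split=> [|v]; [apply/forallP => v; case: (n0 v)|case: (n0 v)].
move=> _; apply/card_gt0P; exists [ffun v => odflt a0 (c v)]; apply/in_extensions.
split=> [|v a cv]; last by rewrite ffunE cv.
apply/forallP => u; apply/forallP => v; apply/implyP => uv; rewrite !ffunE.
case eu: (c u) (ct u) => [a|] // _; case ev: (c v) (ct v) => [b|] // _ /=.
by apply/eqP => e; apply: (pc u v a uv eu); rewrite ev e.
Qed.

Lemma extensions_upd c v a : v \in unc c ->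
  extensions (upd c v a) \subset [set f in extensions c | f v == a].
Proof.
rewrite in_uncolored => /eqP cv; apply/subsetP => f /in_extensions[pf h]; rewrite inE.
rewrite (h v a) ?ffunE ?eqxx // andbT; apply/in_extensions; split=> // u b cu.
by apply: h; rewrite ffunE; case: (u =P v) cu => [->|//]; rewrite cv.
Qed.

Lemma sum_extensions c v : v \in unc c ->
  \sum_(a in av c v) #|extensions (upd c v a)| <= #|extensions c|.
Proof.
move=> vU; apply: (@leq_trans (\sum_(a : 'I_k) #|[set f in extensions c | f v == a]|)).
  rewrite [X in _ <= X](bigID (mem (av c v))) /=; apply: leq_trans (leq_addr _ _).
  by apply: leq_sum => a _; apply/subset_leq_card/extensions_upd.
rewrite -[X in _ <= X]sum1_card (partition_big (fun f : {ffun 'I_n -> 'I_k} => f v) xpredT) //=.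
by apply: leq_sum => a _; rewrite -sum1_card; apply/eq_leq/eq_bigl => f; rewrite inE.
Qed.

(* When B colours [v], the extensions of the position split according to the
   colour of [v], and A wins after each available choice; A's own moves can only
   lower the number of extensions. *)
Local Open Scope ring_scope.

Lemma Awins_extensions (F : realFieldType) (b : nat -> F) (T : nat) :
  (2 * T <= n)%N -> (forall i, 0 <= b i) ->
  (forall i c, (i < T)%N -> #|~: unc c| = (2 * i).+1 ->
     exists2 v, v \in unc c & b i <= #|av c v|%:R) ->
  forall m c j, proper_partial c ->
  (#|~: unc c| = (2 * j)%N -> Awins adj m true c ->
     \prod_(j <= i < T) b i <= #|extensions c|%:R) /\
  (#|~: unc c| = (2 * j).+1 -> Awins adj m false c ->
     \prod_(j <= i < T) b i <= #|extensions c|%:R).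
Proof.
move=> hT b0 hb; elim=> [|m IH] c j pc.
  have anchored : forall t, Awins adj 0 t c -> unc c = set0.
    move=> t /=; case: ifP => // _; case: ifP => // /forallP h _.
    by apply/setP => v; rewrite in_uncolored [RHS]inE; apply/negbTE/h.
  split=> hc /anchored U0; have e1 := extensions_total pc U0.
    rewrite big_geq ?ler1n //; move: hc; rewrite U0 setC0 cardsT card_ord; lia.
  have [jT|jT] := ltnP j T; last by rewrite big_geq // ler1n.
  by have [v] := hb j c jT hc; rewrite U0 inE.
have Dupd v a : v \in unc c -> #|~: unc (upd c v a)| = #|~: unc c|.+1.
  move=> vU; rewrite uncolored_upd setCD setUC cardsU1 inE vU //.
split=> hc /=; case: ifP => // nbl; case: ifP => [/forallP allc|nall].
- move=> _; have U0 : unc c = set0 by apply/setP => v; rewrite in_uncolored [RHS]inE; apply/negbTE/allc.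
  have e1 := extensions_total pc U0.
  rewrite big_geq ?ler1n //; move: hc; rewrite U0 setC0 cardsT card_ord; lia.
- case/existsP => v /existsP[a /andP[]]; rewrite legalE => /andP[vU av] hA.
  have := proj2 (IH _ j (proper_partial_upd pc av)).
  rewrite Dupd // hc => /(_ erefl hA) h; apply: le_trans h _.
  rewrite ler_nat; apply/subset_leq_card; apply: subset_trans (extensions_upd a vU) _.
  by apply/subsetP => f; rewrite inE => /andP[].
- move=> _; have U0 : unc c = set0 by apply/setP => v; rewrite in_uncolored [RHS]inE; apply/negbTE/allc.
  have e1 := extensions_total pc U0.
  have [jT|jT] := ltnP j T; last by rewrite big_geq // ler1n.
  by have [v] := hb j c jT hc; rewrite U0 inE.
- move=> /forallP hA.
  have step v : v \in unc c -> (#|av c v|%:R : F) * \prod_(j.+1 <= i < T) b i <= #|extensions c|%:R.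
    move=> vU; apply: le_trans (_ : (\sum_(a in av c v) #|extensions (upd c v a)|)%:R <= _); last first.
      by rewrite ler_nat; apply: sum_extensions.
    rewrite natr_sum -sumr_const mulr_suml; apply: ler_sum => a ha; rewrite mul1r.
    apply: (proj1 (IH _ j.+1 (proper_partial_upd pc ha))).
      by rewrite Dupd // hc; lia.
    by have := forallP (hA v) a; rewrite legalE vU ha.
  have P0 i : 0 <= \prod_(i <= l < T) b l by apply: prodr_ge0.
  have [jT|jT] := ltnP j T.
    have [v vU bv] := hb j c jT hc.
    rewrite big_ltn //; apply: le_trans (step v vU); exact: ler_wpM2r.
  (* After the first [T] moves of B the product is empty, and a single extension suffices; an
     uncoloured vertex that is not blocked supplies it. *)
  have [U0|[v vU]] := set_0Vmem (unc c).
    case/negP: nall; apply/forallP => v; have := in_set0 v.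
    by rewrite -U0 in_uncolored => ->.
  rewrite big_geq //; have := step v vU; rewrite big_geq 1?ltnW // mulr1; apply: le_trans.
  rewrite ler1n card_gt0; apply/negP => e; move/existsP: nbl; apply.
  by exists v; rewrite blockedE vU.
Qed.

Lemma A_wins_proper_colorings (F : realFieldType) (b : nat -> F) (T : nat) :
  (2 * T <= n)%N -> (forall i, 0 <= b i) ->
  (forall i c, (i < T)%N -> #|~: unc c| = (2 * i).+1 ->
     exists2 v, v \in unc c & b i <= #|av c v|%:R) ->
  @A_wins_game n k adj -> \prod_(0 <= i < T) b i <= #|[set f | proper_coloring f]|%:R.
Proof.
move=> hT b0 hb hA.
have pc : proper_partial (empty_coloring n k) by move=> u v a _; rewrite ffunE.
have h := proj1 (Awins_extensions hT b0 hb n 0 pc).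
apply: le_trans (h _ hA) _.
  rewrite (_ : unc _ = setT) ?setCT ?cards0 //.
  by apply/setP => v; rewrite in_uncolored !inE ffunE.
rewrite ler_nat; apply/subset_leq_card/subsetP => f /in_extensions[pf _].
by rewrite inE.
Qed.
End Lower.

(** * The binomial random graph *)

Local Open Scope ring_scope.

Section Prob.
Variables (F : realFieldType) (n : nat) (p : F).
Hypotheses (p_ge0 : 0 <= p) (p_le1 : p <= 1).
Notation edge := ('I_n * 'I_n)%type.
Implicit Types (S M : {set edge}) (e : edge) (P Q : pred {set edge}).

Definition up_edge e := (e.1 < e.2)%N.
(** Pairs that are not increasing are present with probability 0. This makes the random graph a
    product measure over all ordered pairs, open to [bigA_distr]. *)
Definition pin e : F := if up_edge e then p else 0.
Definition pout e : F := if up_edge e then 1 - p else 1.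
Definition wt S := \prod_e (if e \in S then pin e else pout e).
Definition Pr P := \sum_(S | P S) wt S.
Definition Ex (X : {set edge} -> F) := \sum_S wt S * X S.

Lemma pin_ge0 e : 0 <= pin e. Proof. by rewrite /pin; case: ifP. Qed.
Lemma pout_ge0 e : 0 <= pout e. Proof. by rewrite /pout; case: ifP => _; rewrite ?subr_ge0 ?ler01. Qed.
Lemma pin_pout e : pin e + pout e = 1. Proof. by rewrite /pin /pout; case: ifP => _; ring. Qed.

Lemma wt_ge0 S : 0 <= wt S.
Proof. by apply: prodr_ge0 => e _; case: ifP; rewrite ?pin_ge0 ?pout_ge0. Qed.

Lemma Ex_prod (f g : edge -> F) :
  Ex (fun S => \prod_e (if e \in S then f e else g e)) =
  \prod_e (pin e * f e + pout e * g e).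
Proof.
rewrite bigA_distr /=; apply: eq_bigr => S _; rewrite -big_split /=.
by apply: eq_bigr => e _; case: ifP.
Qed.

Lemma PrE P : Pr P = Ex (fun S => (P S)%:R).
Proof.
by rewrite /Pr /Ex big_mkcond; apply: eq_bigr => S _; case: (P S); rewrite ?mulr1 ?mulr0.
Qed.

Lemma ExD X Y : Ex (fun S => X S + Y S) = Ex X + Ex Y.
Proof. by rewrite /Ex -big_split /=; apply: eq_bigr => S _; rewrite mulrDr. Qed.

Lemma ExZ a X : Ex (fun S => a * X S) = a * Ex X.
Proof. by rewrite /Ex mulr_sumr; apply: eq_bigr => S _; rewrite mulrCA. Qed.

Lemma Ex_sum (I : finType) (A : pred I) (X : I -> {set edge} -> F) :
  Ex (fun S => \sum_(i | A i) X i S) = \sum_(i | A i) Ex (X i).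
Proof.
by rewrite /Ex exchange_big /=; apply: eq_bigr => S _; rewrite mulr_sumr.
Qed.

Lemma Ex_le X Y : (forall S, X S <= Y S) -> Ex X <= Ex Y.
Proof. by move=> h; apply: ler_sum => S _; apply: ler_wpM2l (wt_ge0 S) _ _ (h S). Qed.

Lemma eq_Ex X Y : X =1 Y -> Ex X = Ex Y.
Proof. by move=> h; apply: eq_bigr => S _; rewrite h. Qed.

Lemma Pr_le P Q : (forall S, P S -> Q S) -> Pr P <= Pr Q.
Proof. by move=> h; rewrite !PrE; apply: Ex_le => S; rewrite ler_nat; case: (P S) (h S) => // ->. Qed.

Lemma PrT : Pr xpredT = 1.
Proof.
rewrite PrE; transitivity (Ex (fun S => \prod_e (if e \in S then 1 else 1))).
  by apply: eq_Ex => S; rewrite big1 // => e _; rewrite if_same.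
by rewrite Ex_prod big1 // => e _; rewrite !mulr1 pin_pout.
Qed.

Lemma Pr_union (I : finType) (A : pred I) (P : I -> pred {set edge}) :
  Pr (fun S => [exists (i | A i), P i S]) <= \sum_(i | A i) Pr (P i).
Proof.
rewrite PrE (eq_bigr _ (fun i _ => PrE (P i))) -Ex_sum; apply: Ex_le => S.
case: existsP => [[i /andP[Ai Pi]]|_]; last by apply: sumr_ge0 => i _; rewrite ler0n.
rewrite (bigD1 i) //= Pi lerDl; apply: sumr_ge0 => j _; exact: ler0n.
Qed.

Lemma Pr_or P Q : Pr (fun S => P S || Q S) <= Pr P + Pr Q.
Proof.
rewrite !PrE -ExD; apply: Ex_le => S; rewrite -natrD ler_nat.
by case: (P S); case: (Q S).
Qed.

Lemma Pr_compl P : Pr P = 1 - Pr (fun S => ~~ P S).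
Proof.
rewrite -PrT !PrE; apply/eqP; rewrite eq_sym subr_eq -ExD; apply/eqP.
by apply: eq_Ex => S; case: (P S); rewrite ?addr0 ?add0r.
Qed.

Lemma Markov P X a : 0 < a -> (forall S, 0 <= X S) -> (forall S, P S -> a <= X S) ->
  Pr P <= Ex X / a.
Proof.
move=> a0 X0 h; rewrite ler_pdivlMr // mulrC PrE -ExZ; apply: Ex_le => S.
by case: (boolP (P S)) => [/h|_]; rewrite ?mulr1 ?mulr0.
Qed.

Lemma card_up_edges : #|[set e : edge | up_edge e]| = npairs n.
Proof.
rewrite /npairs -bin2_sum big_mkord.
transitivity #|[set e : edge | (e.2 \in [set: 'I_n]) && (e.1 < e.2)%N]|.
  by apply: eq_card => e; rewrite !inE.
rewrite (card_pairs2 [set: 'I_n] (fun a b : 'I_n => a < b)%N); apply: eq_big => [b|b _]; first by rewrite inE.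
rewrite -sum1dep_card -(big_ord_widen _ (fun _ => 1%N)) ?sum1_card ?card_ord //.
exact: ltnW.
Qed.

Lemma wt_valid S : wt S = if valid_edge_set S
  then p ^+ #|S| * (1 - p) ^+ (npairs n - #|S|) else 0.
Proof.
case: ifPn => [/forall_inP vS|].
  rewrite /wt (bigID (mem S)) /=; congr (_ * _).
    rewrite -prodr_const; apply: eq_bigr => e eS.
    by rewrite eS /pin /up_edge vS.
  rewrite (bigID up_edge) /= [X in _ * X]big1 ?mulr1; last first.
    by move=> e /andP[/negbTE -> /negbTE h]; rewrite /pout h.
  rewrite (eq_bigr (fun _ => 1 - p)); last first.
    by move=> e /andP[/negbTE -> h]; rewrite /pout h.
  rewrite prodr_const; congr (_ ^+ _).
  have -> : npairs n = #|[set e : edge | up_edge e]|.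
    by rewrite card_up_edges.
  rewrite -(cardsID S [set e | up_edge e]) (_ : _ :&: S = S); last first.
    by apply/setP => e; rewrite !inE; case: (boolP (e \in S)); rewrite ?andbF // /up_edge => /vS ->.
  rewrite addKn; apply: eq_card => e; by rewrite !inE.
rewrite negb_forall_in => /exists_inP[e eS he].
by rewrite /wt (bigD1 e) //= eS /pin /up_edge (negbTE he) mul0r.
Qed.

Lemma Pr_valid P : Pr (fun S => valid_edge_set S && P S) = Pr P.
Proof.
rewrite /Pr [RHS](bigID (@valid_edge_set n)) /= [X in _ = _ + X]big1 ?addr0.
  by apply: eq_bigl => S; rewrite andbC.
by move=> S /andP[_ /negbTE h]; rewrite wt_valid h.
Qed.

Lemma Pr_avoid M : Pr (fun S => [disjoint S & M]) = \prod_(e in M) pout e.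
Proof.
rewrite PrE; transitivity (Ex (fun S => \prod_e (if e \in S then (if e \in M then 0 else 1) else 1))).
  apply: eq_Ex => S; case: (boolP [disjoint S & M]) => [d|].
    rewrite big1 // => e _; case: ifP => // eS.
    by have /disjointFr/(_ eS) -> := d.
  rewrite disjoint_subset => /subsetPn[e eS]; rewrite inE negbK => eM.
  by rewrite (bigD1 e) //= eS eM mul0r.
rewrite Ex_prod [RHS]big_mkcond; apply: eq_bigr => e _.
by case: ifP => _; rewrite ?mulr0 ?mulr1 ?add0r ?pin_pout.
Qed.

Lemma Pr_contains M : Pr (fun S => M \subset S) = \prod_(e in M) pin e.
Proof.
rewrite PrE; transitivity (Ex (fun S => \prod_e (if e \in S then 1 else (if e \in M then 0 else 1)))).
  apply: eq_Ex => S; case: (boolP (M \subset S)) => [/subsetP d|].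
    by rewrite big1 // => e _; case: ifPn => // eS; rewrite ifN //; apply: contra eS => /d.
  by case/subsetPn => e eM eS; rewrite (bigD1 e) //= (negbTE eS) eM mul0r.
rewrite Ex_prod [RHS]big_mkcond; apply: eq_bigr => e _.
by case: ifP => _; rewrite ?mulr0 ?mulr1 ?addr0 ?pin_pout.
Qed.

(* The events that no edge of a block is present are independent: expand the
   product over the sets of blocks and recombine. *)
Lemma block_indep (B : finType) (label : edge -> option B) (t : B -> F) :
  Ex (fun S => \prod_b (1 - t b * [forall e in S, label e != Some b]%:R)) =
  \prod_b (1 - t b * \prod_(e | label e == Some b) pout e).
Proof.
pose I b S : F := [forall e in S, label e != Some b]%:R.
transitivity (\sum_(J in {set B}) (\prod_(b in J) (- t b)) * \prod_(b in J) \prod_(e | label e == Some b) pout e).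
  transitivity (\sum_(J in {set B}) Ex (fun S => (\prod_(b in J) (- t b)) * \prod_(b in J) I b S)).
    rewrite -Ex_sum; apply: eq_Ex => S.
    under eq_bigr => b _ do rewrite addrC -mulNr.
    rewrite bigA_distr; apply: eq_bigr => J _.
    by rewrite -big_split /= [RHS]big_mkcond.
  apply: eq_bigr => J _; rewrite ExZ; congr (_ * _).
  pose M := [set e | if label e is Some b then b \in J else false].
  transitivity (Pr (fun S => [disjoint S & M])).
    rewrite PrE; apply: eq_Ex => S; case: (boolP [disjoint S & M]) => [d|].
      apply: big1 => b bJ; rewrite /I (_ : [forall e in S, _]) //.
      apply/forall_inP => e eS; apply: contraTneq eS => lb.
      by rewrite (disjointFl d) // inE lb.
    rewrite disjoint_subset => /subsetPn[e eS]; rewrite inE negbK inE.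
    case lb: (label e) => [b|//] bJ; rewrite (bigD1 b) //= /I.
    rewrite (_ : [forall e in S, _] = false) ?mul0r //; apply/negbTE.
    by rewrite negb_forall_in; apply/exists_inP; exists e; rewrite ?lb ?eqxx.
  rewrite Pr_avoid (exchange_big_dep (mem M)) /=; last first.
    by move=> b e bJ /eqP lb; rewrite inE lb.
  apply: eq_bigr => e; rewrite inE; case lb: (label e) => [b|//] bJ.
  rewrite (bigD1 b) /=; last by rewrite bJ eqxx.
  rewrite big1 ?mulr1 // => b' /andP[/andP[_ /eqP[->]]]; by rewrite eqxx.
transitivity (\prod_b (- t b * (\prod_(e | label e == Some b) pout e) + 1)); last first.
  by apply: eq_bigr => b _; rewrite mulNr addrC.
rewrite bigA_distr; apply: eq_bigr => J _.
by rewrite -big_split /= [LHS]big_mkcond.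
Qed.
End Prob.

(** * Monochromatic pairs of a colouring *)

Section Monochromatic.
Variables n k : nat.
Notation edge := ('I_n * 'I_n)%type.
Implicit Types (S : {set edge}) (f : {ffun 'I_n -> 'I_k}).

Definition mono f := #|[set e : edge | (f e.1 == f e.2) && up_edge e]|.

Lemma proper_disjoint S f :
  proper_coloring (graph_of S) f = [disjoint S & [set e : edge | f e.1 == f e.2]].
Proof.
apply/forallP/idP => [h|].
  rewrite disjoint_subset; apply/subsetP => e eS; rewrite !inE.
  by have /forallP/(_ e.2) := h e.1; rewrite /graph_of -surjective_pairing eS.
rewrite disjoint_subset => /subsetP h u; apply/forallP => v; apply/implyP.
by rewrite /graph_of => /orP[] /h; rewrite !inE //= eq_sym.
Qed.

(** Cauchy-Schwarz for the colour classes [C i]: their sizes add up to [n] and the squares to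
    [2 * mono f + n]. It is obtained from the nonnegative sum of the [(k * C i - n)^2], taken over
    the integers. *)
Lemma mono_ge f : (n ^ 2 <= k * (2 * mono f + n))%N.
Proof.
have [k0|k0] := posnP k.
  have -> // : n = 0%N; case: n f => // m f; by case: (f ord0) => a; rewrite [X in (_ < X)%N]k0.
pose C i := #|[set u | f u == i]|.
have sC : (\sum_i C i = n)%N.
  rewrite -[RHS]card_ord -sum1_card (partition_big f xpredT) //=.
  by apply: eq_bigr => i _; rewrite /C -sum1_card; apply: eq_bigl => u; rewrite inE.
have sC2 : (\sum_i C i * C i = 2 * mono f + n)%N.
  transitivity #|[set e : edge | f e.1 == f e.2]|.
    transitivity #|[set e : edge | (e.1 \in [set: 'I_n]) && (f e.1 == f e.2)]|; last first.
      by apply: eq_card => e; rewrite !inE.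
    rewrite (card_pairs1 [set: 'I_n] (fun u v => f u == f v)).
    rewrite (partition_big f xpredT) //=; apply: eq_bigr => i _.
    rewrite (eq_bigr (fun _ => C i)).
      by rewrite sum_nat_const; congr (_ * _)%N; rewrite /C cardsE; apply: eq_card => u; rewrite [RHS]unfold_in in_setT.
    move=> u /andP[_ /eqP fu]; apply: eq_card => v; by rewrite !inE fu eq_sym.
  pose A := [set e : edge | f e.1 == f e.2].
  rewrite -(cardsID [set e | up_edge e] A) -(cardsID [set e : edge | e.1 != e.2] (A :\: _)) addnA.
  rewrite mul2n -addnn; congr (_ + _ + _)%N.
  - by apply: eq_card => e; rewrite !inE.
  - have inj : injective (fun e : edge => (e.2, e.1)) by move=> [a b] [a' b'] [-> ->].
    rewrite /mono -[RHS](card_imset _ inj); apply: eq_card => -[u v]; rewrite !inE /up_edge /=.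
    apply/idP/imsetP => [/andP[/andP[h fuv] uv]|[[a b]]].
      exists (v, u) => //; rewrite !inE /up_edge /= eq_sym fuv /=.
      by rewrite ltn_neqAle leqNgt h andbT eq_sym.
    rewrite !inE /up_edge /= => /andP[fab ab] [-> ->]; rewrite eq_sym fab andbT.
    by rewrite -leqNgt (ltnW ab) /=; apply: contraTneq ab => ->; rewrite ltnn.
  - have inj : injective (fun u : 'I_n => (u, u)) by move=> ? ? [].
    rewrite -[RHS]card_ord -cardsT -[RHS](card_imset _ inj).
    apply: eq_card => -[u v]; rewrite !inE /up_edge /=; apply/idP/imsetP => [/andP[/negPn/eqP -> _]|[w _ [-> ->]]].
      by exists v.
    by rewrite ltnn !eqxx.
have h : (0 : int) <= \sum_i ((k%:Z * (C i)%:Z - n%:Z) ^+ 2) by apply: sumr_ge0 => i _; apply: sqr_ge0.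
have e : \sum_i ((k%:Z * (C i)%:Z - n%:Z) ^+ 2) =
    k%:Z * (k%:Z * (2 * mono f + n)%:Z - n%:Z ^+ 2).
  transitivity (k%:Z ^+ 2 * \sum_i ((C i)%:Z * (C i)%:Z) - 2 * k%:Z * n%:Z * (\sum_i (C i)%:Z)
      + \sum_(i < k) n%:Z ^+ 2).
    rewrite !mulr_sumr -sumrB -big_split /=; apply: eq_bigr => i _; ring.
  have -> : \sum_i ((C i)%:Z * (C i)%:Z) = (2 * mono f + n)%:Z.
    by rewrite -sC2 (big_morph Posz PoszD (erefl 0%:Z)); apply: eq_bigr.
  have -> : \sum_i (C i)%:Z = n%:Z by rewrite -[in RHS]sC (big_morph Posz PoszD (erefl 0%:Z)).
  rewrite sumr_const card_ord -[_ *+ k]mulr_natl natz; ring.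
rewrite e pmulr_rge0 ?ltz_nat // subr_ge0 in h.
by move: h; lia.
Qed.
End Monochromatic.

(** * Available colours, proper colourings and dense sets in the random graph *)

Section Events.
Variables (F : realFieldType) (n : nat) (p : F).
Hypotheses (p_ge0 : 0 <= p) (p_le1 : p <= 1).
Notation edge := ('I_n * 'I_n)%type.
Implicit Types (S M : {set edge}) (e : edge).
Notation Pr := (Pr p).
Notation Ex := (Ex p).

Lemma q_ge0 : 0 <= 1 - p. Proof. by rewrite subr_ge0. Qed.
Lemma q_le1 : 1 - p <= 1. Proof. by rewrite gerBl. Qed.

Lemma prod_pout (A : pred edge) :
  \prod_(e | A e) pout p e = (1 - p) ^+ #|[set e | A e && up_edge e]|.
Proof.
rewrite (bigID (@up_edge n)) /= [X in _ * X]big1 ?mulr1; last first.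
  by move=> e /andP[_ /negbTE h]; rewrite /pout h.
rewrite (eq_bigr (fun _ => 1 - p)) ?prodr_const; last by move=> e /andP[_ h]; rewrite /pout h.
by congr (_ ^+ _); apply: eq_card => e; rewrite !inE.
Qed.

Section Availability.
Variables (k : nat) (c : coloring n k) (Y : {set 'I_n}).
Hypothesis Yc : Y \subset uncolored c.

Definition color_class (i : 'I_k) : {set 'I_n} := [set u | c u == Some i].

(** The pairs joining [y] to the vertices of colour [i] form the block [(y, i)]. Colour [i] is
    available at [y] exactly when this block contains no edge, and distinct blocks are disjoint,
    hence independent. *)
Definition label e : option ('I_n * 'I_k) :=
  if e.1 \in Y then omap (pair e.1) (c e.2)
  else if e.2 \in Y then omap (pair e.2) (c e.1) else None.

Lemma labelP e y i : label e = Some (y, i) ->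
  y \in Y /\ ((e.1 = y /\ c e.2 = Some i) \/ (e.2 = y /\ c e.1 = Some i)).
Proof.
rewrite /label; case: ifP => h1.
  by case e2: (c e.2) => [j|] //= [<- <-]; split=> //; left.
case: ifP => // h2.
by case e2: (c e.1) => [j|] //= [<- <-]; split=> //; right.
Qed.

Lemma avail_label S y i : y \in Y ->
  (i \in avail (graph_of S) c y) = [forall e in S, label e != Some (y, i)].
Proof.
move=> yY; have yn : c y = None by have := subsetP Yc y yY; rewrite in_uncolored => /eqP.
apply/availP/forall_inP => [h e eS|h u].
  apply/eqP => /labelP[_ [[e1 c2]|[e2 c1]]].
    by apply: (h e.2 _ c2); rewrite /graph_of -e1 -surjective_pairing eS orbT.
  by apply: (h e.1 _ c1); rewrite /graph_of -e2 -surjective_pairing eS.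
rewrite /graph_of => adj cu; have uY : u \notin Y.
  by apply/negP => /(subsetP Yc); rewrite in_uncolored cu.
case/orP: adj => /h /eqP; apply; rewrite /label /= yY ?(negbTE uY) cu //.
Qed.

Lemma card_block y i : y \in Y ->
  (#|[set e | (label e == Some (y, i)) && up_edge e]| <= #|color_class i|)%N.
Proof.
move=> yY; have yn : c y = None by have := subsetP Yc y yY; rewrite in_uncolored => /eqP.
pose g (e : edge) := if e.1 == y then e.2 else e.1.
rewrite -(@card_in_imset _ _ g).
  apply/subset_leq_card/subsetP => u /imsetP[e]; rewrite inE => /andP[/eqP/labelP[_ h] _] ->.
  rewrite inE /g; case: h => [[e1 c2]|[e2 c1]]; first by rewrite e1 eqxx c2.
  by case: (e.1 =P y) => [e1|_]; [rewrite e1 yn in c1|rewrite c1].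
move=> [a b] [a' b']; rewrite !inE /g /up_edge /= => /andP[/eqP/labelP[_ /= h] lt] /andP[/eqP/labelP[_ /= h'] lt'].
case: h => [[ea ca]|[ea ca]]; case: h' => [[ea' ca']|[ea' ca']]; subst.
- by rewrite !eqxx => ->.
- by rewrite eqxx; case: eqP => [_|_] e; subst; rewrite ?yn // in ca *; move: lt lt'; lia.
- by rewrite eqxx; case: eqP => [_|_] e; subst; rewrite ?yn // in ca ca' *; move: lt lt'; lia.
- case: eqP => [e|_]; first by rewrite e yn in ca.
  by case: eqP => [e|_]; [rewrite e yn in ca'|move=> ->].
Qed.

(* Markov's inequality for 2 to the minus the number of available pairs. *)
Lemma avail_tail B :
  Pr (fun S => (\sum_(y in Y) #|avail (graph_of S) c y| <= B)%N) <=
  2 ^+ B * (\prod_i (1 - (1 - p) ^+ #|color_class i| / 2)) ^+ #|Y|.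
Proof.
pose t (b : 'I_n * 'I_k) : F := if b.1 \in Y then 2^-1 else 0.
pose X S := \prod_b (1 - t b * [forall e in S, label e != Some b]%:R).
have half01 : 0 <= (2^-1 : F) <= 1 by lra.
have X0 S : 0 <= X S.
  apply: prodr_ge0 => b _; rewrite /t; case: ifP => _; case: [forall e in S, label e != Some b]; rewrite /=; lra.
have pairE (G : 'I_n * 'I_k -> F) : \prod_b G b = \prod_y \prod_i G (y, i).
  by rewrite pair_bigA /=; apply: eq_bigr => -[].
have XE S : X S = 2^-1 ^+ (\sum_(y in Y) #|avail (graph_of S) c y|)%N.
  rewrite -prodrXr /X pairE [RHS]big_mkcond; apply: eq_bigr => y _.
  case: ifP => yY; last by apply: big1 => i _; rewrite /t /= yY mul0r subr0.
  rewrite -prodr_const [RHS]big_mkcond; apply: eq_bigr => i _.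
  rewrite -avail_label // /t /= yY; case: (i \in _) => /=; lra.
rewrite mulrC -[2 ^+ B]invrK -exprVn.
have hB : 0 < (2^-1 : F) ^+ B by apply: exprn_gt0; lra.
apply: le_trans (Markov p_ge0 p_le1 hB X0 _) _.
  by move=> S hS; rewrite XE; apply: ler_wiXn2l => //; lra.
apply: ler_wpM2r; first by rewrite invr_ge0 ltW.
rewrite /X block_indep pairE -prodr_const [leRHS]big_mkcond; apply: ler_prod => y _.
case: ifP => yY; last first.
  by rewrite big1 ?lexx ?ler01 // => i _; rewrite /t /= yY mul0r subr0.
have pout01 i : 0 <= \prod_(e | label e == Some (y, i)) pout p e <= 1.
  by rewrite prod_pout exprn_ge0 ?q_ge0 //= exprn_ile1 ?q_ge0 ?q_le1.
apply/andP; split.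
  apply: prodr_ge0 => i _; rewrite /t /= yY; have := pout01 i; lra.
apply: ler_prod => i _; rewrite /t /= yY; apply/andP; split; first by have := pout01 i; lra.
have : (1 - p) ^+ #|color_class i| <= \prod_(e | label e == Some (y, i)) pout p e.
  by rewrite prod_pout; apply: ler_wiXn2l; rewrite ?q_ge0 ?q_le1 ?card_block.
lra.
Qed.
End Availability.

Section Proper.
Variable k : nat.
Implicit Types f : {ffun 'I_n -> 'I_k}.

Lemma Ex_proper :
  Ex (fun S => #|[set f : {ffun 'I_n -> 'I_k} | proper_coloring (graph_of S) f]|%:R) =
  \sum_(f : {ffun 'I_n -> 'I_k}) (1 - p) ^+ mono f.
Proof.
transitivity (\sum_(f : {ffun 'I_n -> 'I_k}) Pr (fun S => proper_coloring (graph_of S) f)).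
  under [RHS]eq_bigr do rewrite PrE.
  rewrite -Ex_sum; apply: eq_Ex => S.
  rewrite -sum1_card natr_sum big_mkcond /=; apply: eq_bigr => f _.
  by rewrite inE; case: (proper_coloring _ _).
apply: eq_bigr => f _; rewrite /mono -prod_pout.
transitivity (Pr (fun S => [disjoint S & [set e : edge | f e.1 == f e.2]])).
  by rewrite !PrE; apply: eq_Ex => S; rewrite proper_disjoint.
by rewrite Pr_avoid; apply: eq_bigl => e; rewrite inE.
Qed.

End Proper.

Definition inner_edges S (X : {set 'I_n}) := [set e in S | (e.1 \in X) && (e.2 \in X)].

Lemma arcs_le S X : (arcs (graph_of S) X <= 2 * #|inner_edges S X|)%N.
Proof.
pose sw e : edge := (e.2, e.1).
have sub : [set e : edge | (e.1 \in X) && ((e.2 \in X) && graph_of S e.1 e.2)] \subset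
   inner_edges S X :|: sw @: inner_edges S X.
  apply/subsetP => -[a b]; rewrite inE /graph_of /= => /and3P[aX bX /orP[h|h]]; rewrite in_setU.
    by rewrite inE h aX bX.
  apply/orP; right; apply/imsetP; exists (b, a) => //; by rewrite inE h aX bX.
apply: leq_trans (subset_leq_card sub) _; apply: leq_trans (leq_card_setU _ _) _.
by rewrite mul2n -addnn leq_add2l leq_imset_card.
Qed.

Lemma Pr_inner_edges X t : Pr (fun S => (t <= #|inner_edges S X|)%N) <=
  'C(#|X| * #|X|, t)%:R * p ^+ t.
Proof.
pose U := [set e : edge | [&& up_edge e, e.1 \in X & e.2 \in X]].
pose D := [set M : {set edge} | M \subset U & #|M| == t].
have cU : (#|U| <= #|X| * #|X|)%N.
  rewrite -cardsX; apply/subset_leq_card/subsetP => e; rewrite !inE => /and3P[_ -> ->] //.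
rewrite -Pr_valid; apply: (@le_trans _ _ (Pr (fun S => [exists (M | M \in D), M \subset S]))).
  apply: Pr_le => // S /andP[/forall_inP vS /subset_card[M [MS cM]]].
  apply/existsP; exists M; rewrite inE cM eqxx andbT; apply/andP; split; apply/subsetP => e eM.
    by have := subsetP MS _ eM; rewrite !inE => /and3P[/vS he -> ->]; rewrite /up_edge he.
  by have := subsetP MS _ eM; rewrite inE => /andP[].
apply: le_trans (Pr_union p_ge0 p_le1 _ _) _.
have -> : 'C(#|X| * #|X|, t)%:R * p ^+ t = \sum_(i < 'C(#|X| * #|X|, t)) p ^+ t :> F.
  by rewrite sumr_const card_ord mulr_natl.
rewrite sumr_const card_ord.
apply: (@le_trans _ _ (\sum_(M in D) p ^+ t)).
  apply: ler_sum => M; rewrite inE => /andP[/subsetP MU /eqP cM].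
  rewrite Pr_contains -cM -prodr_const; apply: ler_prod => e /MU; rewrite inE => /andP[ue _].
  by rewrite /pin ue p_ge0 lexx.
rewrite sumr_const; apply: ler_wpMn2l; first exact: exprn_ge0.
by rewrite cards_draws leq_bin2l.
Qed.

Lemma Pr_dense s t : Pr (fun S => [exists (X : {set 'I_n} | #|X| == s), t <= #|inner_edges S X|]%N) <=
  'C(n, s)%:R * ('C(s * s, t)%:R * p ^+ t).
Proof.
apply: le_trans (Pr_union p_ge0 p_le1 _ _) _.
apply: (@le_trans _ _ (\sum_(X : {set 'I_n} | #|X| == s) ('C(s * s, t)%:R * p ^+ t))).
  by apply: ler_sum => X /eqP <-; apply: Pr_inner_edges.
rewrite sumr_const [leRHS]mulr_natl; apply: ler_wpMn2l.
  by rewrite mulr_ge0 ?exprn_ge0.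
rewrite -[X in 'C(X, _)]card_ord -cardsT -cards_draws; apply/eq_leq/eq_card => X.
by rewrite inE subsetT.
Qed.
End Events.

(* [exp] and [ln] would otherwise read their arguments in [R_scope]. *)
Bind Scope ring_scope with RbaseSymbolsImpl.R.
Arguments exp x%_ring_scope.
Arguments ln x%_ring_scope.

(** * The exponential function and the logarithm *)

Lemma expD (x y : R) : exp (x + y) = exp x * exp y.
Proof. by rewrite -!RealsE exp_plus. Qed.
Lemma expe0 : exp 0 = 1 :> R. Proof. by have := exp_0; rewrite !RealsE. Qed.
Lemma exp_ge1 (x : R) : 1 + x <= exp x.
Proof. by have /RleP := exp_ineq1_le x; rewrite !RealsE. Qed.
Lemma exp_gt0 (x : R) : 0 < exp x.
Proof. by have /RltP := exp_pos x; rewrite !RealsE. Qed.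
Lemma exp_ge0 (x : R) : 0 <= exp x. Proof. exact/ltW/exp_gt0. Qed.
Lemma expN (x : R) : exp (- x) = (exp x)^-1.
Proof. by have := exp_Ropp x; rewrite !RealsE. Qed.
Lemma exp_le (x y : R) : x <= y -> exp x <= exp y.
Proof.
move=> h; have -> : y = x + (y - x) by ring.
rewrite expD ler_peMr ?exp_ge0 //; apply: le_trans (exp_ge1 _); lra.
Qed.
Lemma expM_nat (x : R) m : exp (x *+ m) = exp x ^+ m.
Proof. by elim: m => [|m IH]; rewrite ?mulr0n ?expe0 // mulrS expD IH exprS. Qed.
Lemma exp_nat (x : R) m : exp (m%:R * x) = exp x ^+ m.
Proof. by rewrite mulr_natl expM_nat. Qed.
Lemma exp_sum (I : finType) (P : pred I) (x : I -> R) :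
  exp (\sum_(i | P i) x i) = \prod_(i | P i) exp (x i).
Proof. by apply: (big_morph exp expD expe0). Qed.
Lemma lnK (x : R) : 0 < x -> exp (ln x) = x.
Proof. by move=> /RltP h; apply: exp_ln; move: h; rewrite !RealsE. Qed.
Lemma expK (x : R) : ln (exp x) = x. Proof. exact: ln_exp. Qed.
Lemma ln_le (x y : R) : 0 < x -> x <= y -> ln x <= ln y.
Proof.
move=> x0; rewrite le_eqVlt => /orP[/eqP -> //|/RltP h]; apply/ltW/RltP/ln_increasing => //.
by move/RltP: x0; rewrite !RealsE.
Qed.
Lemma exp_nat_ln (x : R) m : 0 < x -> x ^+ m = exp (m%:R * ln x).
Proof. by move=> x0; rewrite exp_nat lnK. Qed.
Lemma exp2_le m : 2 ^+ m <= exp m%:R.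
Proof.
rewrite -[m%:R]mulr1 exp_nat; apply: lerXn2r; rewrite ?nnegrE ?exp_ge0 //.
by apply: le_trans (exp_ge1 1); lra.
Qed.

(** * The tail bound in exponential form *)

Section Tail.
Variables (n : nat) (p : R).
Hypotheses (p_ge0 : 0 <= p) (p_lt1 : p < 1).
Let p_le1 : p <= 1. Proof. exact: ltW. Qed.
Definition rate := - ln (1 - p).
Notation Pr := (Pr p).

Lemma exp_rate m : (1 - p) ^+ m = exp (- (rate * m%:R)).
Proof. by rewrite exp_nat_ln ?subr_gt0 // /rate; congr exp; ring. Qed.

Lemma rate_ge : p <= rate.
Proof.
rewrite /rate lerNr -[X in _ <= X]expK; apply: ln_le; first by rewrite subr_gt0.
exact: exp_ge1.
Qed.
Lemma rate_ge0 : 0 <= rate. Proof. exact: le_trans rate_ge. Qed.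

(** [exp x >= 1 + x] would be too weak, since [1 / (1 - p)] exceeds [1 + p + p^2]. Halving the
    exponent gains [x^2 / 4 >= p^2 / 4], and this covers the remainder [p^3 / (1 - p)] as long as
    [p <= 1/5]. *)
Lemma rate_le : p <= 5^-1 -> rate <= p + p ^+ 2.
Proof.
move=> p5; rewrite /rate lerNl -[X in X <= _]expK; apply: ln_le; first exact: exp_gt0.
have h : (1 + (p + p ^+ 2) / 2) ^+ 2 <= exp (p + p ^+ 2).
  rewrite [in leRHS](_ : p + p ^+ 2 = 2%:R * ((p + p ^+ 2) / 2)); last by field.
  rewrite exp_nat; apply: lerXn2r; rewrite ?nnegrE ?exp_ge0 ?exp_ge1 //.
  by rewrite addr_ge0 // divr_ge0 // addr_ge0 // exprn_ge0.
rewrite expN -[leRHS]invrK; rewrite lef_pV2 ?posrE ?exp_gt0 ?invr_gt0 ?subr_gt0 //.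
apply: le_trans h; rewrite -[(1 - p)^-1]mul1r ler_pdivrMr ?subr_gt0 //.
nra.
Qed.

Lemma prod_exp (I : finType) (x : I -> R) : (forall i, 0 <= 1 - x i) ->
  \prod_i (1 - x i) <= exp (- \sum_i x i).
Proof.
move=> h; rewrite -sumrN exp_sum; apply: ler_prod => i _; rewrite h /=.
exact: exp_ge1.
Qed.

(** The tangent to [exp] at the mean [a] lies below the graph, and its linear terms cancel in the
    sum. *)
Lemma jensen_exp k (x : 'I_k -> R) : (0 < k)%N ->
  k%:R * exp ((\sum_i x i) / k%:R) <= \sum_i exp (x i).
Proof.
move=> k0; have k0' : (k%:R : R) != 0 by rewrite pnatr_eq0 -lt0n.
set a := _ / _.
have h i : exp a * (1 + (x i - a)) <= exp (x i).
  rewrite [in leRHS](_ : x i = a + (x i - a)); last by ring.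
  by rewrite expD ler_wpM2l ?exp_ge0 ?exp_ge1.
apply: le_trans (ler_sum _ (fun i _ => h i)); rewrite -mulr_sumr big_split /= sumrB !sumr_const card_ord.
rewrite mulrC; apply: ler_wpM2l; first exact: exp_ge0.
have -> : a *+ k = \sum_i x i by rewrite -mulr_natr /a mulfVK.
by rewrite subrr addr0.
Qed.

(** By convexity equal colour classes are the worst case, in which a vertex keeps
    [k * exp (- (rate * m / k))] colours on average. The division by 2 stems from the factors
    [1 - q / 2] of [avail_tail]. *)
Lemma avail_tail_exp k (c : coloring n k) (Y : {set 'I_n}) B m : (0 < k)%N ->
  Y \subset uncolored c -> (#|~: uncolored c| <= m)%N ->
  Pr (fun S => (\sum_(y in Y) #|avail (graph_of S) c y| <= B)%N) <=
  exp (B%:R - #|Y|%:R * k%:R * exp (- (rate * m%:R / k%:R)) / 2).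
Proof.
move=> k0 Yc cm; apply: le_trans (avail_tail p_ge0 p_le1 Yc B) _.
rewrite expD; apply: ler_pM; rewrite ?exprn_ge0 ?exp2_le //.
  apply: prodr_ge0 => i _; rewrite exp_rate.
  have : exp (- (rate * #|color_class c i|%:R)) <= 1.
    by rewrite -[leRHS]expe0; apply: exp_le; rewrite oppr_le0 mulr_ge0 ?rate_ge0 ?ler0n.
  lra.
set A := \prod_i _.
have A0 : 0 <= A.
  apply: prodr_ge0 => i _; have := exprn_ile1 #|color_class c i| (q_ge0 p_le1) (q_le1 p_ge0); lra.
rewrite -2!mulrA -mulrN [k%:R * _]mulrA exp_nat; apply: lerXn2r; rewrite ?nnegrE ?exp_ge0 //.
apply: le_trans (prod_exp _) _.
  by move=> i; have := exprn_ile1 #|color_class c i| (q_ge0 p_le1) (q_le1 p_ge0); lra.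
apply: exp_le; rewrite lerN2 -mulr_suml ler_pM2r; last by lra.
have k0' : 0 < (k%:R : R) by rewrite ltr0n.
apply: le_trans (_ : k%:R * exp ((\sum_i - (rate * #|color_class c i|%:R)) / k%:R) <= _); last first.
  by apply: le_trans (jensen_exp _ k0) _; apply: ler_sum => i _; rewrite exp_rate.
apply: ler_wpM2l; first exact: ltW.
apply: exp_le; rewrite sumrN [leRHS]mulNr lerN2 -mulr_sumr ler_pM2r ?invr_gt0 //.
apply: ler_wpM2l; first exact: rate_ge0.
rewrite -natr_sum ler_nat; apply: leq_trans cm.
under eq_bigr => i _ do rewrite -sum1_card.
rewrite (exchange_big_dep (mem (~: uncolored c))) /= => [|i u _]; last first.
  by rewrite !inE => /eqP ->.
rewrite -sum1_card; apply: leq_sum => u; rewrite !inE; case cu: (c u) => [a|//] _.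
rewrite (big_pred1 a) // => i; rewrite inE cu; apply/eqP/eqP => [[]//|-> //].
Qed.
End Tail.

(** * Union bounds over positions and vertex sets *)

Lemma graph_of_sym n (S : {set 'I_n * 'I_n}) : symmetric (graph_of S).
Proof. by move=> u v; rewrite /graph_of orbC. Qed.

Lemma graph_of_irr n (S : {set 'I_n * 'I_n}) : valid_edge_set S -> irreflexive (graph_of S).
Proof.
move=> /forall_inP vS u; rewrite /graph_of orbb; apply/negP => /vS /=.
by rewrite ltnn.
Qed.

Lemma card_coloring n k : #|coloring n k| = (k.+1 ^ n)%N.
Proof. by rewrite card_ffun card_option !card_ord. Qed.

Section Bounds.
Variables (n : nat) (p : R).
Hypotheses (p_ge0 : 0 <= p) (p_lt1 : p < 1).
Let p_le1 : p <= 1. Proof. exact: ltW. Qed.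
Notation Pr := (Pr p).
Notation edge := ('I_n * 'I_n)%type.

Definition dense_bound s t : R := 'C(n, s)%:R * ('C(s * s, t)%:R * p ^+ t).

Lemma Pr_exists_dense m (t : nat -> nat) :
  Pr (fun S => [exists (X : {set 'I_n} | (0 < #|X| <= m)%N), t #|X| <= #|inner_edges S X|]%N) <=
  \sum_(1 <= s < m.+1) dense_bound s (t s).
Proof.
apply: (@le_trans _ _ (Pr (fun S => [exists (s : 'I_m.+1 | (0 < s)%N),
    [exists (X : {set 'I_n} | #|X| == s), t s <= #|inner_edges S X|]%N]))).
  apply: Pr_le => // S /existsP[X /andP[/andP[X0 Xm] tX]].
  apply/existsP; exists (Ordinal (Xm : #|X| < m.+1)%N); rewrite X0 /=.
  by apply/existsP; exists X; rewrite eqxx.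
apply: le_trans (Pr_union p_ge0 p_le1 _ _) _.
rewrite big_add1 /= big_mkord [leLHS]big_mkcond big_ord_recl /= add0r.
apply: ler_sum => s _; exact: Pr_dense.
Qed.

(** Three bad events are excluded: in some position, [g] uncoloured vertices with few available
    colours altogether; a set of at most [14 * g] vertices that is too dense; a set of at most [s1]
    vertices spanning more than 3/2 edges per vertex. The first is a union over [(k + 1)^n] partial
    colourings and [2^n] sets. *)
Theorem Pr_not_A_wins k l r g s1 J B0 :
  (0 < k)%N -> (0 < g)%N -> (0 < l)%N -> (4 <= r)%N -> (25 * 552 + 27 <= B0)%N ->
  (threshold J B0 (4 * l * r) 0 <= k.+1)%N -> (30 * level_size r (2 * g) J + 20 <= s1)%N ->
  Pr (fun S => ~~ @A_wins_game n k (graph_of S)) <=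
  (k.+1 ^ n * 2 ^ n)%:R * exp ((g * (threshold J B0 (4 * l * r) 0 + 4 * l))%:R
      - g%:R * k%:R * exp (- (rate p * n%:R / k%:R)) / 2)
  + (\sum_(1 <= s < (14 * g).+1) dense_bound s (l * s)
     + \sum_(1 <= s < s1.+1) dense_bound s ((3 * s)./2.+1)).
Proof.
move=> k0 g0 l0 r4 hB ht hs; set B := (g * _)%N.
pose E1 S := [exists (cY : coloring n k * {set 'I_n} | (cY.2 \subset uncolored cY.1) && (#|cY.2| == g)),
  (\sum_(y in cY.2) #|avail (graph_of S) cY.1 y| <= B)%N].
pose E2 (S : {set edge}) := [exists (X : {set 'I_n} | (0 < #|X| <= 14 * g)%N), l * #|X| <= #|inner_edges S X|]%N.
pose E3 (S : {set edge}) := [exists (X : {set 'I_n} | (0 < #|X| <= s1)%N), (3 * #|X|)./2.+1 <= #|inner_edges S X|]%N.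
rewrite -Pr_valid; apply: (@le_trans _ _ (Pr (fun S => E1 S || (E2 S || E3 S)))).
  apply: Pr_le => // S /andP[vS]; apply: contraR; rewrite !negb_or => /and3P[h1 h2 h3].
  apply: (A_wins_of_pseudorandom (graph_of_sym S) (graph_of_irr vS) g0 l0 r4 _ _ hB _ ht hs).
  - move=> c Y Yc cY; rewrite ltnNge; apply: contra h1 => h.
    by apply/existsP; exists (c, Y); rewrite Yc cY eqxx.
  - move=> X X0 Xg; apply: leq_ltn_trans (arcs_le _ _) _; rewrite -mulnA ltn_pmul2l // ltnNge.
    by apply: contra h2 => h; apply/existsP; exists X; rewrite X0 Xg.
  - move=> X Xs; apply: leq_trans (arcs_le _ _) _; have [X0|X0] := posnP #|X|.
      rewrite (_ : inner_edges S X = set0) ?cards0 //; apply/setP => e; rewrite !inE.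
      by move/eqP: X0; rewrite cards_eq0 => /eqP ->; rewrite inE andbF.
    have : (#|inner_edges S X| < (3 * #|X|)./2.+1)%N.
      by rewrite ltnNge; apply: contra h3 => h; apply/existsP; exists X; rewrite X0 Xs.
    rewrite ltnS => h; apply: leq_trans (_ : 2 * (3 * #|X|)./2 <= _)%N; first by rewrite leq_mul2l.
    by rewrite mul2n -[leqRHS](odd_double_half (3 * #|X|)) leq_addl.
apply: le_trans (Pr_or p_ge0 p_le1 _ _) _; apply: lerD; last first.
  apply: le_trans (Pr_or p_ge0 p_le1 _ _) _; apply: lerD.
    exact: (Pr_exists_dense _ (fun s => l * s)%N).
  exact: (Pr_exists_dense _ (fun s => (3 * s)./2.+1)).
apply: le_trans (Pr_union p_ge0 p_le1 _ _) _; set bd := exp _.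
apply: (@le_trans _ _ (\sum_(cY : coloring n k * {set 'I_n}) bd)); last first.
  by rewrite sumr_const card_prod card_coloring -[#|{set 'I_n}|%N]cardsT -powersetT card_powerset cardsT card_ord mulr_natl.
rewrite [leLHS]big_mkcond; apply: ler_sum => -[c Y] _ /=; case: ifP => [/andP[Yc /eqP cY]|_].
  rewrite /bd -cY; apply: avail_tail_exp => //.
  by rewrite -[X in (_ <= X)%N]card_ord max_card.
exact: exp_ge0.
Qed.

(** [b i] is the supply of colours promised to B when [2 * i + 1] vertices are coloured, and [bd]
    bounds the probability that a given position breaks the promise. The second summand is Markov's
    inequality for the number of proper colourings. *)
Theorem Pr_A_wins_gen k T (b : nat -> R) (bd : R) : (2 * T <= n)%N -> (forall i, 0 < b i) ->
  (forall i (c : coloring n k), (i < T)%N -> #|~: uncolored c| = (2 * i).+1 ->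
     Pr (fun S => [forall v in uncolored c, #|avail (graph_of S) c v|%:R < b i]) <= bd) ->
  0 <= bd ->
  Pr (fun S => @A_wins_game n k (graph_of S)) <=
  (k.+1 ^ n)%:R * bd + (\sum_(f : {ffun 'I_n -> 'I_k}) (1 - p) ^+ mono f) / \prod_(0 <= i < T) b i.
Proof.
move=> hT b0 hb bd0.
pose A (c : coloring n k) := [exists i : 'I_T, #|~: uncolored c| == (2 * i).+1].
pose E1 S := [exists (c | A c), [forall v in uncolored c,
   #|avail (graph_of S) c v|%:R < b (#|~: uncolored c|)./2]].
pose E2 (S : {set edge}) := \prod_(0 <= i < T) b i <= #|[set f : {ffun 'I_n -> 'I_k} | proper_coloring (graph_of S) f]|%:R.
have half i : (2 * i).+1./2 = i by lia.
rewrite -Pr_valid; apply: (@le_trans _ _ (Pr (fun S => E1 S || E2 S))).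
  apply: Pr_le => // S /andP[vS hA]; case: (boolP (E1 S)) => //= h1.
  apply: (A_wins_proper_colorings (graph_of_sym S) (graph_of_irr vS) hT _ _ hA).
    by move=> i; apply: ltW.
  move=> i c iT cc; have : A c by apply/existsP; exists (Ordinal iT); rewrite cc.
  move=> Ac; move: h1; rewrite negb_exists => /forallP/(_ c); rewrite Ac /= negb_forall_in.
  by case/exists_inP => v vU; rewrite -leNgt cc half => h; exists v.
apply: le_trans (Pr_or p_ge0 p_le1 _ _) _; apply: lerD; last first.
  rewrite -Ex_proper; apply: Markov => //; first by apply: prodr_gt0.
apply: le_trans (Pr_union p_ge0 p_le1 _ _) _.
apply: (@le_trans _ _ (\sum_(c : coloring n k) bd)).
  rewrite [leLHS]big_mkcond; apply: ler_sum => c _; case: ifP => // /existsP[i /eqP ci].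
  by rewrite ci half; apply: hb.
by rewrite sumr_const card_coloring mulr_natl.
Qed.
End Bounds.

(** * Estimates *)

Lemma nat_floor (x : R) : 0 <= x -> exists m : nat, m%:R <= x < m%:R + 1.
Proof.
move=> x0; exists (Num.truncn x); have := truncn_itv x0.
by rewrite -[in X in X -> _]addn1 natrD.
Qed.

Lemma exp_pow_ge (m : nat) (x : R) : (0 < m)%N -> 0 <= x -> (x / m%:R) ^+ m <= exp x.
Proof.
move=> m0 x0; have m0' : (m%:R : R) != 0 by rewrite pnatr_eq0 -lt0n.
rewrite [in leRHS](_ : x = m%:R * (x / m%:R)); last by field.
rewrite exp_nat; apply: lerXn2r; rewrite ?nnegrE ?exp_ge0 ?divr_ge0 ?ler0n //.
by apply: le_trans (exp_ge1 _); lra.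
Qed.

Lemma double_succ_le i T : (i < T)%N -> ((2 * i).+1 <= 2 * T)%N. Proof. lia. Qed.
Lemma half_remaining n u m T : n = (u + m)%N -> (m <= 2 * T)%N -> (4 * T <= n)%N -> (n <= u * 2)%N.
Proof. lia. Qed.
Lemma double_le_of_quadruple T n : (4 * T <= n)%N -> (2 * T <= n)%N. Proof. lia. Qed.

(** [find] returns [n.+1] when its search fails, which the hypothesis excludes. *)
Lemma A_wins_game_chromatic n (adj : rel 'I_n) :
  (game_chromatic_number adj < n.+1)%N -> @A_wins_game n (game_chromatic_number adj) adj.
Proof.
rewrite /game_chromatic_number => h; set P := fun k => _.
have hP : has P (iota 0 n.+1) by rewrite has_find size_iota.
by have := nth_find 0%N hP; rewrite nth_iota // add0n.
Qed.

Lemma game_chromatic_le n k (adj : rel 'I_n) :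
  @A_wins_game n k adj -> (game_chromatic_number adj <= k)%N.
Proof.
move=> hA; rewrite /game_chromatic_number; set P := fun k => _.
have [kn|kn] := ltnP k n.+1; last first.
  by apply: leq_trans (find_size _ _) _; rewrite size_iota.
rewrite leqNgt; apply/negP => /(before_find 0%N); rewrite nth_iota // add0n.
by rewrite /P hA.
Qed.

Lemma exp_decay (N : R) : 1 <= N -> (N + 1) * (2%:R * exp (- (N / 2%:R))) <= 64%:R / N.
Proof.
move=> N1; have hx : 0 <= N / 2%:R by lra.
have h := exp_pow_ge (m := 2) isT hx.
rewrite expN; set E := exp _ in h *; have E0 : 0 < E by apply: exp_gt0.
rewrite mulrA ler_pdivrMr // mulrAC ler_pdivlMr; last lra.
have : 64%:R * (N / 2%:R / 2%:R) ^+ 2 <= 64%:R * E by rewrite ler_wpM2l.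
nra.
Qed.

(** [3 * x + 1 <= 4 * x] unless [x = 0], and from size 0 the recursion stays at 0 because
    [r >= 2]. *)
Lemma level_size_geometric r g j : (2 <= r)%N -> (level_size r g j * r ^ j <= 4 ^ j * g)%N.
Proof.
move=> r2; elim: j => [|j IH]; first by rewrite muln1 mul1n.
apply: (@leq_trans (4 * (level_size r g j * r ^ j))); last by rewrite expnS -mulnA leq_mul2l.
rewrite expnS mulnA [leqRHS]mulnA leq_mul2r; apply/orP; right; rewrite [level_size _ _ _]/=.
have [->|h] := posnP (level_size r g j); first by rewrite divn_small.
by apply: leq_trans (leq_divM _ _) _; lia.
Qed.

Lemma exp1_le3 : exp 1 <= 3%:R.
Proof. by have /RleP := exp_le_3; rewrite !RealsE. Qed.

(** Induction by [(1 + 1/t)^t <= e]; this takes the place of Stirling's formula in [bin_le_pow]. *)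
Lemma self_pow_le (t : nat) : (t%:R : R) ^+ t <= exp t%:R * t`!%:R.
Proof.
elim: t => [|t IH]; first by rewrite expr0 expe0 mul1r.
have [->|t0] := posnP t; first by rewrite expr1 mulr1 (le_trans _ (exp_ge1 _)) // lerDr.
have t0' : 0 < (t%:R : R) by rewrite ltr0n.
have h : (t.+1%:R : R) ^+ t <= exp 1 * t%:R ^+ t.
  rewrite (_ : t.+1%:R = (1 + t%:R^-1) * t%:R :> R); last first.
    by rewrite mulrDl mul1r mulVf ?gt_eqF // -addn1 natrD.
  rewrite exprMn ler_wpM2r ?exprn_ge0 //.
  rewrite (_ : exp 1 = exp (t%:R^-1) ^+ t); last by rewrite -exp_nat mulfV ?gt_eqF.
  by apply: lerXn2r; rewrite ?nnegrE ?exp_ge0 ?exp_ge1 // addr_ge0 ?invr_ge0 ?ltW.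
rewrite exprS factS natrM mulrCA ler_wpM2l ?ler0n // -addn1 natrD expD.
rewrite [exp t%:R * _]mulrC -mulrA; apply: le_trans (_ : exp 1 * t%:R ^+ t <= _).
  by rewrite -natrD addn1.
by rewrite ler_wpM2l ?exp_ge0.
Qed.

Lemma bin_le_pow (a t : nat) : (0 < t)%N -> ('C(a, t)%:R : R) <= (3%:R * a%:R / t%:R) ^+ t.
Proof.
move=> t0; have t0' : 0 < (t%:R : R) by rewrite ltr0n.
rewrite exprMn exprVn ler_pdivlMr ?exprn_gt0 //.
apply: le_trans (ler_wpM2l (ler0n _ _) (self_pow_le t)) _.
rewrite mulrCA -[_ * t`!%:R]natrM bin_ffact exprMn; apply: ler_pM; rewrite ?exp_ge0 ?ler0n //.
  rewrite -[t%:R]mulr1 exp_nat; apply: lerXn2r; rewrite ?nnegrE ?exp_ge0 ?ler0n //.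
  exact: exp1_le3.
rewrite -natrX ler_nat ffact_prod -[X in (_ <= _ ^ X)%N]card_ord -prod_nat_const.
by apply: leq_prod => i _; apply: leq_subr.
Qed.

Lemma dense_bound_le n (p : R) s t : 0 <= p -> (0 < s)%N -> (0 < t)%N ->
  dense_bound n p s t <= (3%:R * n%:R / s%:R) ^+ s * (3%:R * s%:R ^+ 2 * p / t%:R) ^+ t.
Proof.
move=> p0 s0 t0; rewrite /dense_bound; apply: ler_pM; rewrite ?mulr_ge0 ?exprn_ge0 ?bin_le_pow //.
rewrite (_ : 3%:R * s%:R ^+ 2 * p / t%:R = 3%:R * (s * s)%:R / t%:R * p); last by rewrite natrM; ring.
by rewrite exprMn ler_wpM2r ?exprn_ge0 // bin_le_pow.
Qed.

Lemma sum_halves (c : R) (f : nat -> R) m : 0 <= c ->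
  (forall s, (0 < s < m.+1)%N -> f s <= c * 2^-1 ^+ s.-1) ->
  \sum_(1 <= s < m.+1) f s <= 2%:R * c.
Proof.
move=> c0 hf; apply: (@le_trans _ _ (c * (2%:R - 2%:R * 2^-1 ^+ m))); last first.
  by rewrite mulrC ler_wpM2r // gerBl mulr_ge0 // exprn_ge0 // invr_ge0.
elim: m hf => [|m IH] hf; first by rewrite big_geq // expr0 mulr1 subrr mulr0.
rewrite big_nat_recr //=; apply: le_trans (lerD (IH _) (hf m.+1 _)) _.
- by move=> s /andP[s0 sm]; apply: hf; rewrite s0 ltnW.
- by rewrite ltnS leqnn.
- by rewrite -mulrDr ler_wpM2l //= exprS; lra.
Qed.

(** One factor [z] provides the small constant [c], the others provide the geometric decay; the
    factor [s] is absorbed by [s <= 2^(s-1)]. *)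
Lemma small_power (z c : R) s : 0 <= z <= 4^-1 -> z <= s%:R * c -> (0 < s)%N ->
  z ^+ s <= c * 2^-1 ^+ s.-1.
Proof.
case: s => // s /andP[z0 z4] zc _ /=.
have c0 : 0 <= c by have : 0 <= s.+1%:R * c := le_trans z0 zc; rewrite pmulr_rge0 // ltr0n.
rewrite exprS; apply: (@le_trans _ _ (s.+1%:R * c * 4^-1 ^+ s)).
  by apply: ler_pM; rewrite ?exprn_ge0 //; apply: lerXn2r; rewrite ?nnegrE //; lra.
rewrite (_ : 4^-1 = 2^-1 * 2^-1 :> R); last by field.
rewrite exprMn [_ * c]mulrC -mulrA ler_wpM2l // mulrA ler_piMl ?exprn_ge0 ?invr_ge0 //.
rewrite exprVn ler_pdivrMr ?exprn_gt0 // mul1r -natrX ler_nat.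
by elim: {zc}s => // s IH; rewrite expnS mul2n -addnn -addn1 leq_add // expn_gt0.
Qed.

(** The counterpart of [small_power] for terms with natural exponent [3 s / 2]: comparing squares
    avoids half-integral powers. *)
Lemma small_power2 (z c a : R) s : 0 <= z <= 16^-1 -> z <= s%:R * c ^+ 2 -> (0 < s)%N ->
  0 <= c -> 0 <= a -> a ^+ 2 <= z ^+ s -> a <= c * 2^-1 ^+ s.-1.
Proof.
case: s => // s /andP[z0 z4] zc _ c0 a0 /= h.
have h2 : 0 <= c * 2^-1 ^+ s by rewrite mulr_ge0 ?exprn_ge0 ?invr_ge0.
rewrite -(ler_pXn2r (n := 2)) ?nnegrE //; apply: le_trans h _.
rewrite exprS; apply: (@le_trans _ _ (s.+1%:R * c ^+ 2 * 16^-1 ^+ s)).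
  by apply: ler_pM; rewrite ?exprn_ge0 //; apply: lerXn2r; rewrite ?nnegrE //; lra.
rewrite exprMn [_ * c ^+ 2]mulrC -mulrA ler_wpM2l ?sqr_ge0 // -exprM mulnC exprM.
rewrite (_ : 16^-1 = 4^-1 * 2^-1 ^+ 2 :> R); last by field.
rewrite exprMn mulrA ler_piMl ?exprn_ge0 ?invr_ge0 //.
rewrite exprVn ler_pdivrMr ?exprn_gt0 // mul1r -natrX ler_nat.
by apply: ltn_expl.
Qed.

Lemma three_halves s : (3 * s <= 2 * (3 * s)./2.+1)%N. Proof. lia. Qed.

(** * The range of [d] and the lower bound *)

Section Regime.
Variables (n : nat) (d L N p : R).
Hypothesis L_def : L = ln d.
Hypothesis N_def : N = n%:R.
Hypothesis p_def : p = d / N.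
Hypothesis dL : exp 1000%:R <= d.
Hypothesis dn : d ^+ 4 <= N.

Lemma d_gt0 : 0 < d. Proof. exact: lt_le_trans (exp_gt0 _) dL. Qed.
Lemma L_ge : 1000%:R <= L.
Proof. by rewrite -[leLHS]expK L_def; apply: ln_le => //; apply: exp_gt0. Qed.
Lemma d_ge : 1000%:R <= d.
Proof. by apply: le_trans dL; apply: le_trans (exp_ge1 _); lra. Qed.
Lemma expL : exp L = d. Proof. by rewrite L_def lnK ?d_gt0. Qed.
Lemma L_le_d : L <= d. Proof. by rewrite -expL; apply: le_trans (exp_ge1 _); lra. Qed.

Lemma N_big : 1000%:R * d <= N.
Proof.
have h := d_ge; apply: le_trans dn; rewrite exprSr ler_wpM2r ?(ltW d_gt0) //.
apply: le_trans h _; rewrite exprS ler_peMr ?(ltW d_gt0) // exprn_ege1 //; have := d_ge; lra.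
Qed.
Lemma N_gt0 : 0 < N. Proof. have := N_big; have := d_ge; lra. Qed.
Lemma n_gt0 : (0 < n)%N. Proof. by have := N_gt0; rewrite N_def ltr0n. Qed.
Lemma p_ge0 : 0 <= p. Proof. by rewrite p_def divr_ge0 ?(ltW d_gt0) ?(ltW N_gt0). Qed.
Lemma p_le : p <= 1000%:R^-1.
Proof. rewrite p_def ler_pdivrMr ?N_gt0 //; have := N_big; lra. Qed.
Lemma p_lt1 : p < 1. Proof. have := p_le; lra. Qed.
Lemma pN : p * N = d. Proof. by rewrite p_def mulfVK // gt_eqF ?N_gt0. Qed.

Notation lam := (rate p).
Lemma lam_ge : d <= lam * N.
Proof. by rewrite -pN ler_wpM2r ?(ltW N_gt0) ?(rate_ge p_lt1). Qed.
Lemma lam_le : lam * N <= d * (1 + p).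
Proof.
have -> : d * (1 + p) = (p + p ^+ 2) * N by rewrite -pN; ring.
rewrite ler_wpM2r ?(ltW N_gt0) ?rate_le ?p_ge0 ?p_lt1 //; have := p_le; lra.
Qed.
Lemma lam_ge0 : 0 <= lam. Proof. exact: rate_ge0 p_ge0 p_lt1. Qed.

(** Logarithm of the first-moment bound: [k^n] colourings, each with at least [(n^2 / k - n) / 2]
    monochromatic pairs by [mono_ge]. *)
Definition mono_exponent (k : nat) : R := N * ln k%:R - lam * (N ^+ 2 / k%:R - N) / 2.

Lemma sum_mono k : (0 < k)%N ->
  \sum_(f : {ffun 'I_n -> 'I_k}) (1 - p) ^+ mono f <= exp (mono_exponent k).
Proof.
move=> k0; have K0 : 0 < (k%:R : R) by rewrite ltr0n.
rewrite /mono_exponent expD [X in exp (X * ln _)]N_def exp_nat lnK //.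
apply: (@le_trans _ _ (\sum_(f : {ffun 'I_n -> 'I_k}) exp (- (lam * (N ^+ 2 / k%:R - N) / 2)))).
  apply: ler_sum => f _; rewrite exp_rate ?p_lt1 //; apply: exp_le.
  rewrite lerN2 -mulrA ler_wpM2l ?lam_ge0 // ler_pdivrMr ?ltr0n //.
  rewrite lerBlDr ler_pdivrMr // mulrC N_def -!natrX -natrM -natrD -natrM ler_nat.
  by have := mono_ge f; rewrite [(2 * _)%N]mulnC.
by rewrite sumr_const card_ffun !card_ord -natrX mulr_natl.
Qed.

(** With so few colours the first moment already rules out any proper colouring: for [T = 0] the
    product is 1. *)
Lemma Pr_A_wins_small k : (0 < k)%N -> k%:R * (4%:R * L) < d ->
  Pr p (fun S => @A_wins_game n k (graph_of S)) <= exp (- (N / 2)).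
Proof.
move=> k0 kd; have K0 : 0 < (k%:R : R) by rewrite ltr0n.
apply: le_trans (Pr_A_wins_gen p_ge0 p_lt1 (T := 0) (b := fun _ => 1) (bd := 0) _ _ _ _) _ => //.
rewrite mulr0 add0r big_geq // divr1; apply: le_trans (sum_mono k0) _; apply: exp_le.
have Ll := L_ge; have h1 := lam_ge; have h2 := lam_le; have h3 := p_le; have h4 := N_big.
have lk : ln k%:R <= L.
  rewrite L_def; apply: ln_le => //; apply: le_trans (ltW kd); rewrite ler_peMr ?ltW //; lra.
have h5 : 4%:R * L * N <= lam * (N ^+ 2 / k%:R).
  rewrite (_ : lam * _ = (lam * N) * N / k%:R); last by ring.
  rewrite ler_pdivlMr //; have : d * N <= lam * N * N by rewrite ler_wpM2r ?(ltW N_gt0).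
  have : k%:R * (4%:R * L) * N <= d * N by rewrite ler_wpM2r ?(ltW N_gt0) // ltW.
  lra.
have h6 : N * ln k%:R <= N * L by rewrite ler_wpM2l ?(ltW N_gt0).
have h7 : N * 1 <= N * L by rewrite ler_wpM2l ?(ltW N_gt0) //; lra.
have h8 : d * (1 + p) <= d * 2 by rewrite ler_wpM2l ?(ltW d_gt0) //; lra.
rewrite /mono_exponent mulrBr; move: h1 h2 h5 h6 h7 h8 h4; clear.
move: (lam * N) (lam * (N ^+ 2 / k%:R)) (N * ln k%:R) (d * (1 + p)) => X Y Z W; lra.
Qed.

(** The first [T] odd numbers add up to [T^2]. *)
Lemma prod_geometric k (a : R) T :
  \prod_(0 <= i < T) (a * exp (- (lam * (2 * i).+1%:R / k%:R))) =
  a ^+ T * exp (- (lam * (T%:R ^+ 2) / k%:R)).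
Proof.
elim: T => [|T IH].
  by rewrite big_geq // expr0 mul1r expr0n mulr0 mul0r oppr0 expe0.
rewrite big_nat_recr //= IH mulrACA -exprSr -expD; congr (_ * exp _).
by rewrite -(addn1 (2 * T)) -(addn1 T); ring.
Qed.

Lemma exp_beats : 32%:R * L * (L + 1) <= exp (L / 10%:R).
Proof.
have h := L_ge; have hx : 0 <= L / 10%:R by lra.
apply: le_trans (exp_pow_ge (m := 8) isT hx).
rewrite (_ : L / 10%:R / 8%:R = L / 80%:R); last by field.
have : 12%:R ^+ 6 * (L / 80%:R) ^+ 2 <= (L / 80%:R) ^+ 8.
  rewrite (exprD _ 6 2); apply: ler_wpM2r; first exact: sqr_ge0.
  by apply: lerXn2r; rewrite ?nnegrE; lra.
apply: le_trans; rewrite (_ : 12%:R ^+ 6 = 12%:R * 12%:R * 12%:R * 12%:R * 12%:R * 12%:R :> R); last by ring.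
nra.
Qed.

Lemma N_ge_sqr : d * L <= N.
Proof.
have h := d_ge; apply: le_trans dn; apply: (@le_trans _ _ (d * d)).
  by rewrite ler_wpM2l ?(ltW d_gt0) // L_le_d.
rewrite -expr2 (exprD d 2 2) ler_peMr ?sqr_ge0 // exprn_ege1 //; lra.
Qed.

Section Exponent.
Variables (k T : nat) (K x : R).
Hypothesis K_def : K = k%:R.
(** With [be = K * L / d] and [tau * be * N] moves of B, the exponent has leading coefficient
    [1 - 1/(2 be) - (tau - tau^2) be]. This is lowest at [tau = 1/2], where it is negative for
    [be < 2 - sqrt 2]; but the supply of about [K * d^(- 2 tau)] colours would then be less than
    one. The choice [tau = 7/16] retains about [d^(1/8) / L] colours and still reaches 4/7, just
    below [2 - sqrt 2]. *)
Hypothesis x_def : x = 7%:R / 16%:R * K * L * N / d.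
Hypothesis K_low : d <= 4%:R * L * K.
Hypothesis K_high : 7%:R * L * K < 4%:R * d.
Hypothesis T_floor : T%:R <= x < T%:R + 1.

Lemma K_gt0 : 0 < K.
Proof.
have h := d_gt0; have hL := L_ge; rewrite ltNge; apply/negP => K0.
have : 4%:R * L * K <= 0 by rewrite mulr_ge0_le0 //; lra.
by have := K_low; lra.
Qed.

Lemma lnK_le : ln K <= L - ln L.
Proof.
have hL := L_ge; rewrite -[leRHS]expK; apply: ln_le; first exact: K_gt0.
rewrite expD expN expL lnK; last lra.
rewrite ler_pdivlMr; last lra.
have := K_high; have := K_gt0; have := d_gt0; nra.
Qed.

Lemma lnK4_ge : L - ln L - 4%:R <= ln (K / 4%:R).
Proof.
have hL := L_ge; rewrite -[leLHS]expK; apply: ln_le; first exact: exp_gt0.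
rewrite !expD !expN expL lnK; last lra.
have h2 : 16%:R <= exp 4%:R by apply: le_trans (exp2_le 4); lra.
have h3 : d / L <= 4%:R * K.
  by rewrite ler_pdivrMr; [have := K_low; lra|lra].
have h4 : 0 <= d / L by rewrite divr_ge0 ?(ltW d_gt0) //; lra.
apply: (@le_trans _ _ (d / L / 16%:R)); last lra.
by rewrite ler_wpM2l // lef_pV2 ?posrE //; lra.
Qed.

Lemma lnL_bounds : 0 <= ln L <= L / 2%:R.
Proof.
have hL := L_ge; apply/andP; split.
  by rewrite -[leLHS]expK expe0; apply: ln_le; lra.
rewrite -[leRHS]expK; apply: ln_le; first lra.
have hx : 0 <= L / 2%:R by lra.
by apply: le_trans (exp_pow_ge (m := 2) isT hx); nra.
Qed.

(* With [be = K * L / d] the coefficient of [N * L] is [1 - 1/(2 be) - (63/256) be],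
   which increases to -1/64 at [be = 4/7]. *)
Lemma main_exponent : mono_exponent k - T%:R * ln (K / 4%:R) + lam * T%:R ^+ 2 / K <= - N.
Proof.
have Kp := K_gt0; have dp := d_gt0; have Np := N_gt0; have hL := L_ge.
have [T1 T2] := andP T_floor; have /andP[l0 l1] := lnL_bounds.
have l2 := lnK_le; have l3 := lnK4_ge.
pose be := K * L / d; pose ga := d / (K * L).
have bega : be * ga = 1 by rewrite /be /ga; field; rewrite !gt_eqF //; lra.
have be0 : 0 < be by rewrite /be divr_gt0 // mulr_gt0 //; lra.
have be1 : be <= 4%:R / 7%:R.
  rewrite /be ler_pdivrMr //; have := K_high; lra.
have dK : d / K = L * ga by rewrite /ga; field; rewrite !gt_eqF //; lra.
have xE : x = 7%:R / 16%:R * be * N by rewrite x_def /be; ring.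
have ga0 : 0 < ga by rewrite /ga divr_gt0 // mulr_gt0 //; lra.
clearbody be ga.
have A1 : N * ln K <= N * (L - ln L) by rewrite ler_wpM2l // ltW.
have A2 : N * (L * ga) <= lam * (N ^+ 2 / K).
  rewrite -dK (_ : lam * _ = N * ((lam * N) / K)); last by ring.
  by rewrite ler_wpM2l ?(ltW Np) // ler_pM2r ?invr_gt0 // lam_ge.
have A3 : lam * N <= d * 2%:R.
  by apply: le_trans lam_le _; rewrite ler_wpM2l ?(ltW dp) //; have := p_le; lra.
have l4 : ln (K / 4%:R) <= L.
  have : ln (K / 4%:R) <= ln K by apply: ln_le; lra.
  by lra.
have A4 : - (T%:R * ln (K / 4%:R)) <= - (x * (L - ln L - 4%:R)) + L.
  have : (x - 1) * ln (K / 4%:R) <= T%:R * ln (K / 4%:R) by rewrite ler_wpM2r //; lra.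
  have : x * (L - ln L - 4%:R) <= x * ln (K / 4%:R).
    by rewrite ler_wpM2l // (le_trans _ T1) // ler0n.
  by lra.
have A5 : lam * T%:R ^+ 2 / K <= 49%:R / 256%:R * be * N * L + N.
  apply: (@le_trans _ _ (lam * x ^+ 2 / K)).
    rewrite ler_pM2r ?invr_gt0 // ler_wpM2l ?lam_ge0 //.
    by apply: lerXn2r; rewrite ?nnegrE ?ler0n // (le_trans _ T1) // ler0n.
  rewrite xE (_ : lam * _ / K = lam * N * (49%:R / 256%:R * be ^+ 2 * N / K)); last by field; rewrite gt_eqF.
  have h0 : 0 <= 49%:R / 256%:R * be ^+ 2 * N / K.
    by rewrite divr_ge0 ?(ltW Kp) // mulr_ge0 ?(ltW Np) // mulr_ge0 ?sqr_ge0 //; lra.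
  apply: le_trans (ler_wpM2r h0 lam_le) _.
  rewrite [leLHS](_ : _ = 49%:R / 256%:R * be * (be * (d / K)) * N * (1 + p)); last by field; rewrite gt_eqF.
  rewrite dK (_ : be * (L * ga) = L); last by rewrite mulrCA bega mulr1.
  rewrite [leLHS](_ : _ = 49%:R / 256%:R * be * N * L + 49%:R / 256%:R * be * (L * (p * N))); last by ring.
  rewrite lerD2l pN; have h1 := N_ge_sqr; rewrite [L * d]mulrC.
  have h2 : 0 <= d * L by rewrite mulr_ge0 ?(ltW dp) //; lra.
  apply: le_trans h1; rewrite ler_piMl //; lra.
have A6 : 65%:R / 64%:R <= ga / 2%:R + 63%:R / 256%:R * be.
  have g1 : 7%:R / 4%:R <= ga by nra.
  nra.
have A7 : N * L * (65%:R / 64%:R) <= N * L * (ga / 2%:R + 63%:R / 256%:R * be).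
  by rewrite ler_wpM2l // mulr_ge0 ?(ltW Np) //; lra.
have A8 : N * ln L * (7%:R / 16%:R * be) <= N * ln L * 1.
  by rewrite ler_wpM2l ?mulr_ge0 ?(ltW Np) //; lra.
have A9 : N * be <= N * 1 by rewrite ler_wpM2l ?(ltW Np) //; lra.
have A10 : N * 1000%:R <= N * L by rewrite ler_wpM2l ?(ltW Np).
have B1 := N_big; have B2 := L_le_d; have B3 := d_ge.
rewrite /mono_exponent -K_def [lam * (_ - _)]mulrBr; rewrite xE in A4.
move: A1 A2 A3 A4 A5 A7 A8 A9 A10 B1 B2 B3.
move: (lam * T%:R ^+ 2 / K) => X5; move: (T%:R * ln (K / 4%:R)) => X4.
move: (lam * (N ^+ 2 / K)) (lam * N) (N * ln K) => X2 X3 X1.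
lra.
Qed.
End Exponent.

(** While at most [2 * T] vertices are coloured, at least [n / 2] are not, and all of them fall
    short together with probability at most [exp (- mu)]. As [mu] is at least of order
    [n * d^(1/10) / L], this beats the [(k + 1)^n] positions. *)
Lemma Pr_A_wins_main (k : nat) : d <= 4%:R * L * k%:R -> 7%:R * L * k%:R < 4%:R * d ->
  Pr p (fun S => @A_wins_game n k (graph_of S)) <= 2%:R * exp (- N).
Proof.
move=> kl kh; pose K : R := k%:R.
have K0 : 0 < K by apply: (K_gt0 (K := K)).
have k0 : (0 < k)%N by move: K0; rewrite /K ltr0n.
have hL := L_ge; have hd := d_gt0; have hN := N_gt0.
pose x := 7%:R / 16%:R * K * L * N / d.
have x0 : 0 <= x by rewrite /x !(divr_ge0, mulr_ge0) ?(ltW hd) ?(ltW hN) ?(ltW K0) //; lra.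
have [T Tx] := nat_floor x0; have [T1 T2] := andP Tx.
have xN : 4%:R * x <= N.
  rewrite /x (_ : 4%:R * _ = (7%:R * L * K) / (4%:R * d) * N); last by field; rewrite gt_eqF.
  rewrite ler_piMl ?(ltW hN) // ler_pdivrMr; last lra.
  by rewrite mul1r ltW.
have T4 : (4 * T <= n)%N.
  by rewrite -(ler_nat R) natrM -N_def; apply: le_trans xN; rewrite ler_wpM2l.
pose b i := K / 4%:R * exp (- (lam * (2 * i).+1%:R / K)).
have b0 i : 0 < b i by rewrite /b mulr_gt0 ?exp_gt0 //; lra.
pose mu := N / 8%:R * K * exp (- (9%:R / 10%:R * L)).
have Kx : N * (L + 1) <= mu.
  rewrite /mu -mulrA (_ : N / 8%:R * _ = N * (K * exp (- (9%:R / 10%:R * L)) / 8%:R)); last by field.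
  rewrite ler_wpM2l ?(ltW hN) // ler_pdivlMr; last lra.
  have -> : exp (- (9%:R / 10%:R * L)) = exp (L / 10%:R) / d.
    by rewrite -expL -expN -expD; congr exp; field.
  have h := exp_beats.
  have hKd : d^-1 * d = 1 by rewrite mulVf // gt_eqF.
  have : (L + 1) * 8%:R * d <= K * exp (L / 10%:R).
    apply: (@le_trans _ _ ((L + 1) * 8%:R * (4%:R * L * K))).
      by rewrite ler_wpM2l //; lra.
    rewrite (_ : _ * _ = K * (32%:R * L * (L + 1))); last by ring.
    by rewrite ler_wpM2l ?(ltW K0).
  by rewrite mulrA ler_pdivlMr.
have lnk1 : ln (k.+1%:R) <= L.
  rewrite L_def; apply: ln_le => //; rewrite -addn1 natrD -/K.
  have : L * K * 7%:R < 4%:R * d by move: kh; rewrite -/K; lra.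
  have := d_ge; nra.
have step i (c : coloring n k) : (i < T)%N -> #|~: uncolored c| = (2 * i).+1 ->
  Pr p (fun S => [forall v in uncolored c, #|avail (graph_of S) c v|%:R < b i]) <= exp (- mu).
  move=> iT cc; set U := uncolored c; set m := (2 * i).+1 in cc *.
  have cU : (n = #|U| + m)%N by have := cardsC U; rewrite cc card_ord.
  have m2T : (m <= 2 * T)%N by exact: double_succ_le.
  have U2 : N / 2%:R <= #|U|%:R.
    rewrite ler_pdivrMr; last lra.
    by rewrite N_def -natrM ler_nat; apply: half_remaining cU m2T T4.
  pose e := exp (- (lam * m%:R / K)).
  have be : b i = K / 4%:R * e by [].
  have e0 : 0 < e by apply: exp_gt0.
  have ub0 : 0 <= #|U|%:R * b i by rewrite mulr_ge0 ?ler0n // ltW.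
  have [B /andP[B1 B2]] := nat_floor ub0.
  apply: le_trans (_ : Pr p (fun S => (\sum_(y in U) #|avail (graph_of S) c y| <= B)%N) <= _).
    apply: Pr_le; [exact: p_ge0|exact/ltW/p_lt1|].
    move=> S /forall_inP h; rewrite -ltnS -(ltr_nat R) -[B.+1]addn1 natrD; apply: le_lt_trans B2.
    rewrite natr_sum mulr_natl -sumr_const; apply: ler_sum => v vU; exact/ltW/h.
  apply: le_trans (avail_tail_exp p_ge0 p_lt1 B k0 (subxx U) (_ : (_ <= m)%N)) _; first by rewrite cc.
  apply: exp_le; rewrite -/K -/e.
  (* [b i] is half of the [K * e / 2] in the tail bound, so half of the exponent survives. *)
  apply: (@le_trans _ _ (- (#|U|%:R * K * e / 4%:R))); first by rewrite be in B1; lra.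
  rewrite lerN2 /mu.
  (* Twice the 7/16 of [x] is 7/8, and [7/8 * (1 + p) <= 9/10]. *)
  have ee : exp (- (9%:R / 10%:R * L)) <= e.
    apply: exp_le; rewrite lerN2 ler_pdivrMr //.
    have h1 : m%:R <= 2%:R * x.
      by apply: (@le_trans _ _ (2%:R * T%:R)); [rewrite -natrM ler_nat|rewrite ler_wpM2l].
    apply: le_trans (ler_wpM2l lam_ge0 h1) _.
    rewrite /x (_ : _ * _ = lam * N * (7%:R / 8%:R * K * L / d)); last by field; rewrite gt_eqF.
    have h2 : 0 <= 7%:R / 8%:R * K * L / d by rewrite divr_ge0 ?(ltW hd) // mulr_ge0 ?mulr_ge0 ?(ltW K0) //; lra.
    apply: le_trans (ler_wpM2r h2 lam_le) _.
    rewrite [leLHS](_ : _ = (K * L) * (7%:R / 8%:R * (1 + p))); last by field; rewrite gt_eqF.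
    rewrite [leRHS](_ : 9%:R / 10%:R * L * K = (K * L) * (9%:R / 10%:R)); last by ring.
    rewrite ler_wpM2l //; first by rewrite mulr_ge0 ?(ltW K0) //; lra.
    by have := p_le; lra.
  rewrite (_ : #|U|%:R * K * e / 4%:R = (#|U|%:R / 4%:R * K) * e); last by ring.
  apply: ler_pM; rewrite ?exp_ge0 //; first by rewrite !mulr_ge0 ?(ltW K0) ?(ltW hN) ?invr_ge0.
  by rewrite ler_wpM2r ?(ltW K0) //; lra.
have T2n := double_le_of_quadruple T4.
apply: le_trans (Pr_A_wins_gen p_ge0 p_lt1 T2n b0 step (exp_ge0 _)) _.
rewrite mulrDl mul1r; apply: lerD.
  rewrite natrX -[k.+1%:R]lnK ?ltr0n // -exp_nat -expD -N_def; apply: exp_le.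
  have : N * ln k.+1%:R <= N * L by rewrite ler_wpM2l ?(ltW hN).
  by move: Kx; lra.
rewrite /b prod_geometric.
have K40 : 0 < K / 4%:R by lra.
rewrite ler_pdivrMr; last by rewrite mulr_gt0 ?exprn_gt0 ?exp_gt0.
apply: le_trans (sum_mono k0) _.
rewrite exp_nat_ln // -!expD; apply: exp_le.
have := main_exponent (erefl K) (erefl x) kl kh Tx.
lra.
Qed.

Lemma Pr_A_wins_le k : k%:R * (7%:R * L) < 4%:R * d ->
  Pr p (fun S => @A_wins_game n k (graph_of S)) <= 2%:R * exp (- (N / 2%:R)).
Proof.
move=> kh; have N0 := N_gt0; have e0 := exp_ge0 (- (N / 2%:R)).
have [k0|k0] := posnP k.
  apply: le_trans (Pr_A_wins_gen p_ge0 p_lt1 (T := 0) (b := fun _ => 1) (bd := 0) _ _ _ _) _ => //.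
  rewrite mulr0 add0r big_geq // divr1 big1 ?mulr_ge0 // => f _; exfalso.
  have := n_gt0; case: n f => // m f _; by case: (f ord0) => a; rewrite [X in (_ < X)%N]k0.
have [kl|kl] := ltP (k%:R * (4%:R * L)) d.
  by apply: le_trans (Pr_A_wins_small k0 kl) _; lra.
apply: le_trans (Pr_A_wins_main (k := k) _ _) _; [lra|lra|].
rewrite ler_wpM2l //; apply: exp_le; lra.
Qed.

(** Winning with [k] colours is not evidently monotone in [k], so the union runs over all [k] below
    the bound, at the cost of a factor [n + 1]. *)
Theorem Pr_game_chromatic_small :
  Pr p (fun S => (@game_chromatic_number n (graph_of S))%:R * (7%:R * L) < 4%:R * d) <= 64%:R / N.
Proof.
have N0 := N_gt0; have d0 := d_gt0; have Lg := L_ge; have NB := N_big.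
have pg := p_ge0; have pl := ltW p_lt1.
apply: le_trans (_ : Pr p (fun S => [exists (k : 'I_n.+1 | k%:R * (7%:R * L) < 4%:R * d),
    @A_wins_game n k (graph_of S)]) <= _).
  apply: Pr_le => // S hS; set g := game_chromatic_number _ in hS.
  have gn : (g < n.+1)%N.
    rewrite ltnS -(ler_nat R) -N_def leNgt; apply/negP => Ng.
    have : N * (7%:R * L) <= g%:R * (7%:R * L) by rewrite ler_wpM2r //; lra.
    have : N * 1 <= N * (7%:R * L) by rewrite ler_wpM2l //; lra.
    have := d_ge; lra.
  by apply/existsP; exists (Ordinal gn); rewrite hS A_wins_game_chromatic.
apply: le_trans (Pr_union pg pl _ _) _.
apply: (@le_trans _ _ (\sum_(k < n.+1) 2%:R * exp (- (N / 2%:R)))).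
  rewrite [leLHS]big_mkcond; apply: ler_sum => k _; case: ifP => [|_]; first exact: Pr_A_wins_le.
  by rewrite mulr_ge0 ?exp_ge0.
rewrite sumr_const card_ord -[_ *+ n.+1]mulr_natl -addn1 natrD -N_def; apply: exp_decay.
have := d_ge; lra.
Qed.

(** * The parameters of the upper bound *)

Section UpperRegime.
Variable w : R.
Hypothesis w_def : w = exp (L / 20%:R).

Lemma w_gt0 : 0 < w. Proof. by rewrite w_def exp_gt0. Qed.

(* Every parameter of the strategy is, up to rounding, a power of [w = d ^ (1/20)]. *)
Lemma d_eq_pow_w : d = w ^+ 20.
Proof. by rewrite w_def -exp_nat -expL; congr exp; field. Qed.

(** The form [4 * (L + 2)] is the one that [avail_term] consumes. *)
Lemma w_ge_L : 4%:R * L + 8%:R <= w.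
Proof.
have hL := L_ge; have hx : 0 <= L / 20%:R by lra.
rewrite w_def; apply: le_trans (exp_pow_ge (m := 4) isT hx).
rewrite (_ : L / 20%:R / 4%:R = L / 80%:R); last by field.
have -> : (L / 80%:R) ^+ 4 = (L / 80%:R) * ((L / 80%:R) * (L / 80%:R) * (L / 80%:R)) by ring.
have h1 : 12%:R <= L / 80%:R by lra.
have h2 : 12%:R * 12%:R <= (L / 80%:R) * (L / 80%:R) by apply: ler_pM; lra.
have h3 : 12%:R * 12%:R * 12%:R <= (L / 80%:R) * (L / 80%:R) * (L / 80%:R) by apply: ler_pM; lra.
have : (L / 80%:R) * (12%:R * 12%:R * 12%:R) <= (L / 80%:R) * ((L / 80%:R) * (L / 80%:R) * (L / 80%:R)).
  by rewrite ler_wpM2l //; lra.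
lra.
Qed.

Lemma w_ge : 1000%:R <= w.
Proof. have := w_ge_L; have := L_ge; lra. Qed.
Lemma L_le_w : L <= w.
Proof. have := w_ge_L; have := L_ge; lra. Qed.

Lemma w_pow_gt0 m : 0 < w ^+ m. Proof. exact/exprn_gt0/w_gt0. Qed.
Lemma w_pow_step m : 1000%:R * w ^+ m <= w ^+ m.+1.
Proof. by rewrite exprS ler_wpM2r ?w_ge // ltW ?w_pow_gt0. Qed.
Lemma w_pow_ge1 m : 1 <= w ^+ m.
Proof. by apply: exprn_ege1; have := w_ge; lra. Qed.

Lemma N_ge_w : w ^+ 80 <= N.
Proof. by apply: le_trans dn; rewrite d_eq_pow_w -exprM. Qed.

Variables (k l r g s1 B0 : nat).
Hypothesis B0_def : B0 = (25 * 552 + 27)%N.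
Hypothesis k_floor : k%:R <= 12%:R * d / L < k%:R + 1.
Hypothesis l_bounds : w ^+ 8 <= l%:R <= w ^+ 8 + 1.
Hypothesis r_floor : r%:R <= w ^+ 6 < r%:R + 1.
Hypothesis g_bounds : N / w ^+ 15 <= g%:R <= N / w ^+ 15 + 1.
Hypothesis s1_floor : s1%:R <= N / w ^+ 65 < s1%:R + 1.

Lemma B0_le : B0%:R <= w ^+ 2.
Proof.
rewrite B0_def natrD natrM; have := w_pow_step 1; rewrite expr1; have := w_ge; lra.
Qed.

Lemma k_ge : 11%:R * d / L <= k%:R.
Proof.
have /andP[_ h] := k_floor; have hL := L_ge.
have : 1 <= d / L by rewrite ler_pdivlMr; [have := L_le_d; lra|lra].
by move: h; rewrite -!mulrA; lra.
Qed.

Lemma k_ge_w : 11%:R * w ^+ 19 <= k%:R.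
Proof.
apply: le_trans k_ge; have hL := L_ge; rewrite ler_pdivlMr; last lra.
rewrite -mulrA ler_wpM2l // d_eq_pow_w [w ^+ 20]exprSr ler_wpM2l ?L_le_w // ltW ?w_pow_gt0 //.
Qed.

Lemma k_gt0 : (0 < k)%N.
Proof. rewrite -(ltr_nat R); apply: lt_le_trans k_ge_w; have := w_pow_gt0 19; lra. Qed.

Lemma l_gt0 : (0 < l)%N.
Proof. by rewrite -(ltr_nat R); apply: lt_le_trans (w_pow_gt0 8) _; case/andP: l_bounds. Qed.

Lemma g_gt0 : (0 < g)%N.
Proof.
rewrite -(ltr_nat R); apply: lt_le_trans (_ : 0 < N / w ^+ 15) _; last by case/andP: g_bounds.
by rewrite divr_gt0 ?w_pow_gt0 // N_gt0.
Qed.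

Lemma r_ge4 : (4 <= r)%N.
Proof.
rewrite -ltnS -(ltr_nat R) -[r.+1]addn1 natrD; have /andP[_ h] := r_floor.
apply: le_lt_trans h; apply: le_trans (w_pow_step 5); have := w_pow_ge1 5; lra.
Qed.

Lemma lr_le : l%:R * r%:R <= 2%:R * w ^+ 14.
Proof.
have /andP[_ l1] := l_bounds; have /andP[r1 _] := r_floor.
apply: (@le_trans _ _ ((2%:R * w ^+ 8) * w ^+ 6)).
  by apply: ler_pM; rewrite ?ler0n //; have := w_pow_ge1 8; lra.
by rewrite -mulrA -exprD.
Qed.

Lemma threshold0_real : (threshold 10 B0 (4 * l * r) 0)%:R = B0%:R + 40%:R * (l%:R * r%:R) :> R.
Proof. by rewrite /threshold subn0 natrD !natrM; ring. Qed.

Lemma threshold0_le_k : (threshold 10 B0 (4 * l * r) 0 <= k.+1)%N.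
Proof.
rewrite -(ler_nat R) threshold0_real -[k.+1]addn1 natrD.
have h1 := lr_le; have h2 := k_ge_w; have h3 := B0_le.
have h4 : w ^+ 2 <= w ^+ 14 by apply: ler_weXn2l => //; have := w_ge; lra.
have h5 : w ^+ 15 <= w ^+ 19 by apply: ler_weXn2l => //; have := w_ge; lra.
have h6 := w_pow_step 14; have := w_pow_gt0 14; lra.
Qed.

Lemma threshold0_4l_le : (threshold 10 B0 (4 * l * r) 0 + 4 * l)%:R <= w ^+ 16 / 4%:R.
Proof.
rewrite natrD threshold0_real natrM; have /andP[_ l1] := l_bounds.
have h1 := lr_le; have h3 := B0_le.
have h4 : w ^+ 2 <= w ^+ 14 by apply: ler_weXn2l => //; have := w_ge; lra.
have h5 : w ^+ 8 <= w ^+ 14 by apply: ler_weXn2l => //; have := w_ge; lra.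
have h6 := w_pow_step 14; have h7 := w_pow_step 15; have := w_pow_ge1 14; lra.
Qed.

(** From about [2 * N / w^15], ten divisions by [r / 4], with [r] about [w^6], lead to the order of
    [N / w^75]. The remaining factor [w^10] below [N / w^65] swallows the constants. *)
Lemma level_size_s1 : (30 * level_size r (2 * g) 10 + 20 <= s1)%N.
Proof.
have r2 : (2 <= r)%N by apply: ltnW; apply: ltnW; exact: r_ge4.
have h := level_size_geometric (2 * g) 10 r2; set x := level_size _ _ _ in h *.
rewrite -ltnS -(ltr_nat R) -[s1.+1]addn1 [(s1 + 1)%:R]natrD; have /andP[_ hs] := s1_floor.
apply: le_lt_trans hs; rewrite natrD natrM.
pose G := N / w ^+ 65; have GE : N / w ^+ 15 = G * w ^+ 50.
  by rewrite /G (exprD w 50 15) /=; field; rewrite !gt_eqF ?w_gt0.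
have G1 : w ^+ 15 <= G.
  by rewrite /G ler_pdivlMr ?w_pow_gt0 // -exprD N_ge_w.
have /andP[_ g1] := g_bounds; have /andP[_ r1] := r_floor.
have rw : w ^+ 6 / 2%:R <= r%:R by have := w_pow_step 5; have := w_pow_ge1 5; lra.
have h1 : (x%:R : R) * r%:R ^+ 10 <= 4%:R ^+ 10 * (2%:R * g%:R).
  by rewrite -!natrX -!natrM ler_nat.
have h2 : (w ^+ 6 / 2%:R) ^+ 10 <= r%:R ^+ 10.
  by apply: lerXn2r; rewrite ?nnegrE ?ler0n // divr_ge0 ?ltW ?w_pow_gt0.
have h3 : x%:R * (w ^+ 6 / 2%:R) ^+ 10 <= 4%:R ^+ 10 * (2%:R * g%:R).
  by apply: le_trans h1; rewrite ler_wpM2l ?ler0n.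
have h4 : x%:R * w ^+ 60 <= 8%:R ^+ 10 * (2%:R * g%:R).
  rewrite (_ : 8%:R = 4%:R * 2%:R :> R); last by ring.
  rewrite expr_div_n -exprM [x%:R * (_ / _)]mulrA ler_pdivrMr ?exprn_gt0 // in h3.
  by rewrite exprMn mulrAC.
have h5 : x%:R * w ^+ 60 <= 8%:R ^+ 10 * 4%:R * (G * w ^+ 50).
  apply: le_trans h4 _; rewrite -mulrA ler_wpM2l ?exprn_ge0 //.
  have : 1 <= G * w ^+ 50.
    by apply: mulr_ege1; [apply: le_trans (w_pow_ge1 15) G1|apply: w_pow_ge1].
  by rewrite GE in g1; lra.
have h6 : x%:R * w ^+ 10 <= 8%:R ^+ 10 * 4%:R * G.
  rewrite -(ler_pM2r (w_pow_gt0 50)) -[leLHS]mulrA -[leRHS]mulrA.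
  by rewrite -(exprD w 10 50).
have h7 : 8%:R ^+ 10 * 4%:R * 1000%:R <= w ^+ 10.
  apply: le_trans (_ : 1000%:R ^+ 10 <= _); last by apply: lerXn2r; rewrite ?nnegrE ?w_ge ?ltW ?w_gt0.
  apply: (@le_trans _ _ (10%:R ^+ 10 * (10%:R ^+ 20))).
    apply: (@le_trans _ _ (8%:R ^+ 10 * 10%:R ^+ 20)).
      rewrite -mulrA ler_wpM2l ?exprn_ge0 // (_ : 10%:R ^+ 20 = 10%:R ^+ 4 * 10%:R ^+ 16); last by rewrite -exprD.
      have h8 : 1 <= (10%:R : R) ^+ 16 by apply: exprn_ege1; lra.
      have h9 : 10%:R ^+ 4 = 10%:R * 10%:R * 10%:R * 10%:R :> R by ring.
      by rewrite h9; nra.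
    by rewrite ler_wpM2r ?exprn_ge0 //; apply: lerXn2r; rewrite ?nnegrE //; lra.
  have -> : 1000%:R = 10%:R ^+ 3 :> R by ring.
  by rewrite -exprD -exprM.
have h8 : x%:R * 1000%:R <= G.
  have C0 : 0 < (8%:R : R) ^+ 10 * 4%:R by rewrite mulr_gt0 ?exprn_gt0 //; lra.
  rewrite -(ler_pM2l C0) [_ * G]mulrC; rewrite [G * _]mulrC; apply: le_trans h6.
  rewrite (_ : _ * (x%:R * _) = x%:R * (8%:R ^+ 10 * 4%:R * 1000%:R)); last by ring.
  by rewrite ler_wpM2l ?ler0n.
have : 1000%:R * w ^+ 14 <= w ^+ 15 := w_pow_step 14.
have := w_pow_ge1 14; rewrite -/G; lra.
Qed.

(** Even with all vertices coloured, [k >= 11 d / L] guarantees the factor [exp (- L / 10) = w^-2].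
    The resulting scale [w^16] lies above the whole ladder by [threshold0_4l_le]. *)
Lemma avail_rate_ge : w ^+ 16 <= k%:R * exp (- (lam * n%:R / k%:R)).
Proof.
have hL := L_ge; have hd := d_gt0; have kg := k_ge_w.
have K0 : 0 < (k%:R : R) by rewrite ltr0n k_gt0.
have e1 : exp (- (L / 10%:R)) = (w ^+ 2)^-1.
  by rewrite w_def -exp_nat expN; congr (exp _)^-1; field.
have h : lam * n%:R / k%:R <= L / 10%:R.
  rewrite ler_pdivrMr // -N_def; apply: le_trans lam_le _.
  have h1 : 11%:R * d <= k%:R * L by have := k_ge; rewrite ler_pdivrMr //; lra.
  have h2 : d * (1 + p) <= d * (11%:R / 10%:R) by rewrite ler_wpM2l ?(ltW hd) //; have := p_le; lra.
  lra.
apply: (@le_trans _ _ (k%:R * (w ^+ 2)^-1)); last first.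
  by rewrite ler_wpM2l ?(ltW K0) // -e1; apply: exp_le; lra.
rewrite ler_pdivlMr ?w_pow_gt0 // -exprD; apply: le_trans kg.
have := w_pow_step 18; have := w_pow_gt0 18; lra.
Qed.

(** A supply of at least [g * w^16 / 2] against a demand of at most [g * w^16 / 4] leaves
    [N * w / 4 >= N * (L + 2)], while the union bound costs [N * (L + 1)]. *)
Lemma avail_term : (k.+1 ^ n * 2 ^ n)%:R * exp ((g * (threshold 10 B0 (4 * l * r) 0 + 4 * l))%:R
      - g%:R * k%:R * exp (- (lam * n%:R / k%:R)) / 2%:R) <= exp (- N).
Proof.
have hL := L_ge; have hN := N_gt0.
have lnk : ln k.+1%:R <= L.
  rewrite L_def; apply: ln_le; rewrite ?ltr0n // -addn1 natrD.
  have /andP[h _] := k_floor.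
  have h2 : 12%:R * d / L <= d / 2%:R.
    by rewrite ler_pdivrMr; [have := d_gt0; nra|lra].
  have := d_ge; lra.
have h1 : (k.+1 ^ n * 2 ^ n)%:R <= exp (N * (L + 1)).
  rewrite natrM !natrX mulrDr mulr1 expD; apply: ler_pM; rewrite ?exprn_ge0 //.
    rewrite -[k.+1%:R]lnK ?ltr0n // -exp_nat -N_def; apply: exp_le.
    by rewrite ler_wpM2l // ltW.
  by rewrite N_def; apply: exp2_le.
apply: le_trans (ler_wpM2r (exp_ge0 _) h1) _; rewrite -expD; apply: exp_le.
have h2 := avail_rate_ge; have h3 := threshold0_4l_le; have g0 : 0 <= (g%:R : R) by rewrite ler0n.
have h4 := ler_wpM2l g0 h2; have h5 := ler_wpM2l g0 h3.
have h6 : N * w <= g%:R * w ^+ 16.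
  have /andP[gl _] := g_bounds; rewrite ler_pdivrMr ?w_pow_gt0 // in gl.
  by rewrite [w ^+ 16]exprSr mulrA ler_wpM2r // ltW ?w_gt0.
have h7 : N * (4%:R * L + 8%:R) <= N * w by rewrite ler_wpM2l ?w_ge_L // ltW.
rewrite natrM -[g%:R * k%:R * _]mulrA.
move: h4 h5; move: (g%:R * (k%:R * _)) (g%:R * _%:R) => X Y; lra.
Qed.

Lemma sparse_term : \sum_(1 <= s < (14 * g).+1) dense_bound n p s (l * s) <= 2%:R * (d / N).
Proof.
have hN := N_gt0; have hd := d_gt0; have hw := w_ge; have hp := p_ge0.
have /andP[l1 l2] := l_bounds; have /andP[gl gu] := g_bounds.
have l0 : 0 < (l%:R : R) by rewrite ltr0n l_gt0.
have l12 : 12%:R <= (l%:R : R) by apply: le_trans l1; have := w_pow_step 7; have := w_pow_ge1 7; lra.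
have lge : (12 <= l)%N by rewrite -(ler_nat R).
apply: sum_halves; first by rewrite divr_ge0 ?ltW.
move=> s /andP[s0 sm]; have s0' : 0 < (s%:R : R) by rewrite ltr0n.
have ls0 : (0 < l * s)%N by rewrite muln_gt0 l_gt0.
apply: le_trans (dense_bound_le n p_ge0 s0 ls0) _.
pose y := 3%:R * s%:R * p / l%:R.
have -> : 3%:R * s%:R ^+ 2 * p / (l * s)%:R = y.
  by rewrite natrM /y; field; rewrite !gt_eqF.
rewrite [(l * s)%N]mulnC mulnC exprM -exprMn.
have sp : s%:R * p <= 28%:R * w ^+ 5.
  apply: (@le_trans _ _ ((14 * g)%:R * p)); first by rewrite ler_wpM2r ?p_ge0 // ler_nat.
  have N1 : 1 <= N / w ^+ 15.
    rewrite ler_pdivlMr ?w_pow_gt0 // mul1r; apply: le_trans N_ge_w.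
    by apply: ler_weXn2l => //; lra.
  have e : N / w ^+ 15 * p = w ^+ 5.
    by rewrite mulrAC [N * p]mulrC pN d_eq_pow_w (exprD w 5 15) mulfK // gt_eqF ?w_pow_gt0.
  rewrite natrM -e mulrA ler_wpM2r ?p_ge0 //; lra.
have y0 : 0 <= y by rewrite /y divr_ge0 ?mulr_ge0 ?p_ge0 ?ltW.
have yw : y * w ^+ 2 <= 1.
  rewrite /y mulrAC ler_pdivrMr // mul1r; apply: le_trans l1.
  have h1 : s%:R * p * w ^+ 2 <= 28%:R * w ^+ 5 * w ^+ 2 by rewrite ler_wpM2r ?sqr_ge0.
  have h2 : w ^+ 5 * w ^+ 2 = w ^+ 7 by rewrite -exprD.
  have := w_pow_step 7; have := w_pow_gt0 7; rewrite -[leRHS]mulrA h2 in h1; lra.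
have w21 : 1000%:R <= w ^+ 2 by have := w_pow_step 1; rewrite expr1; lra.
have y4 : y <= 4^-1.
  have : y * 4%:R <= y * w ^+ 2 by rewrite ler_wpM2l //; lra.
  lra.
have ysd : y <= s%:R * (d / N).
  rewrite /y p_def ler_pdivrMr // -mulrA [_ * l%:R]mulrC ler_wpM2r //; [exact/mulr_ge0/ltW/divr_gt0|lra].
have e1 : 3%:R * n%:R / s%:R * y = 9%:R * d / l%:R.
  rewrite /y -N_def; have -> : d = p * N by rewrite pN.
  by field; rewrite !gt_eqF.
clearbody y.
have z0 : 0 <= 3%:R * n%:R / s%:R * y ^+ l.
  by rewrite mulr_ge0 ?exprn_ge0 // divr_ge0 // mulr_ge0.
have zy : 3%:R * n%:R / s%:R * y ^+ l <= y.
  (* Twelve of the [l] factors [y] are used: one cancels [n / s], ten cancel [d], and one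
     remains. *)
  have ely : y ^+ l <= y * y * y ^+ 10.
    rewrite -(exprSr y 1) -exprD; apply: ler_wiXn2l => //; lra.
  have y10 : y ^+ 10 * d <= 1.
    rewrite d_eq_pow_w (exprM w 2 10) -exprMn; apply: exprn_ile1 => //.
    by rewrite mulr_ge0 ?sqr_ge0.
  have c0 : 0 <= 3%:R * n%:R / s%:R :> R by rewrite divr_ge0 // mulr_ge0.
  apply: le_trans (ler_wpM2l c0 ely) _.
  rewrite [leLHS](_ : _ = (3%:R * n%:R / s%:R * y) * y * y ^+ 10); last by ring.
  rewrite e1 [leLHS](_ : _ = (y ^+ 10 * d) * (9%:R / l%:R) * y); last by ring.
  have h9 : 9%:R / l%:R <= 1 :> R by rewrite ler_pdivrMr //; lra.
  have h9' : 0 <= 9%:R / l%:R :> R by rewrite divr_ge0.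
  have y10' : 0 <= y ^+ 10 * d by rewrite mulr_ge0 ?exprn_ge0 // ltW.
  by rewrite ler_piMl // mulr_ile1.
apply: small_power => //.
- by rewrite z0 /=; apply: le_trans zy y4.
- exact: le_trans zy ysd.
Qed.

(** The bound for dense sets at [s = 1], where the exponent 3/2 produces a square root. Under
    [d^4 <= N] it is of order at most [N^(-1/8)]. *)
Definition error := Num.sqrt (72%:R * d ^+ 3 / N).

Lemma error_sqr : error ^+ 2 = 72%:R * d ^+ 3 / N.
Proof. by rewrite sqr_sqrtr // divr_ge0 ?mulr_ge0 ?exprn_ge0 ?ltW ?d_gt0 ?N_gt0. Qed.

(** For more than [3 s / 2] edges the square of the first moment is at most [(72 s d^3 / N)^s],
    which decays geometrically as long as [s <= N / w^65]. *)
Lemma local_term : \sum_(1 <= s < s1.+1) dense_bound n p s ((3 * s)./2.+1) <= 2%:R * error.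
Proof.
have hN := N_gt0; have hd := d_gt0; have hw := w_ge; have hp := p_ge0.
have eta0 : 0 <= error by apply: sqrtr_ge0.
have /andP[sl _] := s1_floor.
apply: sum_halves => // s /andP[s0 sm]; have s0' : 0 < (s%:R : R) by rewrite ltr0n.
set t := _.+1; have t3 : (3 * s <= 2 * t)%N by apply: three_halves.
have t3R : 3%:R * s%:R <= 2%:R * t%:R :> R by rewrite -!natrM ler_nat.
have t0' : 0 < (t%:R : R) by rewrite ltr0n.
pose y := 2%:R * s%:R * p.
have y0 : 0 <= y by rewrite /y !mulr_ge0 ?p_ge0.
have sw : s%:R * w ^+ 65 <= N.
  rewrite -ler_pdivlMr ?w_pow_gt0 //; apply: le_trans sl; by rewrite ler_nat.
have spw : s%:R * p * w ^+ 45 <= 1.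
  have : s%:R * w ^+ 65 * p <= N * p by rewrite ler_wpM2r ?p_ge0.
  rewrite [N * p]mulrC pN d_eq_pow_w (exprD w 45 20) mulrA => h.
  rewrite -(ler_pM2r (w_pow_gt0 20)) mul1r; apply: le_trans h; rewrite le_eqVlt; apply/orP; left.
  by apply/eqP; ring.
have y1 : y <= 1.
  have sp0 : 0 <= s%:R * p by rewrite mulr_ge0 ?p_ge0.
  have : s%:R * p * 2%:R <= s%:R * p * w ^+ 45.
    rewrite ler_wpM2l //; have := w_pow_step 44; have := w_pow_ge1 44; lra.
  rewrite /y -mulrA; lra.
have b0 : 0 <= dense_bound n p s t by rewrite /dense_bound !mulr_ge0 ?exprn_ge0 ?p_ge0.
have bnd : dense_bound n p s t <= (3%:R * n%:R / s%:R) ^+ s * y ^+ t.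
  apply: le_trans (dense_bound_le n p_ge0 s0 (ltn0Sn _)) _.
  have c0 : 0 <= 3%:R * n%:R / s%:R :> R by rewrite divr_ge0 // mulr_ge0.
  rewrite ler_wpM2l ?exprn_ge0 //; apply: lerXn2r; rewrite ?nnegrE //.
    by apply: divr_ge0 (ltW t0'); apply: mulr_ge0 => //; apply: mulr_ge0 => //; apply: sqr_ge0.
  rewrite ler_pdivrMr // /y (_ : 3%:R * s%:R ^+ 2 * p = (s%:R * p) * (3%:R * s%:R)); last by ring.
  rewrite (_ : 2%:R * s%:R * p * t%:R = (s%:R * p) * (2%:R * t%:R)); last by ring.
  apply: ler_wpM2l => //; exact: mulr_ge0.
pose z := 72%:R * s%:R * d ^+ 3 / N.
apply: (@small_power2 z) => //.
- have z0 : 0 <= z by rewrite /z divr_ge0 ?ltW // !mulr_gt0 ?exprn_gt0.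
  rewrite z0 /= /z ler_pdivrMr //.
  have h1 : s%:R * d ^+ 3 * w ^+ 5 <= N.
    by rewrite d_eq_pow_w -exprM -mulrA -exprD.
  have h2 : s%:R * d ^+ 3 * 2000%:R <= s%:R * d ^+ 3 * w ^+ 5.
    rewrite ler_wpM2l ?mulr_ge0 ?exprn_ge0 ?ltW //.
    have := w_pow_step 4; have := w_pow_step 3; have := w_pow_ge1 3; lra.
  have := mulr_gt0 s0' (exprn_gt0 3 hd).
  rewrite -mulrA; move: h1 h2; move: (s%:R * d ^+ 3) => X; lra.
- by rewrite error_sqr /z le_eqVlt; apply/orP; left; apply/eqP; ring.
- apply: (@le_trans _ _ (((3%:R * n%:R / s%:R) ^+ s * y ^+ t) ^+ 2)).
    by apply: lerXn2r; rewrite ?nnegrE //; apply: le_trans b0 bnd.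
  rewrite exprMn -!exprM [(s * 2)%N]mulnC [(t * 2)%N]mulnC.
  have c0 : 0 <= 3%:R * n%:R / s%:R :> R by rewrite divr_ge0 // mulr_ge0.
  apply: (@le_trans _ _ ((3%:R * n%:R / s%:R) ^+ (2 * s) * y ^+ (3 * s))).
    rewrite ler_wpM2l ?exprn_ge0 //; exact: ler_wiXn2l.
  rewrite !exprM -exprMn le_eqVlt; apply/orP; left; apply/eqP; congr (_ ^+ s).
  rewrite /z /y p_def -N_def; field; rewrite !gt_eqF //.
Qed.

Lemma error_bound : exp (- N) + (2%:R * (d / N) + 2%:R * error) <= 5%:R * error.
Proof.
have hN := N_gt0; have hd := d_ge; have hd0 := d_gt0; have NB := N_big.
have eta0 : 0 <= error by apply: sqrtr_ge0.
have iN : 0 < N^-1 by rewrite invr_gt0.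
have dN0 : 0 <= d / N by rewrite divr_ge0 ?ltW.
have h1 : d / N <= error.
  rewrite -(ler_pXn2r (n := 2)) ?nnegrE // error_sqr expr_div_n ler_pdivrMr ?exprn_gt0 //.
  rewrite (_ : _ / N * N ^+ 2 = 72%:R * d * N * d ^+ 2); last by field; rewrite gt_eqF.
  rewrite ler_peMl ?sqr_ge0 //; nra.
have h2 : 2%:R * exp (- N) <= d / N.
  rewrite expN ler_pdivlMr // mulrAC ler_pdivrMr ?exp_gt0 //.
  have := exp_ge1 N; nra.
lra.
Qed.

Lemma error_pow : (5%:R * error) ^+ 8 * N <= (5%:R * 72%:R) ^+ 8.
Proof.
have hN := N_gt0; have hd0 := d_gt0.
rewrite exprMn (exprM error 2 4) error_sqr.
have -> : 5%:R ^+ 8 * (72%:R * d ^+ 3 / N) ^+ 4 * N = (5%:R * 72%:R) ^+ 4 * (5%:R ^+ 4 * ((d ^+ 4) ^+ 3 / N ^+ 3)) :> R.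
  by field; rewrite gt_eqF.
rewrite (exprD _ 4 4); apply: ler_wpM2l; first by rewrite exprn_ge0 // mulr_ge0.
rewrite [leRHS]exprMn; apply: ler_wpM2l; first by rewrite exprn_ge0.
apply: (@le_trans _ _ 1); last by apply: exprn_ege1; lra.
rewrite ler_pdivrMr ?exprn_gt0 // mul1r.
by apply: lerXn2r => //; rewrite nnegrE ?exprn_ge0 // ltW.
Qed.

Theorem Pr_not_A_wins_floor :
  Pr p (fun S => ~~ @A_wins_game n k (graph_of S)) <= 5%:R * error.
Proof.
have g0 := g_gt0.
have r4 := r_ge4.
have hB : (25 * 552 + 27 <= B0)%N by rewrite B0_def.
have ht := threshold0_le_k.
have hs := level_size_s1.
apply: le_trans (Pr_not_A_wins n p_ge0 p_lt1 k_gt0 g0 l_gt0 r4 hB ht hs) _.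
apply: le_trans error_bound; apply: lerD; first exact: avail_term.
by apply: lerD; [apply: sparse_term|apply: local_term].
Qed.
End UpperRegime.
End Regime.

(** * From the estimates to the stated limits *)

Lemma Gnp_probE n (p : R) (P : pred (rel 'I_n)) :
  Gnp_prob p P = Pr p (fun S => P (graph_of S)).
Proof.
rewrite -Pr_valid /Gnp_prob /Pr big_mkcond -big_enum /=.
elim: (enum _) => [|S s IH] /=; first by rewrite big_nil.
rewrite big_cons -IH RplusE; congr (_ + _); case: ifP => // /andP[vS _].
by rewrite wt_valid vS !RealsE.
Qed.

Lemma defs_RlebE (x y : R) : Defs.Rleb x y = (x <= y).
Proof. by rewrite /Defs.Rleb; case: Rle_dec => h; apply/esym; [apply/RleP|apply/negbTE/RleP]. Qed.

(** The rate is required in the form [e n ^+ 8 * n <= C] to cover both [64 / n] and the order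
    [n^(-1/8)] of the upper bound without real powers. *)
Lemma Un_cv_one (u e : nat -> R) (C : R) (N0 : nat) :
  (forall n, (N0 <= n)%N -> [/\ 1 - e n <= u n, u n <= 1, 0 <= e n & e n ^+ 8 * n%:R <= C]) ->
  Un_cv u 1.
Proof.
move=> h eps /RltP; rewrite RealsE => eps0.
have e8 : 0 < eps ^+ 8 by rewrite exprn_gt0.
have c0 : 0 <= `|C| / eps ^+ 8 by rewrite divr_ge0 // ltW.
have [m /andP[_ hm]] := nat_floor c0.
exists (maxn N0 m.+1) => n /ssrnat.leP; rewrite geq_max => /andP[n0 nm].
have [h1 h2 h3 h4] := h n n0; apply/RltP; rewrite !RealsE.
have Cn : C < n%:R * eps ^+ 8.
  apply: le_lt_trans (ler_norm _) _; rewrite -ltr_pdivrMr //; apply: lt_le_trans hm _.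
  by rewrite natr1 ler_nat.
have n1 : 0 < (n%:R : R) by rewrite ltr0n; apply: leq_trans nm.
have ee : e n < eps.
  rewrite -(ltr_pXn2r (n := 8)) ?nnegrE //; last exact: ltW.
  rewrite -(ltr_pM2r n1) [eps ^+ 8 * _]mulrC; exact: le_lt_trans h4 Cn.
by rewrite ler0_norm; lra.
Qed.

Lemma Pr_le1 n (p : R) (P : pred {set 'I_n * 'I_n}) : 0 <= p -> p <= 1 -> Pr p P <= 1.
Proof. by move=> p0 p1; rewrite -[leRHS](PrT n p); apply: Pr_le. Qed.

Lemma lower_bound (alpha : R) (d : nat -> R) (N0 : nat) : alpha < 4%:R / 7%:R ->
  (forall n, (N0 <= n)%N -> exp 1000%:R <= d n /\ ((0 < n)%N -> d n ^+ 4 <= n%:R)) ->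
  Un_cv (fun n => Gnp_prob (Rdiv (d n) (INR n)) (fun G : rel 'I_n =>
    Defs.Rleb (Rdiv (Rmult alpha (d n)) (ln (d n))) (INR (game_chromatic_number G)))) 1.
Proof.
move=> ha hd; apply: (@Un_cv_one _ (fun n => 64%:R / n%:R) (64%:R ^+ 8) (maxn N0 1)) => n.
rewrite geq_max => /andP[nN n0]; have [h1 /(_ n0) h3] := hd n nN.
have d0 : 0 < d n := d_gt0 h1.
have n1 : 1 <= (n%:R : R) by rewrite ler1n.
have p0 := p_ge0 erefl h1 h3; have p1 := ltW (p_lt1 erefl h1 h3).
have hL := L_ge erefl h1.
rewrite !RealsE Gnp_probE; split.
- rewrite Pr_compl lerD2l lerN2; apply: le_trans (Pr_game_chromatic_small erefl erefl erefl h1 h3).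
  apply: Pr_le => // S; rewrite defs_RlebE -ltNge !RealsE => hS.
  have L0 : 0 < ln (d n) by lra.
  rewrite ltr_pdivlMr // in hS.
  have : alpha * d n < 4%:R / 7%:R * d n.
    by rewrite ltr_pM2r.
  by rewrite mulrCA mulrA; lra.
- exact: Pr_le1.
- by rewrite divr_ge0.
- rewrite expr_div_n mulrAC ler_pdivrMr ?exprn_gt0 ?ltr0n //.
  by rewrite ler_wpM2l ?exprn_ge0 // -[leLHS]expr1; apply: ler_weXn2l.
Qed.

Lemma nat_ceil (x : R) : 0 <= x -> exists m : nat, x <= m%:R <= x + 1.
Proof.
move=> /nat_floor[m /andP[h1 h2]]; exists m.+1; rewrite -natr1; lra.
Qed.

Lemma upper_bound (alpha : R) (d : nat -> R) (N0 : nat) : 12%:R < alpha ->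
  (forall n, (N0 <= n)%N -> exp 1000%:R <= d n /\ ((0 < n)%N -> d n ^+ 4 <= n%:R)) ->
  Un_cv (fun n => Gnp_prob (Rdiv (d n) (INR n)) (fun G : rel 'I_n =>
    Defs.Rleb (INR (game_chromatic_number G)) (Rdiv (Rmult alpha (d n)) (ln (d n))))) 1.
Proof.
move=> ha hd.
apply: (@Un_cv_one _ (fun n => 5%:R * error (d n) n%:R) ((5%:R * 72%:R) ^+ 8) (maxn N0 1)) => n.
rewrite geq_max => /andP[nN n0]; have [h1 /(_ n0) h3] := hd n nN.
have d0 : 0 < d n := d_gt0 h1.
have n1 : 0 < (n%:R : R) by rewrite ltr0n.
have p0 := p_ge0 erefl h1 h3; have p1 := ltW (p_lt1 erefl h1 h3).
have hL := L_ge erefl h1.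
set L := ln (d n) in hL *; pose w := exp (L / 20%:R).
have wp m : 0 < w ^+ m by rewrite exprn_gt0 // exp_gt0.
have L0 : 0 < L by lra.
have [k kf] : exists k : nat, k%:R <= 12%:R * d n / L < k%:R + 1.
  by apply: nat_floor; rewrite divr_ge0 ?mulr_ge0 // ltW.
have [l lf] := nat_ceil (ltW (wp 8)).
have [r rf] := nat_floor (ltW (wp 6)).
have [g gf] := nat_ceil (ltW (divr_gt0 n1 (wp 15))).
have [s1 sf] := nat_floor (ltW (divr_gt0 n1 (wp 65))).
have main := Pr_not_A_wins_floor erefl erefl erefl h1 h3 (erefl w) (erefl _) kf lf rf gf sf.
rewrite !RealsE Gnp_probE; split.
- rewrite Pr_compl lerD2l lerN2; apply: le_trans main.
  apply: Pr_le => // S; apply: contra => /game_chromatic_le hk.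
  rewrite defs_RlebE !RealsE -/L; apply: le_trans (_ : k%:R <= _); first by rewrite ler_nat.
  have /andP[kl _] := kf; apply: le_trans kl _.
  by rewrite ler_pM2r ?invr_gt0 // ler_pM2r // ltW.
- exact: Pr_le1.
- by rewrite mulr_ge0 // sqrtr_ge0.
- exact: (error_pow h1 h3).
Qed.

(* MathComp had taken over the delimiter [R]. *)
Delimit Scope ring_scope with RR.
Delimit Scope R_scope with R.
Bind Scope R_scope with RbaseSymbolsImpl.R.
Open Scope R_scope.

Lemma pow4_of_Rpower (n : nat) (d : R) : (0 < n)%N -> Rle 0 d ->
  Rle d (Rpower (INR n) (Rdiv 1 4)) -> (d ^+ 4 <= n%:R)%RR.
Proof.
move=> n0 /RleP d0 /RleP h; have n0' : (0 < n%:R :> R)%RR by rewrite ltr0n.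
apply: (@le_trans _ _ (Rpower (INR n) (Rdiv 1 4) ^+ 4)%RR).
  by apply: lerXn2r; rewrite ?nnegrE //; apply: le_trans h.
rewrite /Rpower -exp_nat INRE (_ : 4%:R * _ = ln n%:R)%RR ?lnK //.
by rewrite !RealsE /=; field.
Qed.

Theorem theorem2 :
  (forall alpha : R, Rlt alpha (Rdiv 4 7) ->
    exists d0 : R, forall d : nat -> R,
      (exists N : nat, forall n : nat, (N <= n)%N ->
          Rle d0 (d n) /\ Rle (d n) (Rpower (INR n) (Rdiv 1 4))) ->
      Un_cv (fun n : nat =>
               @Gnp_prob n (Rdiv (d n) (INR n))
                 (fun G => Rleb (Rdiv (Rmult alpha (d n)) (ln (d n)))
                             (INR (@game_chromatic_number n G)))) 1)
  /\
  (forall alpha : R, Rlt 12 alpha ->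
    exists d0 : R, forall d : nat -> R,
      (exists N : nat, forall n : nat, (N <= n)%N ->
          Rle d0 (d n) /\ Rle (d n) (Rpower (INR n) (Rdiv 1 4))) ->
      Un_cv (fun n : nat =>
               @Gnp_prob n (Rdiv (d n) (INR n))
                 (fun G => Rleb (INR (@game_chromatic_number n G))
                             (Rdiv (Rmult alpha (d n)) (ln (d n))))) 1).
Proof.
have hyp d N n : (forall n : nat, (N <= n)%N ->
    Rle (exp 1000%:R%RR) (d n) /\ Rle (d n) (Rpower (INR n) (Rdiv 1 4))) -> (N <= n)%N ->
    (exp 1000%:R <= d n /\ ((0 < n)%N -> d n ^+ 4 <= n%:R))%RR.
  move=> hN /hN[/RleP h1 h2]; split=> // n0; apply: pow4_of_Rpower => //.
  exact/RleP/ltW/(d_gt0 h1).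
(* One [d0] serves all [alpha], since the estimates are proved for the constants 4/7 and 12
   themselves. *)
split=> alpha /RltP ha; rewrite !RealsE /= in ha; exists (exp 1000%:R%RR) => d [N hN].
- exact: lower_bound ha (fun n => @hyp d N n hN).
- exact: upper_bound ha (fun n => @hyp d N n hN).
Qed.
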